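(* (Identification of $f$ with $\gamma$ and $b$ known.) Let $b$ satisfy (B), $f$ satisfy (F), $\gamma>0$, and let $\phi$ be a solution of the Cahn-Hilliard system with parameters $(\gamma,b,f)$. Fix $t\in(0,T)$ with $\phi=\phi(\cdot,t)\in H^3(\Omega)$ and $\partial_t\phi=\partial_t\phi(\cdot,t)\in H^{-1}(\Omega)$. For each $\delta>0$ let data $\phi^\delta=\phi^\delta(\cdot,t)\in H^3(\Omega)$, $\partial_t\phi^\delta=\partial_t\phi^\delta(\cdot,t)\in H^{-1}(\Omega)$ be given with $\phi^\delta(x,t)\in(-1,1)$ for all $x\in\Omega$ and $$\|\phi-\phi^\delta\|_{H^3(\Omega)}\le\delta,\qquad \|\partial_t\phi-\partial_t\phi^\delta\|_{H^{-1}(\Omega)}\le\delta .$$ Define $T,T^\delta:H^2(-1,1)\to H^{-1}(\Omega)$ and $y,y^\delta\in H^{-1}(\Omega)$ by $$T^\delta c=\operatorname{div}\big(c(\phi^\delta)\nabla\phi^\delta\big),\quad y^\delta=\partial_t\phi^\delta+\gamma\operatorname{div}\big(b(\phi^\delta)\nabla\Delta\phi^\delta\big),\quad Tc=\operatorname{div}\big(c(\phi)\nabla\phi\big),\quad y=\partial_t\phi+\gamma\operatorname{div}\big(b(\phi)\nabla\Delta\phi\big).$$ For $\alpha>0$ let $c_\alpha^\delta$ be the minimizer over $c\in H^2(-1,1)$ of $$\|T^\delta c-y^\delta\|_{H^{-1}(\Omega)}^2+\alpha\|c\|_{H^2(-1,1)}^2 .$$ If $\alpha=\alpha(\delta)$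 is chosen such that $\alpha\to0$ and $\delta^2/\alpha\to0$ as $\delta\to0$, then $c_\alpha^\delta$ converges in $H^2(-1,1)$, as $\delta\to0$, to the minimum-norm solution $c^\dagger$ of $Tc=y$.
   Context: $\Omega$ is the $d$-dimensional torus $\mathbb{T}^d$, $d\in\{1,2,3\}$; all functions on $\Omega$ are periodic, and $H^{-1}(\Omega)$ is the dual of $H^1(\Omega)$. Divergences are understood in the weak sense: $\langle\operatorname{div}(g),v\rangle=-\int_\Omega g\cdot\nabla v\,dx$ for $v\in H^1(\Omega)$. (B): $b:\mathbb{R}\to\mathbb{R}_+$, $b\in C^2(\mathbb{R})$, and there are constants $\beta_1,\beta_2,\beta_3,\beta_4$ with $0<\beta_1\le b(s)\le\beta_2$ for all $s$, $\|b'\|_\infty\le\beta_3$, $\|b''\|_\infty\le\beta_4$. (F): $f=F'$ with $F\in C^4(\mathbb{R})$ such that $F(s)\ge-\kappa$ and $F''(s)\ge-\kappa$ for all $s$ and some $\kappa\ge0$, and $|F^{(k)}(s)|\le p_k+q_k|s|^{4-k}$ for $0\le k\le4$ and all $s$, with constants $p_k,q_k\ge0$. The Cahn-Hilliard system with parameters $(\gamma,b,f)$ is $\partial_t\phi=\operatorname{div}(b(\phi)\nabla\mu)$, $\mu=-\gamma\Delta\phi+f(\phi)$ on $\Omega\times(0,T)$ with periodic boundary conditions. At the fixed time $t$ it holds in $H^{-1}(\Omega)$, so that $c=bf'$ (restricted to $(-1,1)$) satisfies $Tc=y$. The minimum-norm solution is the solution of $Tc=y$ of smallest $H^2(-1,1)$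 norm. Elements of $H^2(-1,1)$ are identified with their continuous representatives on $[-1,1]$. *)

(* Defs.v *)
From HB Require Import structures.
From mathcomp Require Import all_boot all_order all_algebra.
From mathcomp Require Import all_classical all_reals all_analysis.

Set Implicit Arguments.
Unset Strict Implicit.
Unset Printing Implicit Defensive.
Import Order.TTheory GRing.Theory Num.Theory.
Import numFieldNormedType.Exports.
Local Open Scope classical_set_scope.
Local Open Scope ring_scope.

(* Functions of class C^k on the real line. *)
Definition Ck_real (R : realType) (k : nat) (g : R -> R) : Prop :=
  (forall j, (j < k)%N -> forall s, derivable (g^`(j)%classic) s 1) /\
  (forall j, (j <= k)%N -> continuous (g^`(j)%classic)).

Definition assumption_B (R : realType) (b : R -> R) : Prop :=
  Ck_real 2 b /\
  exists beta1 beta2 beta3 beta4 : R, 0 < beta1 /\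
    forall s, [/\ beta1 <= b s, b s <= beta2,
                  `|b^`()%classic s| <= beta3 & `|b^`(2)%classic s| <= beta4].

Definition assumption_F (R : realType) (f : R -> R) : Prop :=
  exists (F : R -> R) (kappa : R) (p q : nat -> R),
    [/\ Ck_real 4 F, f = F^`()%classic, 0 <= kappa,
        forall s, - kappa <= F s /\ - kappa <= F^`(2)%classic s &
        forall k, (k <= 4)%N -> 0 <= p k /\ 0 <= q k /\
          forall s, `|F^`(k)%classic s| <= p k + q k * `|s| ^+ (4 - k)].

(* The torus is R^d / Z^d.  Functions on it are Z^d-periodic functions on
   'rV[R]_d, integrated over the cell [0, 1]^d. *)

Definition cons_pair (R : realType) (n : nat)
    (p : measurableTypeR R * n.-tuple R) :
  n.+1.-tuple R := [tuple of p.1 :: p.2].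

Lemma measurable_cons_pair (R : realType) (n : nat) :
  measurable_fun [set: measurableTypeR R * n.-tuple R] (@cons_pair R n).
Proof.
apply: (@measurable_cons _ _ (measurableTypeR R * n.-tuple R)%type R).
- exact: (@measurable_fst _ _ (measurableTypeR R) (n.-tuple R)).
- exact: measurable_snd.
Qed.

(* Lebesgue measure restricted to [0, 1]^d, as an iterated product.  The
   library has a product sigma-algebra on tuples but no measure there. *)
Fixpoint cell_measure (R : realType) (d : nat) : probability (d.-tuple R) R :=
  match d with
  | 0 => \d_ [tuple]
  | n.+1 => distribution (uniform_prob (@ltr01 R) \x cell_measure R n)%E
              (mfun_Sub (mem_set (@measurable_cons_pair R n)))
  end.

Definition row_of_tuple (R : realType) (d : nat) (x : d.-tuple R) : 'rV[R]_d :=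
  \row_i tnth x i.

Section Torus.
Variables (R : realType) (d : nat).
Implicit Types (u v w psi : 'rV[R]_d -> R) (i : 'I_d).

Definition periodic u : Prop :=
  forall i x, u (x + delta_mx 0 i) = u x.

Definition torus_int u : R :=
  \int[cell_measure R d]_x u (row_of_tuple x).

Definition torus_L2 u : Prop :=
  periodic u /\ u \o @row_of_tuple R d \in Lfun (cell_measure R d) 2%:E.

Definition torus_L2norm u : R :=
  fine ('N[cell_measure R d]_2%:E[EFin \o (u \o @row_of_tuple R d)])%E.

Fixpoint torus_Ck (k : nat) psi : Prop :=
  continuous psi /\
  if k is k'.+1 then
    forall i, (forall x, derivable psi x (delta_mx 0 i)) /\
              torus_Ck k' ('D_(delta_mx 0 i) psi)
  else True.

Definition torus_test psi : Prop :=
  periodic psi /\ forall k, torus_Ck k psi.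

Definition is_wpartial i u w : Prop :=
  forall psi, torus_test psi ->
    torus_int (u \* 'D_(delta_mx 0 i) psi) = - torus_int (w \* psi).

(* The weak partial derivative, determined up to a null set; 0 if there is no
   square-integrable one. *)
Definition wpartial i u : 'rV[R]_d -> R :=
  xget (cst 0) [set w | torus_L2 w /\ is_wpartial i u w].

(* H^k of the torus *)
Fixpoint torus_H (k : nat) u : Prop :=
  torus_L2 u /\
  if k is k'.+1 then
    forall i, (exists w, torus_L2 w /\ is_wpartial i u w) /\
              torus_H k' (wpartial i u)
  else True.

(* Unfolds to the sum over j <= k of the squared L^2 norms of the full
   derivative tensors D^j u. *)
Fixpoint torus_Hsqnorm (k : nat) u : R :=
  torus_L2norm u ^+ 2 +
  if k is k'.+1 then \sum_(i < d) torus_Hsqnorm k' (wpartial i u) else 0.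

Definition torus_Hnorm (k : nat) u : R := Num.sqrt (torus_Hsqnorm k u).

(* Elements of H^{-1} are functionals of which only the values on H^1 are
   relevant.  Boundedness implies compatibility with a.e. equality. *)
Definition Hm1 (l : ('rV[R]_d -> R) -> R) : Prop :=
  (forall (a : R) u v, torus_H 1 u -> torus_H 1 v ->
     l (a \*o u \+ v) = a * l u + l v) /\
  exists C : R, forall v, torus_H 1 v -> `|l v| <= C * torus_Hnorm 1 v.

Definition Hm1norm (l : ('rV[R]_d -> R) -> R) : R :=
  sup [set r | exists v, [/\ torus_H 1 v, torus_Hnorm 1 v <= 1 & r = `|l v|]].

Definition Hm1_eq (l l' : ('rV[R]_d -> R) -> R) : Prop :=
  forall v, torus_H 1 v -> l v = l' v.

Definition wdiv (g : 'I_d -> 'rV[R]_d -> R) (v : 'rV[R]_d -> R) : R :=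
  - torus_int (fun x => \sum_(i < d) g i x * wpartial i v x).

Definition laplacian u : 'rV[R]_d -> R :=
  fun x => \sum_(i < d) wpartial i (wpartial i u) x.

Definition chem_potential (gamma : R) (f : R -> R) u : 'rV[R]_d -> R :=
  fun x => - gamma * laplacian u x + f (u x).

(* The Cahn-Hilliard system at one time, in H^{-1}, for the state u and its
   time derivative du. *)
Definition CH_at (gamma : R) (b f : R -> R) u (du : ('rV[R]_d -> R) -> R) :
  Prop :=
  torus_H 1 (chem_potential gamma f u) /\
  Hm1_eq du (wdiv (fun i x => b (u x) *
                              wpartial i (chem_potential gamma f u) x)).

End Torus.

Section Interval.
Variables (R : realType) (a b : R).
Implicit Types (u w psi : R -> R).

Definition itv_L2 u : Prop :=
  u \_ `]a, b[ \in Lfun (@lebesgue_measure R) 2%:E.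

Definition itv_L2norm u : R :=
  fine ('N[@lebesgue_measure R]_2%:E[EFin \o (u \_ `]a, b[)])%E.

(* C^oo functions with compact support in ]a, b[ *)
Definition itv_test psi : Prop :=
  (forall n s, derivable (psi^`(n)%classic) s 1) /\
  exists a' b' : R, [/\ a < a', b' < b &
    forall s, s \notin `[a', b'] -> psi s = 0].

Definition is_wderiv u w : Prop :=
  forall psi, itv_test psi ->
    \int[lebesgue_measure]_(s in `]a, b[) (u s * psi^`()%classic s) =
    - \int[lebesgue_measure]_(s in `]a, b[) (w s * psi s).

Definition wderiv u : R -> R :=
  xget (cst 0) [set w | itv_L2 w /\ is_wderiv u w].

(* H^2(a, b), an element being represented by a function whose restriction to
   [a, b] is the continuous representative; values outside [a, b] are
   irrelevant. *)
Definition itv_H2 u : Prop :=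
  [/\ {within `[a, b], continuous u}, itv_L2 u,
      exists w, itv_L2 w /\ is_wderiv u w &
      exists w, itv_L2 w /\ is_wderiv (wderiv u) w].

Definition itv_H2norm u : R :=
  Num.sqrt (itv_L2norm u ^+ 2 + itv_L2norm (wderiv u) ^+ 2 +
            itv_L2norm (wderiv (wderiv u)) ^+ 2).

End Interval.

Section Identification.
Variables (R : realType) (d : nat).

(* Weak solutions on ]0, T[: dphi is the weak time derivative of phi, with
   values in H^{-1}, and the system holds in H^{-1} at almost every time. *)
Definition CH_solution (T gamma : R) (b f : R -> R)
    (phi : R -> 'rV[R]_d -> R) (dphi : R -> ('rV[R]_d -> R) -> R) : Prop :=
  (forall v, torus_H 1 v ->
    [/\ lebesgue_measure.-integrable `]0, T[
          (EFin \o (fun s => torus_int (phi s \* v))),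
        lebesgue_measure.-integrable `]0, T[ (EFin \o (fun s => dphi s v)) &
        is_wderiv 0 T (fun s => torus_int (phi s \* v))
                      (fun s => dphi s v)]) /\
  {ae lebesgue_measure, forall s, s \in `]0, T[ ->
    [/\ torus_H 3 (phi s), Hm1 (dphi s) &
        CH_at gamma b f (phi s) (dphi s)]}.

(* T c = div (c(u) grad u).  For c in H^2(-1, 1) this is used with u valued in
   [-1, 1]: for the data by hypothesis, for the exact state in the limit. *)
Definition opT (u : 'rV[R]_d -> R) (c : R -> R) : ('rV[R]_d -> R) -> R :=
  wdiv (fun i x => c (u x) * wpartial i u x).

(* y = du + gamma div (b(u) grad Delta u) *)
Definition rhs (gamma : R) (b : R -> R) (u : 'rV[R]_d -> R)
    (du : ('rV[R]_d -> R) -> R) : ('rV[R]_d -> R) -> R :=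
  du \+ gamma \*o wdiv (fun i x => b (u x) * wpartial i (laplacian u) x).

Definition tikhonov (u : 'rV[R]_d -> R) (y : ('rV[R]_d -> R) -> R)
    (alpha : R) (c : R -> R) : R :=
  Hm1norm (opT u c \- y) ^+ 2 + alpha * itv_H2norm (-1) 1 c ^+ 2.

Definition tikhonov_minimizer (u : 'rV[R]_d -> R) (y : ('rV[R]_d -> R) -> R)
    (alpha : R) (c : R -> R) : Prop :=
  itv_H2 (-1) 1 c /\
  forall c', itv_H2 (-1) 1 c' -> tikhonov u y alpha c <= tikhonov u y alpha c'.

Definition min_norm_solution (u : 'rV[R]_d -> R) (y : ('rV[R]_d -> R) -> R)
    (c : R -> R) : Prop :=
  [/\ itv_H2 (-1) 1 c, Hm1_eq (opT u c) y &
      forall c', itv_H2 (-1) 1 c' -> Hm1_eq (opT u c') y ->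
        itv_H2norm (-1) 1 c <= itv_H2norm (-1) 1 c'].

End Identification.

(* Main.v *)
Require Import Defs.
From mathcomp Require Import all_boot all_order all_algebra.
From mathcomp Require Import all_classical all_reals all_analysis.
From mathcomp Require Import measurable_realfun ring lra.
Set Implicit Arguments.
Unset Strict Implicit.
Unset Printing Implicit Defensive.
Import Order.TTheory GRing.Theory Num.Theory.
Import numFieldNormedType.Exports.
Local Open Scope classical_set_scope.
Local Open Scope ring_scope.

(** Everything rests on the estimate | |T^delta c - y^delta| - |T c - y| | <= C delta (1 + |c|).  It follows from
    the embeddings of H^2(-1,1) into the Lipschitz functions and of H^3 of the torus into the continuous ones
    (d <= 3), which turn the H^3 distance of the data into a uniform one.  The equation T c = y is solvable since
    b f' is of class C^2 and, by the chain rule for the weak gradient of f(phi), solves it.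

    Minimizers are found without weak compactness: in a complete space whose norm obeys the parallelogram law, a
    decreasing sequence of closed midpoint-convex sets K_n with elements of bounded norm has a common element p of
    least norm, and elements of K_n (n large) whose norm hardly exceeds that of p are close to p.  Sublevel sets
    of the Tikhonov functional give the minimizers.  The sets {|T c - y| <= 1/n} give the minimum-norm solution
    p = c^dagger and the convergence: comparing the minimizer with p in the functional shows that it enters K_n
    and that its norm is at most |p| + o(1), because alpha and delta^2/alpha tend to 0. *)

(** * Square-integrable functions *)

(** Weak derivatives are chosen representatives, fixed only up to null sets; identities about them
    and about the norms built from them pass through almost everywhere equality, which rests on the
    fact that test functions separate functions. Both embeddings go by duality. On the interval, the
    pairings of u and of u' with a test function are bounded by the L^1 norm of the test function;
    concentrating it at a point turns this into a sup bound and a Lipschitz bound. On the torus, u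
    is tested against a product of one-dimensional periodic kernels of mean one concentrated at a
    point. A kernel minus one has a periodic primitive bounded by one however sharp the kernel is,
    so each coordinate costs one derivative and a factor 2: three derivatives suffice for d <= 3,
    and the constant is 8. In the chain rule, smoothing is replaced by averages along coordinate
    segments: a difference quotient of u is an average of its weak derivative. The exact state
    inherits only the closed range [-1,1] from the data, so coefficients are controlled up to the
    endpoints. *)

Section L2.
Context {dd : measure_display} {T : measurableType dd} {R : realType}.
Variable mu : {measure set T -> \bar R}.
Implicit Types f g h : T -> R.

Local Notation L2 f := (f \in Lfun mu 2%:E).
Local Notation nrm f := (fine ('N[mu]_2%:E[EFin \o f%R])%E).

Lemma L2_measurable f : L2 f -> measurable_fun setT f.
Proof. by rewrite inE => /andP[]; rewrite inE. Qed.

Lemma L2_lin a f g : L2 f -> L2 g -> L2 (a \*o f \+ g).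
Proof.
have h2 : (1 <= 2%:E :> \bar R)%E by rewrite lee_fin ler1n.
have [_ h] := @Lfun_submod_closed _ T R mu _ h2.
exact: h.
Qed.

Lemma L2_0 : L2 (cst 0 : T -> R).
Proof.
have h2 : (1 <= 2%:E :> \bar R)%E by rewrite lee_fin ler1n.
by have [h _] := @Lfun_submod_closed _ T R mu _ h2.
Qed.

Lemma L2_integrable f g : L2 f -> L2 g ->
  mu.-integrable setT (EFin \o (fun x => f x * g x)).
Proof. by move=> hf hg; apply/Lfun1_integrable; exact: Lfun2_mul_Lfun1. Qed.

Lemma L2P f : measurable_fun setT f ->
  mu.-integrable setT (EFin \o (fun x => f x * f x)) -> L2 f.
Proof.
move=> mf /integrableP[_ hi].
rewrite inE; apply/andP; split; rewrite inE//=.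
rewrite /finite_norm unlock poweR_lty//.
apply: le_lt_trans hi.
rewrite le_eqVlt; apply/orP; left; apply/eqP; apply: eq_integral => x _ /=.
by rewrite powR_mulrn// -normrX expr2.
Qed.

Lemma nrm_ge0 f : 0 <= nrm f.
Proof. by rewrite fine_ge0// Lnorm_ge0. Qed.

Lemma nrm_sqr f : L2 f -> nrm f ^+ 2 = \int[mu]_x (f x * f x).
Proof.
move=> hf.
rewrite -powR_mulrn ?nrm_ge0//.
have -> : nrm f `^ 2%:R = fine ('N[mu]_2%:E[EFin \o f] `^ 2%:R)%E.
  have [_] := andP (hf : f \in [predI _ & _]); rewrite inE /= /finite_norm => hfin.
  have hfn : ('N[mu]_2%:E[EFin \o f])%E \is a fin_num.
    by rewrite ge0_fin_numE// Lnorm_ge0.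
  by rewrite -[X in (X `^ _)%E](fineK hfn) poweR_EFin.
rewrite powR_Lnorm// /Rintegral; congr fine; apply: eq_integral => x _ /=.
by rewrite powR_mulrn// -normrX expr2 ger0_norm// -expr2 sqr_ge0.
Qed.

Lemma L2_eq f g : L2 f -> f =1 g -> L2 g.
Proof. by move=> + /funext <-. Qed.

Lemma L2_Z a f : L2 f -> L2 (fun x => a * f x).
Proof.
by move=> hf; apply: L2_eq (L2_lin a hf L2_0) _ => x /=; rewrite addr0.
Qed.

Lemma L2_D f g : L2 f -> L2 g -> L2 (fun x => f x + g x).
Proof.
move=> hf hg; apply: L2_eq (L2_lin 1 hf hg) _ => x /=.
by rewrite mul1r.
Qed.

Lemma L2_B f g : L2 f -> L2 g -> L2 (fun x => f x - g x).
Proof.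
move=> hf hg; apply: L2_eq (L2_lin (-1) hg hf) _ => x /=.
by rewrite mulN1r addrC.
Qed.

Lemma Rint_lin a f g : mu.-integrable setT (EFin \o f) ->
  mu.-integrable setT (EFin \o g) ->
  \int[mu]_x (a * f x + g x) = a * (\int[mu]_x f x) + \int[mu]_x g x.
Proof.
move=> hf hg; rewrite RintegralD//; last first.
  by have := integrableZl measurableT a hf; apply: eq_integrable.
by rewrite RintegralZl.
Qed.

Lemma ip_lin a f g h : L2 f -> L2 g -> L2 h ->
  \int[mu]_x ((a * f x + g x) * h x) =
  a * (\int[mu]_x (f x * h x)) + \int[mu]_x (g x * h x).
Proof.
move=> hf hg hh; rewrite -Rint_lin; try exact: L2_integrable.
by apply: eq_Rintegral => x _; rewrite mulrDl mulrA.
Qed.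

Lemma ipC f g : \int[mu]_x (f x * g x) = \int[mu]_x (g x * f x).
Proof. by apply: eq_Rintegral => x _; rewrite mulrC. Qed.

Lemma nrm_sqr_lin a f g : L2 f -> L2 g ->
  nrm (a \*o f \+ g) ^+ 2 =
  a ^+ 2 * nrm f ^+ 2 + 2 * a * (\int[mu]_x (f x * g x)) + nrm g ^+ 2.
Proof.
move=> hf hg; have hfg := L2_lin a hf hg.
rewrite !nrm_sqr//.
rewrite (@ip_lin a f g (a \*o f \+ g))// (ipC f) (ipC g).
rewrite (@ip_lin a f g f)// (@ip_lin a f g g)// (ipC g f).
by ring.
Qed.

Lemma cauchy_schwarz f g : L2 f -> L2 g ->
  `|\int[mu]_x (f x * g x)| <= nrm f * nrm g.
Proof.
move=> hf hg; set I := (X in `|X|).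
have key a : 0 <= a ^+ 2 * nrm f ^+ 2 + 2 * a * I + nrm g ^+ 2.
  by rewrite -nrm_sqr_lin// sqr_ge0.
have [f0|f0] := eqVneq (nrm f) 0.
  suff -> : I = 0 by rewrite normr0 mulr_ge0// nrm_ge0.
  apply/eqP; apply: contraT => I0.
  (* With [nrm f = 0] the quadratic is affine in [a]; this value of [a] makes it equal to -1. *)
  have := key (- (nrm g ^+ 2 + 1) / (2 * I)).
  rewrite f0 expr0n/= mulr0 add0r.
  rewrite (_ : 2 * _ * I = - (nrm g ^+ 2 + 1)); last by field.
  lra.
rewrite -(@ler_pXn2r _ 2)//; rewrite ?nnegrE ?mulr_ge0 ?nrm_ge0//.
rewrite real_normK ?num_real//.
have fp : 0 < nrm f ^+ 2 by rewrite exprn_gt0// lt_neqAle eq_sym f0 nrm_ge0.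
(* The minimizer of the quadratic in [a]. *)
have := key (- I / nrm f ^+ 2).
rewrite (_ : _ + _ + _ = nrm g ^+ 2 - I ^+ 2 / nrm f ^+ 2); last by field.
by rewrite subr_ge0 ler_pdivrMr// mulrC -exprMn.
Qed.

Lemma nrmZ a f : L2 f -> nrm (fun x => a * f x) = `|a| * nrm f.
Proof.
move=> hf; apply/eqP; rewrite -(@eqrXn2 _ 2)// ?mulr_ge0 ?nrm_ge0//.
rewrite exprMn !nrm_sqr//; last exact: L2_Z.
rewrite real_normK ?num_real//.
rewrite -RintegralZl//; last exact: L2_integrable.
by apply/eqP; apply: eq_Rintegral => x _; rewrite expr2; ring.
Qed.

Lemma nrm_parallelogram f g : L2 f -> L2 g ->
  nrm (fun x => f x + g x) ^+ 2 + nrm (fun x => f x - g x) ^+ 2 =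
  2 * nrm f ^+ 2 + 2 * nrm g ^+ 2.
Proof.
move=> hf hg; have := nrm_sqr_lin 1 hf hg; have := nrm_sqr_lin (-1) hg hf.
rewrite (_ : (-1 \*o g \+ f) = (fun x => f x - g x)); last first.
  by apply/funext => x /=; rewrite mulN1r addrC.
rewrite (_ : (1 \*o f \+ g) = (fun x => f x + g x)); last first.
  by apply/funext => x /=; rewrite mul1r.
by rewrite (ipC g f) => -> ->; ring.
Qed.

Lemma nrmD f g : L2 f -> L2 g -> nrm (fun x => f x + g x) <= nrm f + nrm g.
Proof.
move=> hf hg; rewrite -(@ler_pXn2r _ 2)//; rewrite ?nnegrE ?addr_ge0 ?nrm_ge0//.
have := nrm_sqr_lin 1 hf hg.
rewrite (_ : (1 \*o f \+ g) = (fun x => f x + g x)); last first.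
  by apply/funext => x /=; rewrite mul1r.
move=> ->; have := cauchy_schwarz hf hg.
rewrite ler_norml => /andP[_].
by rewrite sqrrD; set I := Rintegral _ _ _; lra.
Qed.

Lemma L2_dom f g : measurable_fun setT f -> L2 g ->
  (forall x, `|f x| <= `|g x|) -> L2 f.
Proof.
move=> mf hg hfg; apply: L2P => //.
apply: le_integrable (L2_integrable hg hg) => //.
  by apply/measurable_EFinP; exact: measurable_funM.
by move=> x _ /=; rewrite lee_fin !normrM ler_pM.
Qed.

Lemma nrm_le f g : L2 f -> L2 g ->
  (forall x, `|f x| <= `|g x|) -> nrm f <= nrm g.
Proof.
move=> hf hg hfg; rewrite -(@ler_pXn2r _ 2)//; rewrite ?nnegrE ?nrm_ge0//.
rewrite !nrm_sqr//; apply: le_Rintegral => //; try exact: L2_integrable.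
move=> x _; rewrite -!expr2 -(real_normK (num_real (f x))).
by rewrite -(real_normK (num_real (g x))) lerXn2r// nnegrE.
Qed.

Lemma L2_mulb f g M : measurable_fun setT f -> L2 g ->
  (forall x, `|f x| <= M) -> L2 (fun x => f x * g x).
Proof.
move=> mf hg hM; apply: L2_dom (L2_Z M hg) _.
  by apply: measurable_funM => //; exact: L2_measurable.
by move=> x; rewrite !normrM ler_wpM2r// (le_trans (hM x))// ler_norm.
Qed.

Lemma nrm_mulb f g M : measurable_fun setT f -> L2 g ->
  (forall x, `|f x| <= M) -> 0 <= M -> nrm (fun x => f x * g x) <= M * nrm g.
Proof.
move=> mf hg hM M0; rewrite -[X in X * _](ger0_norm M0) -nrmZ//.
apply: nrm_le; [exact: L2_mulb hM|exact: L2_Z|].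
by move=> x; rewrite !normrM ler_wpM2r// (le_trans (hM x))// ler_norm.
Qed.

Lemma ae_Rintegral f g : measurable_fun setT f -> measurable_fun setT g ->
  (\forall x \ae mu, f x = g x) -> \int[mu]_x f x = \int[mu]_x g x.
Proof.
move=> mf mg fg; congr fine; apply: ae_eq_integral => //;
  try exact/measurable_EFinP.
by apply: filterS fg => x /= -> _.
Qed.

Lemma ae_nrm f g : L2 f -> L2 g ->
  (\forall x \ae mu, f x = g x) -> nrm f = nrm g.
Proof.
move=> hf hg fg; apply/eqP; rewrite -(@eqrXn2 _ 2)// ?nrm_ge0// !nrm_sqr//.
apply/eqP; apply: ae_Rintegral.
- by apply: measurable_funM; exact: L2_measurable.
- by apply: measurable_funM; exact: L2_measurable.
- by apply: filterS fg => x ->.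
Qed.

End L2.

(** * Dominated convergence, null functions and completeness of L^2 *)

Section Integration.
Context {dd : measure_display} {T : measurableType dd} {R : realType}.
Variable mu : {measure set T -> \bar R}.

Lemma ae_imp (P Q : T -> Prop) : (forall x, P x -> Q x) ->
  (\forall x \ae mu, P x) -> \forall x \ae mu, Q x.
Proof. by move=> PQ; apply: filterS. Qed.

Lemma ae_sym (f g : T -> R) : (\forall x \ae mu, f x = g x) -> \forall x \ae mu, g x = f x.
Proof. by apply: ae_imp => s ->. Qed.

Lemma dominated_cvgR (D : set T) (f_ : nat -> T -> R) (f g : T -> R) :
  measurable D -> (forall n, measurable_fun D (f_ n)) -> measurable_fun D f ->
  (\forall x \ae mu, D x -> f_ n x @[n --> \oo] --> f x) ->
  mu.-integrable D (EFin \o g) ->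
  (forall n x, D x -> `|f_ n x| <= g x) ->
  \int[mu]_(x in D) f_ n x @[n --> \oo] --> \int[mu]_(x in D) f x.
Proof.
move=> mD mf_ mf cf ig fg.
have [] := @dominated_convergence _ _ _ mu D mD (fun n => EFin \o f_ n)
  (EFin \o f) (EFin \o g).
- by move=> n; exact/measurable_EFinP.
- exact/measurable_EFinP.
- apply: filterS cf => x /= h Dx.
  by apply: cvg_comp (h Dx) _; apply: cvg_EFin => //; exact: nearW.
- exact: ig.
- by apply: aeW => x n Dx /=; rewrite lee_fin fg.
move=> hi _ h; rewrite /Rintegral.
apply: fine_cvg; rewrite fineK; last exact: integrable_fin_num.
exact: h.
Qed.

(** The measurable sets over which [f] integrates to zero are closed under countable disjoint unions
    and, since the total integral is zero, under complements. Dynkin's theorem thus passes from [G]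
    to the whole sigma-algebra. *)
Lemma pi_system_ae0 (G : set (set T)) (f : T -> R) :
  @measurable _ T = <<s G >> -> setI_closed G ->
  mu.-integrable setT (EFin \o f) -> \int[mu]_x f x = 0 ->
  (forall A, G A -> \int[mu]_(x in A) f x = 0) ->
  \forall x \ae mu, f x = 0.
Proof.
move=> mG GI fi fT fG.
have mf := measurable_int _ fi.
have fin A : measurable A -> (\int[mu]_(x in A) (f x)%:E)%E \is a fin_num.
  move=> mA; have iA := integrableS measurableT mA (@subsetT _ _) fi.
  exact: integrable_fin_num.
have eqE A : measurable A ->
    \int[mu]_(x in A) f x = 0 -> (\int[mu]_(x in A) (f x)%:E)%E = 0%E.
  by move=> mA; rewrite /Rintegral => h; rewrite -(fineK (fin A mA)) h.
suff h : forall A, <<s G >> A -> (\int[mu]_(x in A) (f x)%:E)%E = 0%E.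
  have := @integral_ae_eq _ _ _ mu setT measurableT (cst 0%E) (EFin \o f) fi.
  move=> /(_ (measurable_cst _)) [].
    by move=> A _ mA; rewrite integral0; apply: h; rewrite -mG.
  move=> N [mN N0 hN]; exists N; split => // x /= fx; apply: hN => /= h0.
  by apply: fx; have /= [] := h0 I.
apply: dynkin_induction => //.
- exact: eqE.
- by move=> A GA; apply: eqE; [rewrite mG; exact: sub_gen_smallest|exact: fG].
- move=> A mA A0.
  have := integral_setU_EFin mu mA (measurableC mA) (f := f).
  rewrite setUCr A0 add0e => <-.
  + exact: eqE.
  + by apply: measurable_funTS; exact/measurable_EFinP.
  + by apply/disj_setPCl.
- move=> F mF tF F0; rewrite integral_bigcup//; last first.
    by apply: integrableS fi => //; exact: bigcup_measurable.
  by under eq_eseriesr do rewrite F0; rewrite eseries0.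
Qed.

Local Notation L2 f := (f \in Lfun mu 2%:E).
Local Notation nrm f := (fine ('N[mu]_2%:E[EFin \o f%R])%E).

Lemma measurable_fun_limn_einf (G : nat -> T -> \bar R) :
  (forall n, measurable_fun setT (G n)) ->
  measurable_fun setT (fun x => limn_einf (G ^~ x)).
Proof.
move=> mG; have -> : (fun x => limn_einf (G ^~ x)) =
    (fun x => - limn_esup (fun n => - G n x))%E.
  by apply/funext => x; rewrite (limn_esupN (G ^~ x)) oppeK.
apply: measurableT_comp => //; apply: measurable_fun_limn_esup => n.
exact: measurableT_comp.
Qed.

Lemma limn_einf_le (u : nat -> \bar R) (M : \bar R) :
  (\forall n \near \oo, (u n <= M)%E) -> (limn_einf u <= M)%E.
Proof.
move=> h; rewrite limn_einf_lim; apply: lime_le; first exact: is_cvg_einfs.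
apply: filterS h => n uM; apply: le_trans uM.
by apply: ereal_inf_lbound; exists n => /=.
Qed.

Variable f : nat -> T -> R.
Hypothesis Lf : forall n, L2 (f n).
Hypothesis fast : forall n, nrm (fun x => f n.+1 x - f n x) <= 2^-1 ^+ n.

(** Partial sums of the absolute increments, as in the Riesz-Fischer theorem: their L^2 norms stay
    below 2, so by Fatou their limit is finite almost everywhere, and there the telescoping series
    of [f] converges absolutely. *)
Let S n x := \sum_(k < n) `|f k.+1 x - f k x|.

Let LS n : L2 (S n).
Proof.
elim: n => [|n IH].
  by apply: L2_eq (L2_0 mu) _ => x; rewrite /S big_ord0.
apply: L2_eq (L2_D IH _) _; last by move=> x; rewrite /S big_ord_recr.
apply: (L2_dom _ (L2_B (Lf n.+1) (Lf n))).
  apply: measurableT_comp => //; apply: measurable_funB; exact: (L2_measurable (Lf _)).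
by move=> x; rewrite normr_id.
Qed.

Let nrmS n : nrm (S n) <= 2 - 2 * 2^-1 ^+ n.
Proof.
elim: n => [|n IH].
  have -> : S 0 = (fun x => 0 * f 0%N x).
    by apply/funext => x; rewrite /S big_ord0 mul0r.
  by rewrite nrmZ// normr0 mul0r expr0; lra.
have La : L2 (fun x => `|f n.+1 x - f n x|).
  apply: (L2_dom _ (L2_B (Lf n.+1) (Lf n))).
    apply: measurableT_comp => //; apply: measurable_funB; exact: (L2_measurable (Lf _)).
  by move=> x; rewrite normr_id.
have -> : S n.+1 = (fun x => S n x + `|f n.+1 x - f n x|).
  by apply/funext => x; rewrite /S big_ord_recr.
apply: le_trans (nrmD (LS n) La) _.
have : nrm (fun x => `|f n.+1 x - f n x|) <= 2^-1 ^+ n.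
  apply: le_trans (fast n); apply: nrm_le => //; first exact: L2_B.
  by move=> x; rewrite normr_id.
by rewrite exprSr; move: IH; lra.
Qed.

Let nrmf m n : (n <= m)%N -> nrm (fun x => f m x - f n x) <= 2 * 2^-1 ^+ n.
Proof.
move=> /subnKC <-; move: (m - n)%N => {m} k.
suff : nrm (fun x => f (n + k)%N x - f n x) <= 2 * 2^-1 ^+ n - 2 * 2^-1 ^+ (n + k).
  by move=> h; apply: le_trans h _; rewrite gerBl mulr_ge0// exprn_ge0.
elim: k => [|k IH].
  rewrite addn0 subrr; have -> : (fun x => f n x - f n x) = (fun x => 0 * f n x).
    by apply/funext => x; rewrite subrr mul0r.
  by rewrite nrmZ// normr0 mul0r.
have -> : (fun x => f (n + k.+1)%N x - f n x) =
    (fun x => (f (n + k).+1 x - f (n + k)%N x) + (f (n + k)%N x - f n x)).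
  by apply/funext => x; rewrite addnS; ring.
apply: le_trans (nrmD (L2_B (Lf _) (Lf _)) (L2_B (Lf _) (Lf _))) _.
have := fast (n + k); move: IH; rewrite addnS exprSr; lra.
Qed.

Let ae_cvg : \forall x \ae mu, cvgn (f ^~ x).
Proof.
pose G n x := (S n x * S n x)%:E.
have mG n : measurable_fun setT (G n).
  by apply/measurable_EFinP; apply: measurable_funM; exact: (L2_measurable (LS n)).
have G0 n x : setT x -> (0 <= G n x)%E by move=> _; rewrite lee_fin -expr2 sqr_ge0.
have iG : mu.-integrable setT (fun x => limn_einf (G ^~ x)).
  apply/integrableP; split; first exact: measurable_fun_limn_einf.
  have g0 x : (0 <= limn_einf (G ^~ x))%E.
    rewrite limn_einf_lim; apply: lime_ge; first exact: is_cvg_einfs.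
    by apply: nearW => n; apply: le_ereal_inf_tmp => _ [m /= _ <-]; exact: G0.
  under eq_integral => x _ do rewrite gee0_abs//.
  apply: le_lt_trans (fatou mu measurableT mG G0) _.
  apply: (@le_lt_trans _ _ 4%:E); last exact: ltry.
  apply: limn_einf_le; apply: nearW => n.
  rewrite -(@fineK _ (\int[mu]_x G n x)%E); last first.
    exact: integrable_fin_num (L2_integrable (LS n) (LS n)).
  have := nrm_sqr (LS n); rewrite /Rintegral => <-; rewrite lee_fin.
  have hn := nrmS n; have e0 : 0 <= 2^-1 ^+ n :> R by rewrite exprn_ge0.
  have n0 := nrm_ge0 mu (S n).
  rewrite (_ : 4 = 2 ^+ 2 :> R); last by rewrite expr2; lra.
  by rewrite lerXn2r// ?nnegrE//; lra.
have := integrable_ae measurableT iG; apply: filterS => x /(_ I) fx.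
have ndS : nondecreasing_seq (S ^~ x).
  by apply/nondecreasing_seqP => n; rewrite /S big_ord_recr/= lerDl.
have S0 n : 0 <= S n x by exact: sumr_ge0.
have ndG : nondecreasing_seq (G ^~ x).
  by move=> m n mn; rewrite lee_fin ler_pM// ndS.
have cG := ereal_nondecreasing_is_cvgn ndG.
rewrite is_cvg_limn_einfE// in fx.
have bS n : S n x <= 1 + fine (limn (G ^~ x)).
  have : (G n x <= limn (G ^~ x))%E.
    rewrite (cvg_lim _ (ereal_nondecreasing_cvgn ndG))//.
    by apply: ereal_sup_ubound; exists n.
  rewrite -[in X in (_ <= X)%E -> _](fineK fx) lee_fin => h.
  by apply: le_trans (_ : 1 + S n x * S n x <= _); [nra|rewrite lerD2l].
have cS : cvgn (S ^~ x).
  apply: nondecreasing_is_cvgn => //; exists (1 + fine (limn (G ^~ x))).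
  by move=> _ [n _ <-].
have : cvgn (series (fun k => f k.+1 x - f k x)).
  apply: normed_cvg; rewrite /normed_series_of /series /=.
  by move: cS; congr (cvgn _); apply/funext => n; rewrite /S big_mkord.
have -> : f ^~ x = (fun n => f 0%N x + series (fun k => f k.+1 x - f k x) n).
  by apply/funext => n; rewrite /series /= telescope_sumr// addrC subrK.
by move=> h; apply: is_cvgD => //; exact: is_cvg_cst.
Qed.

Lemma L2_complete : exists g : T -> R,
  [/\ L2 g, forall n, nrm (fun x => f n x - g x) <= 2 * 2^-1 ^+ n &
      \forall x \ae mu, f n x @[n --> \oo] --> g x].
Proof.
(* A limit superior is defined and measurable everywhere, so the null set of divergence need not be
   cut out. *)
pose g x := fine (limn_esup (fun n => (f n x)%:E)).
have mg : measurable_fun setT g.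
  apply: measurableT_comp => //; apply: measurable_fun_limn_esup => n.
  by apply/measurable_EFinP; exact: L2_measurable.
have cg : \forall x \ae mu, f n x @[n --> \oo] --> g x.
  apply: filterS ae_cvg => x /cvg_ex[l hl].
  suff -> : g x = l by [].
  have hl' : (f n x)%:E @[n --> \oo] --> l%:E.
    by apply: cvg_comp hl _; apply: cvg_EFin => //; exact: nearW.
  by rewrite /g (cvg_limn_einf_sup hl').2.
(* Fatou in the second index carries the Cauchy estimate [nrmf] to the limit. The integral is kept
   extended-real because [g] is not yet known to be in L^2; its finiteness is what proves it. *)
have key n : (\int[mu]_x ((f n x - g x) * (f n x - g x))%:E
    <= ((2 * 2^-1 ^+ n) ^+ 2)%:E)%E.
  pose G m x := ((f n x - f m x) * (f n x - f m x))%:E.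
  have mG m : measurable_fun setT (G m).
    by apply/measurable_EFinP; apply: measurable_funM; apply: measurable_funB;
      exact: (L2_measurable (Lf _)).
  have G0 m x : setT x -> (0 <= G m x)%E by move=> _; rewrite lee_fin -expr2 sqr_ge0.
  have -> : (\int[mu]_x ((f n x - g x) * (f n x - g x))%:E =
      \int[mu]_x limn_einf (G ^~ x))%E.
    apply: ae_eq_integral => //.
    + by apply/measurable_EFinP; apply: measurable_funM; apply: measurable_funB => //;
        exact: (L2_measurable (Lf _)).
    + exact: measurable_fun_limn_einf.
    + apply: filterS cg => x hx _.
      apply/esym; apply: (cvg_limn_einf_sup _).1.
      apply: cvg_EFin; first exact: nearW.
      by apply: cvgM; apply: cvgB => //; exact: cvg_cst.
  apply: le_trans (fatou mu measurableT mG G0) _.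
  apply: limn_einf_le; exists n => // m /= nm.
  have L := L2_B (Lf n) (Lf m).
  rewrite -(@fineK _ (\int[mu]_x G m x)%E); last first.
    exact: integrable_fin_num (L2_integrable L L).
  have := nrm_sqr L; rewrite /Rintegral => <-; rewrite lee_fin.
  rewrite lerXn2r// ?nnegrE ?nrm_ge0//.
  have -> : (fun x => f n x - f m x) = (fun x => -1 * (f m x - f n x)).
    by apply/funext => x; ring.
  by rewrite nrmZ ?normrN1 ?mul1r ?nrmf//; exact: L2_B.
have Ld n : L2 (fun x => f n x - g x).
  have md : measurable_fun setT (fun x => f n x - g x).
    by apply: measurable_funB => //; exact: (L2_measurable (Lf _)).
  apply: L2P => //; apply/integrableP; split.
    by apply/measurable_EFinP; exact: measurable_funM.
  apply: le_lt_trans (ltry ((2 * 2^-1 ^+ n) ^+ 2)).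
  apply: le_trans (key n); rewrite le_eqVlt; apply/orP; left; apply/eqP.
  by apply: eq_integral => x _; rewrite gee0_abs// lee_fin -expr2 sqr_ge0.
exists g; split => //.
- by apply: L2_eq (L2_B (Lf 0) (Ld 0%N)) _ => x; ring.
- move=> n; rewrite -(@ler_pXn2r _ 2)//; rewrite ?nnegrE ?nrm_ge0//.
  rewrite nrm_sqr// -lee_fin /Rintegral fineK; first exact: key.
  exact: integrable_fin_num (L2_integrable (Ld n) (Ld n)).
Qed.

End Integration.

(** * Smooth functions of one variable *)

Section Smooth.
Context {R : realType}.
Implicit Types (f g : R -> R) (s x : R).

Definition smooth g := forall n s, derivable (g^`(n)%classic) s 1.

(** Finite orders make induction possible: the derivative of a product or of a composite contains
    the original functions again, one order lower. *)
Definition diffn (k : nat) g := forall n, (n < k)%N -> forall s, derivable (g^`(n)%classic) s 1.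

Lemma derive1_is_derive g g' : (forall s, is_derive s 1 g (g' s)) -> g^`()%classic = g'.
Proof. by move=> h; apply/funext => s; rewrite derive1E; exact: derive_val. Qed.

Lemma is_derive_derive1 g s : derivable g s 1 -> is_derive s 1 g (g^`()%classic s).
Proof. by move=> h; rewrite derive1E; exact: derivableP. Qed.

Lemma diffn0 g : diffn 0 g.
Proof. by move=> n; rewrite ltn0; discriminate. Qed.

Lemma diffn_is_derive k g s : diffn k.+1 g -> is_derive s 1 g (g^`()%classic s).
Proof. by move=> h; apply: is_derive_derive1; have := h 0%N isT s. Qed.

Lemma diffn_derive k g : diffn k.+1 g -> diffn k (g^`()%classic).
Proof. by move=> h n nk s; rewrite -derive1Sn; exact: h. Qed.

Lemma diffnS k g g' : (forall s, is_derive s 1 g (g' s)) -> diffn k g' -> diffn k.+1 g.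
Proof.
move=> h hg' [_ s|n nk s]; first by rewrite derive1n0; exact: (@ex_derive _ _ _ _ _ _ _ (h s)).
by rewrite derive1Sn (derive1_is_derive h); exact: hg'.
Qed.

Lemma diffnW k l g : (k <= l)%N -> diffn l g -> diffn k g.
Proof. by move=> kl h n nk; apply: h; exact: leq_trans kl. Qed.

Lemma smooth_diffn g : smooth g <-> forall k, diffn k g.
Proof. by split=> [h k n _|h n]; [exact: h|exact: (h n.+1 n)]. Qed.

Lemma smooth_is_derive g s : smooth g -> is_derive s 1 g (g^`()%classic s).
Proof. by move/smooth_diffn => /(_ 1%N); exact: diffn_is_derive. Qed.

Lemma smooth_derive g : smooth g -> smooth (g^`()%classic).
Proof. by move=> h n; rewrite -derive1Sn; exact: h. Qed.

Lemma smoothS g g' : (forall s, is_derive s 1 g (g' s)) -> smooth g' -> smooth g.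
Proof.
move=> h /smooth_diffn hg'; apply/smooth_diffn => k.
by apply: (@diffnW _ k.+1); [exact: leqnSn|exact: diffnS h _].
Qed.

Lemma is_derive_continuous g s (l : R) : is_derive s 1 g l -> {for s, continuous g}.
Proof. by move=> h; apply/differentiable_continuous/derivable1_diffP; exact: ex_derive. Qed.

Lemma smooth_continuous g : smooth g -> continuous g.
Proof. by move=> h s; exact: is_derive_continuous (smooth_is_derive s h). Qed.

Lemma diffn_cst k (c : R) : diffn k (cst c).
Proof.
elim: k c => [c|k IH c]; first exact: diffn0.
 apply: (@diffnS _ _ (cst 0)); last exact: IH.
Qed.

Lemma diffn_id k : diffn k id.
Proof.
case: k => [|k]; first exact: diffn0.
apply: (@diffnS _ _ (cst 1)); exact: diffn_cst.
Qed.

Lemma diffnD k f g : diffn k f -> diffn k g -> diffn k (fun s => f s + g s).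
Proof.
elim: k f g => [f g _ _|k IH f g hf hg]; first exact: diffn0.
apply: (@diffnS _ _ (fun s => f^`()%classic s + g^`()%classic s)).
  move=> s; have h := is_deriveD (diffn_is_derive s hf) (diffn_is_derive s hg).
  exact: h.
by apply: IH; exact: diffn_derive.
Qed.

Lemma diffnM k f g : diffn k f -> diffn k g -> diffn k (fun s => f s * g s).
Proof.
elim: k f g => [f g _ _|k IH f g hf hg]; first exact: diffn0.
apply: (@diffnS _ _ (fun s => f s * g^`()%classic s + g s * f^`()%classic s)).
  move=> s; have h := is_deriveM (diffn_is_derive s hf) (diffn_is_derive s hg).
  exact: h.
apply: diffnD; apply: IH.
- exact: diffnW (leqnSn k) hf.
- exact: diffn_derive hg.
- exact: diffnW (leqnSn k) hg.
- exact: diffn_derive hf.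
Qed.

Lemma diffn_comp k f g : diffn k f -> diffn k g -> diffn k (fun s => f (g s)).
Proof.
elim: k f g => [f g _ _|k IH f g hf hg]; first exact: diffn0.
apply: (@diffnS _ _ (fun s => f^`()%classic (g s) * g^`()%classic s)).
  move=> s; have hg' := diffn_is_derive s hg.
  have hf' := diffn_is_derive (g s) hf.
  exact: is_derive1_comp.
apply: diffnM; last exact: diffn_derive.
apply: IH; first exact: diffn_derive.
exact: diffnW (leqnSn k) hg.
Qed.

Lemma smooth_cst (c : R) : smooth (cst c).
Proof. by apply/smooth_diffn => k; exact: diffn_cst. Qed.

Lemma smooth_id : smooth id.
Proof. by apply/smooth_diffn => k; exact: diffn_id. Qed.

Lemma smoothD f g : smooth f -> smooth g -> smooth (fun s => f s + g s).
Proof. by move=> /smooth_diffn hf /smooth_diffn hg; apply/smooth_diffn => k; exact: diffnD. Qed.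

Lemma smoothM f g : smooth f -> smooth g -> smooth (fun s => f s * g s).
Proof. by move=> /smooth_diffn hf /smooth_diffn hg; apply/smooth_diffn => k; exact: diffnM. Qed.

Lemma smooth_comp f g : smooth f -> smooth g -> smooth (fun s => f (g s)).
Proof. by move=> /smooth_diffn hf /smooth_diffn hg; apply/smooth_diffn => k; exact: diffn_comp. Qed.

Lemma smoothZ c f : smooth f -> smooth (fun s => c * f s).
Proof. by move=> hf; exact: (smoothM (@smooth_cst c) hf). Qed.

Lemma smoothB f g : smooth f -> smooth g -> smooth (fun s => f s - g s).
Proof.
move=> hf hg; have h := smoothD hf (@smoothZ (-1) g hg).
have -> : (fun s => f s - g s) = (fun s => f s + -1 * g s); last exact: h.
by apply/funext => s; rewrite mulN1r.
Qed.

Lemma smooth_shift f c : smooth f -> smooth (fun s => f (s - c)).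
Proof. move=> hf; have h := smoothB smooth_id (@smooth_cst c).
exact (smooth_comp hf h). Qed.

Lemma smooth_cos : smooth (@cos R).
Proof.
suff h k : diffn k (@cos R) /\ diffn k (@sin R) by apply/smooth_diffn => k; apply h.
elim: k => [|k [hc hs]]; first by split; exact: diffn0.
split.
  apply: (@diffnS _ _ (fun s => - 1 * sin s)); last exact: diffnM (@diffn_cst k (-1)) hs.
  by move=> s; rewrite mulN1r; exact: is_derive_cos.
by apply: (@diffnS _ _ (@cos R)).
Qed.

(* [en 0] is the standard smooth function vanishing exactly on the negative
   half-line; its derivatives are combinations of the [en n]. *)
Definition en (n : nat) (x : R) := if 0 < x then x^-1 ^+ n * expR (- x^-1) else 0.

Lemma en_ge0 n x : 0 <= en n x.
Proof. by rewrite /en; case: ifP => // x0; rewrite mulr_ge0 ?expR_ge0// exprn_ge0// invr_ge0 ltW. Qed.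

(** With m = n + 2, the inequality t <= exp t at t = 1/(m x), raised to the power m, gives exp(1/x)
    >= (m x)^(-m). A bound quadratic in x is what makes the difference quotients of [en n] at 0 tend
    to 0. *)
Lemma en_quad n x : en n x <= (n.+2)%:R ^+ n.+2 * x ^+ 2.
Proof.
rewrite /en; case: ifPn => [x0|_]; last first.
  by rewrite mulr_ge0 ?sqr_ge0// exprn_ge0// ler0n.

have m0 : 0 < (n.+2%:R : R) by rewrite ltr0n.
rewrite expRN -[X in expR X](@mulfVK _ n.+2%:R) ?gt_eqF//.
rewrite (mulrC _ n.+2%:R) expRM_natl.
have h : x^-1 / n.+2%:R <= expR (x^-1 / n.+2%:R).
  by apply: le_trans (expR_ge1Dx _); rewrite lerDr.
have p0 : 0 < x^-1 / n.+2%:R by rewrite divr_gt0// invr_gt0.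
apply: (@le_trans _ _ (x^-1 ^+ n * ((x^-1 / n.+2%:R) ^+ n.+2)^-1)).
  apply: ler_wpM2l; first by rewrite exprn_ge0// invr_ge0 ltW.
  by rewrite lef_pV2 ?posrE ?exprn_gt0 ?expR_gt0// lerXn2r// nnegrE ?expR_ge0// ltW.
rewrite le_eqVlt; apply/orP; left; apply/eqP.
rewrite expr_div_n invf_div mulrC -mulrA; congr (_ * _).
rewrite !exprVn invrK -addn2 exprD mulrAC mulfV ?mul1r//.
by rewrite expf_neq0// gt_eqF.
Qed.

Lemma en_is_derive n x : is_derive x 1 (en n) (- n%:R * en n.+1 x + en n.+2 x).
Proof.
have [x0|x0|->] := ltrgtP x 0.
- have h : \forall y \near x, cst 0 y = en n y.
    have : \forall y \near x, y < 0 by exact: lt_nbhsl.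
    by apply: filterS => y y0; rewrite /en ltNge (ltW y0).
  have := near_eq_is_derive h (is_derive_cst 0 x 1).
  by rewrite /en ltNge (ltW x0)/= mulr0 addr0.
- have hn : \forall y \near x, y^-1 ^+ n * expR (- y^-1) = en n y.
    have : \forall y \near x, 0 < y by exact: lt_nbhsr.
    by apply: filterS => y y0; rewrite /en y0.
  have xn0 : x != 0 by rewrite gt_eqF.
  have dV : is_derive x 1 (fun y => y^-1) (- x ^- 2).
    have := @is_deriveV R id x 1 1 xn0 (is_derive_id x 1).
    by move=> h; apply: (is_derive_eq h); rewrite /GRing.scale /= mulr1.
  have dX : is_derive x 1 (fun y : R => y^-1 ^+ n) (n%:R * x^-1 ^+ n.-1 * - x ^- 2).
    have := is_deriveX n dV.
    by rewrite /GRing.scale /= exprfctE; move=> h; apply: (is_derive_eq h); rewrite mulr_natl.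
  have dE : is_derive x 1 (fun y : R => expR (- y^-1)) (expR (- x^-1) * x ^- 2).
    have dN := is_deriveN dV; rewrite opprK in dN.
    have := @is_derive1_comp _ expR (fun y => - y^-1) x _ _ (is_derive_expR _) dN.
    by [].
  have := near_eq_is_derive hn (is_deriveM dX dE); move=> h; apply: (is_derive_eq h).
  rewrite /en x0 /GRing.scale /=.
  rewrite -!exprVn; case: n {hn dX h} => [|n] /=.
    by rewrite mulr0n !exprS !expr0; ring.
  by rewrite !exprS !expr0; ring.
- have -> : - n%:R * en n.+1 0 + en n.+2 0 = 0 by rewrite /en ltxx mulr0 addr0.
  suff h : (fun h => h^-1 *: (en n (h *: 1 + 0) - en n 0)) @ 0^' --> (0 : R).
    by split; [exact: cvgP h|exact: cvg_lim h].
  pose C := n.+2%:R ^+ n.+2 : R.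
  have e00 : en n 0 = 0 by rewrite /en ltxx.
  apply/cvgr0Pnorm_lt => e e0.
  have C0 : 0 < C by rewrite exprn_gt0// ltr0n.
  near=> h.
  rewrite e00 subr0 addr0 /GRing.scale /= mulr1 normrM (ger0_norm (en_ge0 _ _)).
  apply: (@le_lt_trans _ _ (`|h^-1| * (C * h ^+ 2))).
    by rewrite ler_wpM2l//; exact: en_quad.
  have hn0 : h != 0 by near: h; exact: nbhs_dnbhs_neq.
  have -> : `|h^-1| * (C * h ^+ 2) = C * `|h|.
    rewrite -(real_normK (num_real h)) normfV; have : `|h| != 0 by rewrite normr_eq0.
    by move: `|h| => z z0; field.
  rewrite -ltr_pdivlMl//.
  by near: h; apply: dnbhs0_lt; rewrite mulr_gt0// invr_gt0.
Unshelve. all: by end_near. Qed.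

Lemma smooth_en n : smooth (en n).
Proof.
suff h k : forall n, diffn k (en n) by apply/smooth_diffn => k; exact: h.
elim: k => [n'|k IH {}n]; first exact: diffn0.
apply: (@diffnS _ _ (fun x => - n%:R * en n.+1 x + en n.+2 x)).
  by move=> s; exact: en_is_derive.
by apply: diffnD; [apply: diffnM; [exact: diffn_cst|exact: IH]|exact: IH].
Qed.

Lemma en0_le1 x : en 0 x <= 1.
Proof. by rewrite /en; case: ifP => // x0; rewrite expr0 mul1r -expR0 ler_expR oppr_le0 invr_ge0 ltW. Qed.

Lemma en0_gt0 x : (0 < en 0 x) = (0 < x).
Proof. by rewrite /en; case: ifP; rewrite ?ltxx// expr0 mul1r expR_gt0. Qed.

Lemma en0_eq0 x : x <= 0 -> en 0 x = 0.
Proof. by rewrite /en ltNge => ->. Qed.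

Lemma en0_cvg1 x : 0 < x -> en 0 (n.+1%:R * x) @[n --> \oo] --> (1 : R).
Proof.
move=> x0; have -> : (fun n => en 0 (n.+1%:R * x)) = (fun n => expR (- (x^-1 * n.+1%:R^-1))).
  by apply/funext => n; rewrite /en mulr_gt0// expr0 mul1r invfM mulrC.
rewrite -[X in _ --> X]expR0.
apply: continuous_cvg; first exact: continuous_expR.
rewrite -oppr0; apply: cvgN; rewrite -(mulr0 x^-1).
apply: cvgM; [exact: cvg_cst|exact: cvg_harmonic].
Qed.

Local Notation leb := (@lebesgue_measure R).

Lemma cont_within f (A : set R) : continuous f -> {within A, continuous f}.
Proof. exact: continuous_subspaceT. Qed.

Lemma cont_int_itv f a b : continuous f -> leb.-integrable `[a, b] (EFin \o f).
Proof.
by move=> cf; apply: continuous_compact_integrable; [exact: segment_compact|exact: cont_within].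
Qed.

Lemma FTC2R f F a b : a <= b -> continuous f -> (forall s, is_derive s 1 F (f s)) ->
  \int[leb]_(x in `[a, b]) f x = F b - F a.
Proof.
rewrite le_eqVlt => /predU1P[<-|ab] cf dF; first by rewrite set_itv1 Rintegral_set1 subrr.
have cF : continuous F by move=> s; exact: is_derive_continuous (dF s).
rewrite /Rintegral (@continuous_FTC2 _ f F)//.
- exact: cont_within.
- split; first by move=> x _; exact: ex_derive.
  + exact/cvg_at_right_filter/cF.
  + exact/cvg_at_left_filter/cF.
- by move=> x _; rewrite (derive1_is_derive dF).
Qed.

(** The base point - |x| - 1 lies to the left of both x and 0, and subtracting the integral up to 0
    makes its choice immaterial ([FE]). Near a given x one fixed base therefore serves, and the
    fundamental theorem on a closed interval applies. *)
Lemma antiderivative f : continuous f -> exists F, forall s, is_derive s 1 F (f s).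
Proof.
move=> cf.
pose G c x := \int[leb]_(t in `[c, x]) f t.
have Gadd c c' x : c <= c' -> c' <= x -> G c x = G c c' + G c' x.
  move=> cc' c'x.
  have := @Rintegral_itvB _ f (BLeft c) (BRight x) c' (cont_int_itv c x cf).
  rewrite !bnd_simp => /(_ cc' c'x); rewrite Rintegral_itv_obnd_cbnd.
    by move=> /eqP; rewrite subr_eq addrC => /eqP.
  apply: integrableS (cont_int_itv c' x cf) => //.
  by apply: subset_itvr; rewrite bnd_simp.
pose F x := G (- `|x| - 1) x - G (- `|x| - 1) 0.
have FE c x : c <= - `|x| - 1 -> F x = G c x - G c 0.
  move=> cx; have := ler_norm x; have := ler_norm (- x); rewrite normrN => h1 h2.
  rewrite /F (Gadd _ _ x cx); last by lra.
  rewrite (Gadd _ _ 0 cx); last by lra.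
  by ring.
exists F => x.
pose c := - `|x| - 2.
have hn : \forall y \near x, G c y - G c 0 = F y.
  near=> y; apply/esym/FE.
  have : `|x - y| < 1 by near: y; apply: nbhsx_ballx.
  move=> h; have := ler_normD x (y - x); rewrite addrC subrK (distrC y x) /c; lra.
have cx : c < x.
  have := ler_norm (- x); rewrite normrN /c; lra.
have xx1 : x < x + 1 by rewrite ltrDl.
have [dG dGE] := @continuous_FTC1_closed _ f c x (x + 1) xx1
  (cont_int_itv _ _ cf) cx (cf x).
have := near_eq_is_derive hn (is_deriveD (is_derive_derive1 dG) (is_derive_cst (- G c 0) x 1)).
by rewrite dGE addr0.
Unshelve. all: by end_near. Qed.

End Smooth.

(** * The space H^2 of an interval *)

Section Bump.
Context {R : realType}.
Local Notation leb := (@lebesgue_measure R).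
Implicit Types (s c d : R) (f psi : R -> R).

Lemma Rint_eq0 (D : set R) f : (forall x, D x -> f x = 0) ->
  \int[leb]_(x in D) f x = 0.
Proof.
move=> h; rewrite /Rintegral (eq_integral (cst 0%E)) ?integral0//.
by move=> x; rewrite inE => Dx; rewrite h.
Qed.

Lemma en0_mono : {homo @en R 0 : x y / x <= y}.
Proof.
move=> x y xy; rewrite /en; case: ifPn => [x0|_]; last exact: en_ge0.
have y0 : 0 < y by exact: lt_le_trans xy.
by rewrite y0 !expr0 !mul1r ler_expR lerN2 lef_pV2.
Qed.

(** For [c < d] and [k > 0] it is positive exactly on ]c, d[; a growing [k] pushes it up to the
    indicator of that interval. *)
Definition bump (k c d : R) (s : R) : R := en 0 (k * ((s - c) * (d - s))).

Lemma smooth_bump k c d : smooth (bump k c d).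
Proof.
have h : smooth (fun s : R => k * ((s - c) * (d - s))).
  apply: smoothZ; apply: smoothM.
    exact (smoothB (@smooth_id R) (@smooth_cst R c)).
  exact (smoothB (@smooth_cst R d) (@smooth_id R)).
exact (smooth_comp (@smooth_en R 0) h).
Qed.

Lemma bump_ge0 k c d s : 0 <= bump k c d s. Proof. exact: en_ge0. Qed.

Lemma bump_le1 k c d s : bump k c d s <= 1. Proof. exact: en0_le1. Qed.

Lemma bump_supp k c d s : 0 <= k -> c <= d -> s \notin `[c, d] -> bump k c d s = 0.
Proof.
move=> k0 cd; rewrite in_itv/= negb_and -!ltNge => /orP sc.
by apply: en0_eq0; rewrite mulr_ge0_le0//; case: sc => h; nra.
Qed.

Lemma cont_restrict_integrable f c d : continuous f ->
  leb.-integrable setT (EFin \o (f \_ `[c, d])).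
Proof.
move=> cf; have := cont_int_itv c d cf.
by rewrite [X in X -> _]integrable_mkcond// restrict_EFin.
Qed.

Lemma cont_supp_integrable f c d : continuous f ->
  (forall s, s \notin `[c, d] -> f s = 0) -> leb.-integrable setT (EFin \o f).
Proof.
move=> cf f0; have := cont_int_itv c d cf; rewrite integrable_mkcond//.
apply: eq_integrable => // s _ /=; rewrite restrict_EFin /= patchE.
case: ifPn => //; rewrite notin_setE /= => /negP; rewrite -/(is_true _) => h.
by rewrite f0//.
Qed.

Lemma cont_supp_Rint f c d : (forall s, s \notin `[c, d] -> f s = 0) ->
  \int[leb]_s f s = \int[leb]_(s in `[c, d]) f s.
Proof.
move=> f0; rewrite [RHS]Rintegral_mkcond; apply: eq_Rintegral => s _.
rewrite patchE; case: ifPn => //; rewrite notin_setE /= => /negP h.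
by rewrite f0//.
Qed.

Lemma bump_int_gt0 c d : c < d -> 0 < \int[leb]_s bump 1 c d s.
Proof.
move=> cd; set t := (d - c) / 4.
have t0 : 0 < t by rewrite divr_gt0// subr_gt0.
have sb := smooth_continuous (@smooth_bump 1 c d).
(* On the middle half [c + t, d - t] both factors in the argument of the bump are at least [t]. *)
pose m := en 0 (t * t).
have m0 : 0 < m by rewrite en0_gt0 mulr_gt0.
have d3 : c + 3 * t = d - t by rewrite /t; field.
have h1 : \int[leb]_(s in `[c + t, d - t]) m <= \int[leb]_(s in `[c + t, d - t]) bump 1 c d s.
  apply: le_Rintegral => //.
  - by apply: cont_int_itv; exact: cst_continuous.
  - exact: cont_int_itv.
  move=> s /=; rewrite in_itv/= => /andP[s1 s2]; rewrite /bump mul1r; apply: en0_mono.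
  by nra.
apply: lt_le_trans (_ : \int[leb]_(s in `[c + t, d - t]) bump 1 c d s <= _).
  apply: lt_le_trans h1; rewrite Rintegral_cst//.
  have := lebesgue_measure_itv `[c + t, d - t]%R => /= ->; rewrite lte_fin.
  rewrite ifT; last by rewrite -d3; lra.
  by rewrite -EFinD/= mulr_gt0// -d3; lra.
rewrite Rintegral_mkcond; apply: le_Rintegral => //.
- exact: cont_restrict_integrable.
- apply: (cont_supp_integrable sb) => s; apply: bump_supp => //; exact: ltW.
- by move=> s _; rewrite patchE; case: ifPn => // _; exact: bump_ge0.
Qed.

(** The primitive [P] is a smooth step from 0 to 1. The difference of two such steps is a test
    function close to the signed indicator of the segment between two points, with derivative a
    difference of two mollifiers. *)
Lemma mollifier c d : c < d -> exists rho P : R -> R,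
  [/\ smooth rho, smooth P, (forall s, is_derive s 1 P (rho s)),
      (forall s, 0 <= rho s) & (forall s, s \notin `[c, d] -> rho s = 0) /\
      [/\ \int[leb]_s rho s = 1, (forall s, s <= c -> P s = 0),
          (forall s, d <= s -> P s = 1) & forall s, 0 <= P s <= 1]].
Proof.
move=> cd; pose J := \int[leb]_s bump 1 c d s.
have J0 : 0 < J by exact: bump_int_gt0.
pose rho s := J^-1 * bump 1 c d s.
have srho : smooth rho by apply: smoothZ; exact: smooth_bump.
have crho := smooth_continuous srho.
have rho0 s : 0 <= rho s by rewrite mulr_ge0 ?bump_ge0// invr_ge0 ltW.
have rhos s : s \notin `[c, d] -> rho s = 0.
  by move=> h; rewrite /rho bump_supp ?mulr0// ltW.
have [F dF] := antiderivative crho.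
pose P s := F s - F c.
have dP s : is_derive s 1 P (rho s).
  have := is_deriveB (dF s) (is_derive_cst (F c) s 1).
  by rewrite subr0.
have sP : smooth P by exact: smoothS dP srho.
have irho : \int[leb]_s rho s = 1.
  rewrite RintegralZl//; first by rewrite -/J mulVf// gt_eqF.
  apply: (@cont_supp_integrable _ c d); first exact: smooth_continuous (@smooth_bump 1 c d).
  by move=> s; apply: bump_supp => //; exact: ltW.
have Pmono x y : x <= y -> P x <= P y.
  move=> xy; rewrite -subr_ge0 -(FTC2R xy crho dP).
  by apply: Rintegral_ge0 => s _.
have Pc : P c = 0 by rewrite /P subrr.
have Plt s : s <= c -> P s = 0.
  move=> sc; have := FTC2R sc crho dP; rewrite Pc sub0r.
  have -> : \int[leb]_(x in `[s, c]) rho x = 0; last by move/eqP; rewrite eq_sym oppr_eq0 => /eqP.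
  rewrite -(Rintegral_itv_bndo_bndc (f := rho)); last first.
    apply: integrableS (cont_int_itv s c crho) => //.
    by apply: subset_itvl; rewrite bnd_simp.
  apply: Rint_eq0 => x; rewrite /= in_itv/= => /andP[_ xc].
  by rewrite rhos// in_itv/= leNgt xc.
have Pd : P d = 1.
  by rewrite -irho (cont_supp_Rint rhos) (FTC2R (ltW cd) crho dP) Pc subr0.
have Pgt s : d <= s -> P s = 1.
  move=> sd; have := FTC2R sd crho dP; rewrite Pd.
  have -> : \int[leb]_(x in `[d, s]) rho x = 0; last by move/eqP; rewrite eq_sym subr_eq0 => /eqP.
  rewrite -(Rintegral_itv_obnd_cbnd (f := rho)); last first.
    apply: integrableS (cont_int_itv d s crho) => //.
    by apply: subset_itvr; rewrite bnd_simp.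
  apply: Rint_eq0 => x; rewrite /= in_itv/= => /andP[dx _].
  by rewrite rhos// in_itv/= (leNgt x) dx andbF.
exists rho, P; split => //; split => //; split => // s.
have [sc|/ltW cs] := leP s c; first by rewrite Plt// lexx ler01.
rewrite -(Plt c (lexx c)) Pmono//=.
have [ds|/ltW sd] := leP d s; first by rewrite Pgt.
by rewrite -Pd Pmono.
Qed.

End Bump.

(** * Test functions on an interval *)

Section ItvTest.
Context {R : realType}.
Variables (a b : R).
Hypothesis ab : a < b.
Local Notation leb := (@lebesgue_measure R).
Local Notation cut u := (u \_ `]a, b[).
Local Notation test := (itv_test a b).
Local Notation L2 f := (f \in Lfun leb 2%:E).
Local Notation nrm f := (fine ('N[leb]_2%:E[EFin \o f%R])%E).
Implicit Types (u v w psi : R -> R) (s : R).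

Lemma cutE u s : (cut u) s = if s \in `]a, b[ then u s else 0.
Proof. by rewrite patchE mem_setE. Qed.

Lemma int_cut u psi :
  \int[leb]_(s in `]a, b[) (u s * psi s) = \int[leb]_s ((cut u) s * psi s).
Proof.
rewrite [LHS]Rintegral_mkcond; apply: eq_Rintegral => s _.
by rewrite cutE patchE mem_setE; case: ifP => // _; rewrite mul0r.
Qed.

Lemma is_wderivE u w : is_wderiv a b u w <-> forall psi, test psi ->
  \int[leb]_s ((cut u) s * psi^`()%classic s) = - \int[leb]_s ((cut w) s * psi s).
Proof.
by split=> h psi /h; rewrite !int_cut.
Qed.

Lemma test_smooth psi : test psi -> smooth psi. Proof. by move=> []. Qed.

Lemma test_cont psi : test psi -> continuous psi.
Proof. by move/test_smooth/smooth_continuous. Qed.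

Lemma test_out psi s : test psi -> s \notin `]a, b[ -> psi s = 0.
Proof.
move=> [_ [a' [b' [aa bb h]]]] hs; apply: h; apply: contra hs.
by rewrite !in_itv/= => /andP[h1 h2]; rewrite (lt_le_trans aa h1) (le_lt_trans h2 bb).
Qed.

Lemma test_outc psi s : test psi -> s \notin `[a, b] -> psi s = 0.
Proof.
move=> hp hs; apply: test_out hp _; apply: contra hs.
by rewrite !in_itv/= => /andP[/ltW -> /ltW ->].
Qed.

Lemma test_derive psi : test psi -> test (psi^`()%classic).
Proof.
move=> [sp [a' [b' [aa bb h]]]]; split; first exact (smooth_derive sp).
exists a', b'; split => // s hs.
have hn : \forall x \near s, psi x = cst 0 x.
  move: hs; rewrite in_itv/= negb_and -!ltNge => /orP[hs|hs].
    have : \forall x \near s, x < a' by exact: lt_nbhsl.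
    by apply: filterS => x xa; apply: h; rewrite in_itv/= leNgt xa.
  have : \forall x \near s, b' < x by exact: lt_nbhsr.
  by apply: filterS => x xa; apply: h; rewrite in_itv/= (leNgt x) xa andbF.
by rewrite derive1E (near_eq_derive _ hn) derive_cst.
Qed.

Lemma test_lin k psi psi' : test psi -> test psi' -> test (fun s => k * psi s + psi' s).
Proof.
move=> [sp [a1 [b1 [aa1 bb1 h1]]]] [sp' [a2 [b2 [aa2 bb2 h2]]]].
split; first exact (smoothD (@smoothZ R k psi sp) sp').
exists (Num.min a1 a2), (Num.max b1 b2); split.
- by rewrite lt_min aa1.
- by rewrite gt_max bb1.
move=> s; rewrite in_itv/= ge_min le_max => hs.
rewrite h1 ?h2 ?mulr0 ?addr0//; apply: contra hs; rewrite in_itv/= => /andP[-> ->]//.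
by rewrite !orbT.
Qed.

Lemma test_bump k c d : 0 <= k -> a < c -> d < b -> c <= d -> test (bump k c d).
Proof.
move=> k0 ac db cd; split; first exact (@smooth_bump R k c d).
by exists c, d; split => // s; exact: bump_supp.
Qed.

Lemma test_integrable psi : test psi -> leb.-integrable setT (EFin \o psi).
Proof.
move=> hp; apply: (@cont_supp_integrable _ psi a b); first exact: test_cont.
by move=> s; exact: test_outc.
Qed.

Lemma test_measurable psi : test psi -> measurable_fun setT psi.
Proof. by move=> hp; apply: continuous_measurable_fun; exact: test_cont. Qed.

Lemma test_L2 psi : test psi -> L2 psi.
Proof.
move=> hp; apply: L2P; first exact: test_measurable.
apply: (@cont_supp_integrable _ (fun s => psi s * psi s) a b).
  by move=> s; apply: cvgM; exact: test_cont.
by move=> s hs; rewrite (test_outc hp hs) mul0r.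
Qed.

Lemma test_abs_integrable psi : test psi -> leb.-integrable setT (EFin \o (fun s => `|psi s|)).
Proof. by move=> hp; have := integrable_norm (test_integrable hp). Qed.

(** The primitive that vanishes to the left of the support of [psi] is constant to its right, and
    the constant is the integral of [psi]; mean zero is exactly what makes the primitive compactly
    supported. *)
Lemma test_prim psi : test psi -> \int[leb]_s psi s = 0 ->
  exists Psi, [/\ test Psi, Psi^`()%classic = psi &
    forall s, `|Psi s| <= \int[leb]_s `|psi s|].
Proof.
move=> hp i0; have [_ [a' [b' [aa bb h]]]] := hp.
have cp := test_cont hp.
have [F dF] := antiderivative cp.
pose P s := F s - F a.
have dP s : is_derive s 1 P (psi s).
  by have := is_deriveB (dF s) (is_derive_cst (F a) s 1); rewrite subr0.
have sP : smooth P by exact: smoothS dP (test_smooth hp).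
have Pa : P a = 0 by rewrite /P subrr.
have PE s : a <= s -> P s = \int[leb]_(x in `[a, s]) psi x.
  by move=> as_; rewrite (FTC2R as_ cp dP) Pa subr0.
have Pb s : b <= s -> P s = 0.
  move=> bs; rewrite PE ?(le_trans (ltW ab))// -i0 (@cont_supp_Rint _ psi a s)//.
  move=> x hx; apply: (test_outc hp); apply: contra hx; rewrite !in_itv/= => /andP[-> h2].
  exact: le_trans bs.
have cab s c : (forall x, x \in `[s, c] -> psi x = 0) -> s <= c -> P c = P s.
  move=> hx sc; apply/eqP; rewrite -subr_eq0 -(FTC2R sc cp dP).
  by apply/eqP; apply: Rint_eq0 => x /= xs; rewrite hx.
have Plt s : s <= a -> P s = 0.
  move=> sa; rewrite -Pa; apply/esym/cab => // x; rewrite in_itv/= => /andP[_ xa].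
  by apply: (test_out hp); rewrite in_itv/= ltNge xa.
have a'b' : exists a2 b2, [/\ a < a2, b2 < b & forall s, s \notin `[a2, b2] -> P s = 0].
  pose a2 := Num.min a' b; pose b2 := Num.max b' a.
  have h2 : a < a2 by rewrite lt_min aa.
  have h3 : b2 < b by rewrite gt_max bb.
  exists (a2 - (a2 - a) / 2), (b2 + (b - b2) / 2); split; [lra|lra|].
  move=> s; rewrite in_itv/= negb_and -!ltNge => /orP[hs|hs].
    have [sa|/ltW sa] := leP s a; first exact: Plt.
    rewrite -Pa; apply: cab => // x; rewrite in_itv/= => /andP[_ xs].
    apply: h; rewrite in_itv/= leNgt (_ : x < a')//.
    by apply: (@lt_le_trans _ _ a2); [lra|rewrite ge_min lexx].
  have [sa|/ltW sa] := leP b s; first exact: Pb.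
  rewrite -(Pb b (lexx b)); apply/esym/cab => // x; rewrite in_itv/= => /andP[xs _].
  apply: h; rewrite in_itv/= (leNgt x) (_ : b' < x) ?andbF//.
  by apply: (@le_lt_trans _ _ b2); [rewrite le_max lexx|lra].
have tP : test P by split.
exists P; split => //; first exact: derive1_is_derive.
move=> s; have [sa|/ltW sa] := leP s a.
  by rewrite Plt// normr0 Rintegral_ge0.
rewrite PE//; apply: le_trans (le_normr_Rintegral _ _) _ => //; first exact: cont_int_itv.
rewrite Rintegral_mkcond; apply: le_Rintegral => //.
- by apply: cont_restrict_integrable => x; apply: continuous_comp; [exact: cp|exact: norm_continuous].
- exact: test_abs_integrable.
- by move=> x _; rewrite patchE; case: ifPn => // _; exact: normr_ge0.
Qed.

Lemma indE s : \1_(`]a, b[) s = (if s \in `]a, b[ then 1 else 0 : R).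
Proof. by rewrite indicE mem_setE; case: ifP. Qed.

Lemma L2_ind : L2 (\1_(`]a, b[) : R -> R).
Proof.
have hm : measurable (`]a, b[ : set R) by exact: measurable_itv.
apply: L2P; first exact: measurable_indic.
have -> : (fun x => \1_(`]a, b[) x * \1_(`]a, b[) x) = (\1_(`]a, b[) : R -> R).
  by apply/funext => x; rewrite indicE; case: (_ \in _); rewrite ?mulr1 ?mulr0.
exact: integrable_indic_itv.
Qed.

Lemma nrm_test psi M : test psi -> (forall s, `|psi s| <= M) -> 
  nrm psi <= M * nrm (\1_(`]a, b[) : R -> R).
Proof.
move=> hp hM; have M0 : 0 <= M by exact: le_trans (hM a).
rewrite -[X in X * _](ger0_norm M0) -nrmZ; last exact: L2_ind.
apply: nrm_le; [exact: test_L2|by apply: L2_Z; exact: L2_ind|].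
move=> s; rewrite indE; case: ifPn => hs.
  by rewrite mulr1 (le_trans (hM s))// ler_norm.
by rewrite (test_out hp hs) normr0.
Qed.

End ItvTest.

(** * Weak derivatives on an interval *)

Section ItvWeak.
Context {R : realType}.
Variables (a b : R).
Hypothesis ab : a < b.
Local Notation leb := (@lebesgue_measure R).
Local Notation cut u := (u \_ `]a, b[).
Local Notation test := (itv_test a b).
Local Notation L2 f := (f \in Lfun leb 2%:E).
Local Notation nrm f := (fine ('N[leb]_2%:E[EFin \o f%R])%E).
Implicit Types (u v w psi : R -> R) (s : R).

(** The margin (d - c)/(n + 3) is less than half the length, so the shrunk interval is nonempty; it
    stays away from c and d, which makes the bump a test function. The amplitude n + 1 drives its
    values to 1 inside. *)
Lemma bump_cvg (c d s : R) : c < d ->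
  bump n.+1%:R (c + (d - c) / n.+3%:R) (d - (d - c) / n.+3%:R) s @[n --> \oo] -->
  (if s \in `]c, d[ then 1 else 0 : R).
Proof.
move=> cd; have dc0 : 0 < d - c by rewrite subr_gt0.
have e0 n : 0 < (d - c) / n.+3%:R by rewrite divr_gt0.
have e2 n : 2 * ((d - c) / n.+3%:R) < d - c.
  by rewrite mulrA ltr_pdivrMr// mulrC ltr_pM2l// ltr_nat.
case: ifPn; last first.
  rewrite in_itv/= negb_and -!leNgt => hs; apply: cvg_near_cst; apply: nearW => n.
  have h := e0 n; have h2 := e2 n; move: h h2; set e := _ / _ => h h2.
  apply: bump_supp; [by rewrite ler0n|by lra|].
  by rewrite in_itv/= negb_and -!ltNge; case/orP: hs => hs; apply/orP; [left|right]; lra.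
rewrite in_itv/= => /andP[cs sd].
(* A lower bound for the product of the distances of [s] to the shrunk endpoints, valid once the
   margin is at most half of each original distance. *)
pose k := (s - c) * (d - s) / 4.
have k0 : 0 < k by rewrite divr_gt0// mulr_gt0// subr_gt0.
have c1 : (fun _ : nat => 1 : R) @ \oo --> (1 : R) by exact: cvg_cst.
apply: (squeeze_cvgr _ (en0_cvg1 k0) c1).
have ce : (d - c) / n.+3%:R @[n --> \oo] --> (0 : R).
  rewrite -(mulr0 (d - c)); apply: cvgM; first exact: cvg_cst.
  have := @cvg_harmonic R; rewrite -(cvg_shiftn 2)/= /harmonic.
  by under eq_fun do rewrite addn2.
have m0 : 0 < Num.min (s - c) (d - s) / 2 by rewrite divr_gt0// lt_min !subr_gt0 cs.
near=> n; rewrite bump_le1 andbT /bump; apply: en0_mono.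
rewrite ler_wpM2l ?ler0n//.
have : (d - c) / n.+3%:R < Num.min (s - c) (d - s) / 2.
  by near: n; exact: (cvgr_lt 0).
move: (e0 n); set e := _ / _ => h h1.
have [h2 h3] : e <= (s - c) / 2 /\ e <= (d - s) / 2.
  split; apply: (le_trans (ltW h1)); rewrite ler_pM2r ?invr_gt0//.
  - by rewrite ge_min lexx.
  - by rewrite ge_min lexx orbT.
have -> : k = ((s - c) / 2) * ((d - s) / 2) by rewrite /k; field.
apply: ler_pM; lra.
Unshelve. all: by end_near. Qed.

(** Bumps converge boundedly to the indicator of any open subinterval, so [h] integrates to zero
    over every open interval; these form a pi-system generating the Borel sets. *)
Lemma test_ae0 h : L2 h -> (forall s, s \notin `]a, b[ -> h s = 0) ->
  (forall psi, test psi -> \int[leb]_s (h s * psi s) = 0) ->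
  \forall s \ae leb, h s = 0.
Proof.
move=> Lh h0 hpsi.
have mh := L2_measurable Lh.
have ih : leb.-integrable setT (EFin \o h).
  have := L2_integrable Lh (@L2_ind R a b); apply: eq_integrable => // s _ /=.
  by rewrite indE; case: ifPn; rewrite ?mulr1// => hs; rewrite h0// mul0r.
have key c d : c < d -> a <= c -> d <= b ->
    \int[leb]_s (h s * (if s \in `]c, d[ then 1 else 0)) = 0.
  move=> cd ac db; have dc0 : 0 < d - c by rewrite subr_gt0.
  pose psi n := bump n.+1%:R (c + (d - c) / n.+3%:R) (d - (d - c) / n.+3%:R) : R -> R.
  have tpsi n : test (psi n).
    have e0 : 0 < (d - c) / n.+3%:R by rewrite divr_gt0.
    have e2 : 2 * ((d - c) / n.+3%:R) < d - c.
      by rewrite mulrA ltr_pdivrMr// mulrC ltr_pM2l// ltr_nat.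
    by move: e0 e2; rewrite /psi; set e := _ / _ => h1 h2; apply: test_bump => //; lra.
  have mi : measurable_fun setT (fun s => if s \in `]c, d[ then 1 else 0 : R).
    have -> : (fun s => if s \in `]c, d[ then 1 else 0 : R) = \1_(`]c, d[).
      by apply/funext => s; rewrite indE.
    exact: measurable_indic.
  have hl : \int[leb]_s (h s * psi n s) @[n --> \oo] -->
      \int[leb]_s (h s * (if s \in `]c, d[ then 1 else 0)).
    apply: (@dominated_cvgR _ _ _ leb setT (fun n s => h s * psi n s) _ (fun s => `|h s|)) => //.
    - by move=> n; apply: measurable_funM => //; exact: test_measurable (tpsi n).
    - exact: measurable_funM.
    - apply: aeW => s _; apply: cvgM; first exact: cvg_cst.
      exact: bump_cvg.
    - exact: (integrable_norm ih).
    - move=> n s _; rewrite normrM ler_piMr// ger0_norm ?bump_ge0//.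
      exact: bump_le1.
  have hE : (fun n => \int[leb]_s (h s * psi n s)) = (fun=> 0).
    by apply/funext => n; exact: hpsi.
  by rewrite hE in hl; apply: (cvg_unique _ hl) => //; exact: cvg_cst.
apply: (@pi_system_ae0 _ _ _ leb (@RGenOpens.G R)) => //.
- exact: RGenOpens.measurableE.
- move=> _ _ [x [y ->]] [x' [y' ->]]; exists (Num.max x x'), (Num.min y y').
  apply/funext => z; apply/propext; rewrite /= !in_itv/= gt_max lt_min.
  by split=> [[/andP[-> ->] /andP[-> ->]]|/andP[/andP[-> ->] /andP[-> ->]]].
- rewrite -(key a b ab (lexx a) (lexx b)); apply: eq_Rintegral => s _.
  by case: ifPn => hs; rewrite ?mulr1// mulr0 h0.
- move=> _ [x [y ->]]; rewrite Rintegral_mkcond.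
  pose c := Num.max x a; pose d := Num.min y b.
  have E s : (h \_ `]x, y[) s = h s * (if s \in `]c, d[ then 1 else 0).
    rewrite patchE mem_setE !in_itv/= gt_max lt_min.
    case: (boolP (a < s)) => ha; case: (boolP (s < b)) => hb;
      rewrite ?andbT ?andbF/= ?mulr0; last 3 first.
    + by rewrite h0 ?if_same//= in_itv/= negb_and hb orbT.
    + by rewrite h0 ?if_same//= in_itv/= negb_and ha.
    + by rewrite h0 ?if_same//= in_itv/= negb_and ha.
    by case: ifP => _; rewrite ?mulr1 ?mulr0.
  under eq_Rintegral do rewrite E.
  have [cd|dc] := ltP c d.
    by apply: key => //; [rewrite le_max lexx orbT|rewrite ge_min lexx orbT].
  rewrite (@Rint_eq0 R setT)// => s _; rewrite in_itv/=.
  case: ifPn; rewrite ?mulr0// => /andP[h1 h2].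
  by have := lt_trans h1 h2; rewrite ltNge dc.
Qed.

Lemma cut_lin (k : R) u v s : (cut (fun s => k * u s + v s)) s = k * (cut u) s + (cut v) s.
Proof. by rewrite !cutE; case: ifP => // _; rewrite mulr0 addr0. Qed.

Lemma itv_L2_lin (k : R) u v : itv_L2 a b u -> itv_L2 a b v ->
  itv_L2 a b (fun s => k * u s + v s).
Proof.
move=> hu hv; apply: L2_eq (L2_lin k hu hv) _ => s /=.
by rewrite cut_lin.
Qed.

Lemma is_wderiv_unique u w w' : itv_L2 a b w -> itv_L2 a b w' ->
  is_wderiv a b u w -> is_wderiv a b u w' -> \forall s \ae leb, (cut w) s = (cut w') s.
Proof.
move=> Lw Lw' /is_wderivE hw /is_wderivE hw'.
have : \forall s \ae leb, -1 * (cut w') s + (cut w) s = 0.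
  apply: test_ae0; first exact: (L2_lin (-1) Lw' Lw).
  - by move=> s hs; rewrite !cutE (negbTE hs) mulr0 addr0.
  - move=> psi tp; rewrite ip_lin//; last exact (test_L2 tp).
    have := hw' _ tp; rewrite hw// => /eqP; rewrite eqr_opp => /eqP ->.
    by rewrite mulN1r addNr.
apply: ae_imp => s /eqP.
by rewrite mulN1r addrC subr_eq0 => /eqP.
Qed.

Lemma is_wderiv_lin (k : R) u v w w' :
  itv_L2 a b u -> itv_L2 a b v -> itv_L2 a b w -> itv_L2 a b w' ->
  is_wderiv a b u w -> is_wderiv a b v w' ->
  is_wderiv a b (fun s => k * u s + v s) (fun s => k * w s + w' s).
Proof.
move=> Lu Lv Lw Lw' /is_wderivE h1 /is_wderivE h2; apply/is_wderivE => psi tp.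
under eq_Rintegral do rewrite cut_lin.
rewrite ip_lin//; last exact (test_L2 (test_derive tp)).
rewrite h1// h2//; under [in RHS]eq_Rintegral do rewrite cut_lin.
by rewrite ip_lin//; [ring|exact (test_L2 tp)].
Qed.

Lemma is_wderiv_ae u u' w : itv_L2 a b u -> itv_L2 a b u' ->
  (\forall s \ae leb, (cut u) s = (cut u') s) ->
  is_wderiv a b u w -> is_wderiv a b u' w.
Proof.
move=> Lu Lu' uu' /is_wderivE h; apply/is_wderivE => psi tp; rewrite -h//.
have md := test_measurable (test_derive tp).
apply: ae_Rintegral.
- by apply: measurable_funM => //; exact: L2_measurable Lu'.
- by apply: measurable_funM => //; exact: L2_measurable Lu.
- by apply: ae_imp uu' => s ->.
Qed.

Lemma wderivP u : (exists w, itv_L2 a b w /\ is_wderiv a b u w) ->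
  itv_L2 a b (wderiv a b u) /\ is_wderiv a b u (wderiv a b u).
Proof. by move=> [w hw]; rewrite /wderiv; case: xgetP => [_ _ //|/(_ w)]; case. Qed.

Lemma wderivE u w : itv_L2 a b w -> is_wderiv a b u w ->
  \forall s \ae leb, (cut (wderiv a b u)) s = (cut w) s.
Proof.
move=> Lw hw; have [L' h'] := wderivP (ex_intro _ w (conj Lw hw)).
exact: is_wderiv_unique h' hw.
Qed.

(* A test function minus its integral times eta (of integral one) is the
   derivative of a test function: this bounds u as a functional on L^1. *)
Lemma wderiv_dual_bound : exists2 C, 0 <= C & forall u w psi,
  itv_L2 a b u -> itv_L2 a b w -> is_wderiv a b u w -> test psi ->
  `|\int[leb]_s ((cut u) s * psi s)| <=
    C * (nrm (cut u) + nrm (cut w)) * \int[leb]_s `|psi s|.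
Proof.
have [eta teta ieta] : exists2 eta, test eta & \int[leb]_s eta s = 1.
  pose t := (b - a) / 4; have t0 : 0 < t by rewrite divr_gt0// subr_gt0.
  have bt : b = a + 4 * t by rewrite /t; field.
  have cd : a + t < b - t by rewrite bt; lra.
  have [rho [P [srho _ _ _ [rho0 [irho _ _ _]]]]] := mollifier cd.
  exists rho => //; split => //.
  by exists (a + t), (b - t); split => //; lra.
pose A := nrm eta; pose B := 1 + \int[leb]_s `|eta s|; pose D := nrm (\1_(`]a, b[) : R -> R).
have A0 : 0 <= A by exact: nrm_ge0.
have D0 : 0 <= D by exact: nrm_ge0.
have B0 : 0 <= B by rewrite addr_ge0// Rintegral_ge0.
exists (A + B * D); first by rewrite addr_ge0// mulr_ge0.
move=> u w psi Lu Lw /is_wderivE hw tp.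
pose m := \int[leb]_s psi s; pose M := \int[leb]_s `|psi s|.
have mM : `|m| <= M by apply: le_normr_Rintegral => //; exact (test_integrable tp).
have M0 : 0 <= M by rewrite Rintegral_ge0.
pose theta s := - m * eta s + psi s.
have tth : test theta by exact (test_lin (- m) teta tp).
have ith : \int[leb]_s theta s = 0.
  rewrite Rint_lin; [|exact (test_integrable teta)|exact (test_integrable tp)].
  by rewrite ieta mulr1 addNr.
have [Psi [tPsi dPsi bPsi]] := test_prim ab tth ith.
have bth : \int[leb]_s `|theta s| <= M * B.
  apply: (@le_trans _ _ (\int[leb]_s (`|m| * `|eta s| + `|psi s|))).
    apply: le_Rintegral => //.
    - exact (test_abs_integrable tth).
    - have ie := test_abs_integrable teta; have ip := test_abs_integrable tp.
      have := integrableD measurableT (integrableZl measurableT `|m| ie) ip.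
      by apply: eq_integrable.
    - by move=> s _; rewrite -[X in _ <= X * _ + _]normrN -normrM; exact: ler_normD.
  rewrite Rint_lin; [|exact (test_abs_integrable teta)|exact (test_abs_integrable tp)].
  rewrite /B mulrDr mulr1 addrC lerD2l ler_wpM2r// Rintegral_ge0//.
have -> : \int[leb]_s ((cut u) s * psi s) =
    m * (\int[leb]_s ((cut u) s * eta s)) - \int[leb]_s ((cut w) s * Psi s).
  rewrite -hw// dPsi /theta.
  have := @ip_lin _ _ _ leb (- m) eta psi (cut u) (test_L2 teta) (test_L2 tp) Lu.
  rewrite ipC => ->; rewrite (ipC leb eta) (ipC leb psi); ring.
have h1 := cauchy_schwarz Lu (test_L2 teta).
have h2 := cauchy_schwarz Lw (test_L2 tPsi).
have h3 : nrm Psi <= M * B * D.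
  apply: nrm_test => // s; exact: le_trans (bPsi s) bth.
apply: le_trans (ler_normB _ _) _; rewrite normrM.
have nu := nrm_ge0 leb (cut u); have nw := nrm_ge0 leb (cut w).
have h4 : `|m| * `|\int[leb]_s ((cut u) s * eta s)| <= M * (nrm (cut u) * A).
  by apply: ler_pM.
have h5 : nrm (cut w) * nrm Psi <= nrm (cut w) * (M * B * D) by rewrite ler_wpM2l.
have h6 : 0 <= M * (nrm (cut u) * (B * D)) by rewrite !mulr_ge0.
have h7 : 0 <= M * (nrm (cut w) * A) by rewrite !mulr_ge0.
rewrite -/M; move: h1 h2 h4 h5 h6 h7; set x := nrm (cut u); set y := nrm (cut w); set z := nrm Psi.
move=> h1 h2 h4 h5 h6 h7.
apply: le_trans (lerD h4 (le_trans h2 h5)) _.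
have -> : (A + B * D) * (x + y) * M = M * (x * A) + y * (M * B * D) + (M * (x * (B * D)) + M * (y * A)) by ring.
by rewrite lerDl addr_ge0.
Qed.

End ItvWeak.

(** * Continuous representatives and pointwise bounds by duality *)

Section ItvH2.
Context {R : realType}.
Variables (a b : R).
Hypothesis ab : a < b.
Local Notation leb := (@lebesgue_measure R).
Local Notation cut u := (u \_ `]a, b[).
Local Notation test := (itv_test a b).
Local Notation L2 f := (f \in Lfun leb 2%:E).
Implicit Types (u v w psi c : R -> R) (s x y e r K : R).

Lemma within_cont_near c x e : {within `[a, b], continuous c} -> x \in `[a, b] -> 0 < e ->
  exists2 r, 0 < r & forall s, s \in `[a, b] -> `|s - x| < r -> `|c s - c x| < e.
Proof.
move=> cc xab e0.
have /subspace_continuousP/(_ x xab)/cvgrPdist_lt/(_ e e0) := cc.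
rewrite near_withinE => /nbhs_ballP[r /= r0 h]; exists r => // s sab sx.
by rewrite distrC; apply: (h s) => //; rewrite /ball /= distrC.
Qed.

Lemma cont_itv_L2 c : {within `[a, b], continuous c} -> itv_L2 a b c.
Proof.
move=> cc.
have mc : measurable_fun setT (cut c).
  apply/(@measurable_restrictT _ _ _ _ `]a, b[); first exact: measurable_itv.
  apply: (@measurable_funS _ _ _ _ `[a, b]) => //.
    by apply: subset_itvW; rewrite lexx.
  by apply: subspace_continuous_measurable_fun.
have cn : {within `[a, b], continuous (fun s => `|c s|)}.
  by move=> s; apply: continuous_comp; [exact: cc|exact: norm_continuous].
have [m mab hm] := EVT_max (ltW ab) cn.
apply: (@L2_dom _ _ _ leb (cut c) _ mc (L2_Z `|c m| (@L2_ind R a b))) => s.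
rewrite cutE indE; case: ifPn => hs; last by rewrite normr0.
rewrite mulr1 normr_id; apply: hm; move: hs; rewrite !in_itv/= => /andP[h1 h2].
by rewrite !ltW.
Qed.

Lemma cont_interval c x e r : {within `[a, b], continuous c} -> x \in `[a, b] ->
  0 < e -> 0 < r -> exists c' d' : R, [/\ a < c', c' < d', d' < b &
    forall s, s \in `[c', d'] -> `|c s - c x| < e /\ `|s - x| < r].
Proof.
move=> cc xab e0 r0.
have [r1 r10 h1] := within_cont_near cc xab e0.
pose q := Num.min r r1.
have q0 : 0 < q by rewrite lt_min r0.
have [qr qr1] : q <= r /\ q <= r1 by rewrite !ge_min !lexx orbT.
move: (xab); rewrite in_itv/= => /andP[ax xb].
(* [x] may be an endpoint, so the subinterval is placed beside it: to the right, or to the left when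
   [x = b]. It then stays strictly inside ]a, b[. *)
have [xb'|bx] := ltP x b.
  pose p := Num.min (x + q) b.
  have pb : p <= b by rewrite ge_min lexx orbT.
  have pq : p <= x + q by rewrite ge_min lexx.
  have xp : x < p by rewrite lt_min xb' ltrDl q0.
  pose t := (p - x) / 3; have t0 : 0 < t by rewrite divr_gt0// subr_gt0.
  have pE : p = x + 3 * t by rewrite /t; field.
  exists (x + t), (x + 2 * t); split; [lra|lra|lra|].
  move=> s; rewrite in_itv/= => /andP[s1 s2].
  have sx : `|s - x| < q by rewrite ltr_norml; apply/andP; split; lra.
  split; last exact: lt_le_trans qr.
  by apply: h1; [rewrite in_itv/=; apply/andP; split; lra|exact: lt_le_trans qr1].
pose p := Num.max (x - q) a.
have pb : a <= p by rewrite le_max lexx orbT.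
have pq : x - q <= p by rewrite le_max lexx.
have xp : p < x by rewrite gt_max ltrBlDr ltrDl q0 (lt_le_trans ab).
pose t := (x - p) / 3; have t0 : 0 < t by rewrite divr_gt0// subr_gt0.
have pE : p = x - 3 * t by rewrite /t; field.
exists (x - 2 * t), (x - t); split; [lra|lra|lra|].
move=> s; rewrite in_itv/= => /andP[s1 s2].
have sx : `|s - x| < q by rewrite ltr_norml; apply/andP; split; lra.
split; last exact: lt_le_trans qr.
by apply: h1; [rewrite in_itv/=; apply/andP; split; lra|exact: lt_le_trans qr1].
Qed.

Lemma mollify_near c x e : {within `[a, b], continuous c} -> x \in `[a, b] -> 0 < e ->
  exists (c' d' : R) (rho P : R -> R), [/\ a < c' /\ d' < b, x - e < c' /\ d' < x + e, c' < d',
    [/\ test rho, smooth P, (forall s, is_derive s 1 P (rho s)),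
      (forall s, 0 <= rho s) & \int[leb]_s rho s = 1] &
    [/\ (forall s, s <= c' -> P s = 0), (forall s, d' <= s -> P s = 1),
      (forall s, 0 <= P s <= 1) & `|\int[leb]_s ((cut c) s * rho s) - c x| <= e]].
Proof.
move=> cc xab e0.
have [c' [d' [ac cd db h]]] := cont_interval cc xab e0 e0.
have [rho [P [srho sP dP rho0 [rhos [irho Pl Pg Pb]]]]] := mollifier cd.
have tr : test rho by split => //; exists c', d'.
exists c', d', rho, P; split => //.
  have [|_] := h c' _; first by rewrite in_itv/= lexx ltW.
  have [|_] := h d' _; first by rewrite in_itv/= lexx ltW.
  by rewrite !ltr_norml => /andP[_ h1] /andP[h2 _]; split; lra.
split => //.
have Lc := cont_itv_L2 cc.
have ir := test_integrable tr.
have -> : \int[leb]_s ((cut c) s * rho s) - c x =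
    \int[leb]_s (- c x * rho s + (cut c) s * rho s).
  rewrite Rint_lin; [|exact: ir|exact: (L2_integrable Lc (test_L2 tr))].
  by rewrite irho mulr1 addrC.
have ii : leb.-integrable setT (EFin \o (fun s => - c x * rho s + (cut c) s * rho s)).
  have := integrableD measurableT (integrableZl measurableT (- c x) ir)
    (L2_integrable Lc (test_L2 tr)).
  by apply: eq_integrable.
apply: le_trans (le_normr_Rintegral _ ii) _ => //.
rewrite -[leRHS]mulr1 -irho -RintegralZl//.
apply: le_Rintegral => //.
- exact: (integrable_norm ii).
- by have := integrableZl measurableT e ir; apply: eq_integrable.
move=> s _; rewrite -mulrDl normrM (ger0_norm (rho0 s)).
have [sc|sc] := boolP (s \in `[c', d']); last by rewrite rhos// !mulr0.
apply: ler_wpM2r => //; rewrite cutE ifT; last first.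
  by move: sc; rewrite !in_itv/= => /andP[s1 s2]; rewrite (lt_le_trans ac s1) (le_lt_trans s2 db).
by have [h1 _] := h s sc; rewrite addrC ltW.
Qed.

(** Mollifiers of unit mass concentrating near [x] are test functions of L^1 norm 1 whose pairings
    with [c] approach [c x], at the endpoints as well. *)
Lemma dual_sup_bound c K : {within `[a, b], continuous c} ->
  (forall psi, test psi -> `|\int[leb]_s ((cut c) s * psi s)| <= K * \int[leb]_s `|psi s|) ->
  forall x, x \in `[a, b] -> `|c x| <= K.
Proof.
move=> cc hK x xab; apply/ler_addgt0Pr => e e0.
have [c' [d' [rho [P [_ _ _ [tr _ _ rho0 irho] [_ _ _ h]]]]]] := mollify_near cc xab e0.
have := hK _ tr; under [in leRHS]eq_Rintegral do rewrite ger0_norm//.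
rewrite irho mulr1; move: h; set I := Rintegral _ _ _ => h hI.
have -> : c x = I - (I - c x) by ring.
by apply: le_trans (ler_normB _ _) _; rewrite lerD.
Qed.

(** Up to mollification, c x - c y is the pairing of [c] with the derivative of [Psi], a difference
    of two smooth steps located near [x] and near [y]. It is thus minus the pairing of [w] with
    [Psi], whose L^1 norm is about |x - y|. *)
Lemma dual_lipschitz c w K : {within `[a, b], continuous c} -> is_wderiv a b c w ->
  0 <= K ->
  (forall psi, test psi -> `|\int[leb]_s ((cut w) s * psi s)| <= K * \int[leb]_s `|psi s|) ->
  forall x y, x \in `[a, b] -> y \in `[a, b] -> `|c x - c y| <= K * `|x - y|.
Proof.
move=> cc /is_wderivE hw K0 hK x y xab yab.
have Lc := cont_itv_L2 cc.
(* The two mollifications cost [e] each, and the support of [Psi] may exceed the segment by [2 * e],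
   which is weighted by [K]. *)
suff h e : 0 < e -> `|c x - c y| <= K * `|x - y| + (2 + 2 * K) * e.
  apply/ler_addgt0Pr => e e0.
  have p0 : 0 < 2 + 2 * K by lra.
  by have := h (e / (2 + 2 * K)) (divr_gt0 e0 p0); rewrite mulrCA mulfV ?gt_eqF// mulr1.
move=> e0.
have [c1 [d1 [r1 [P1 [[ac1 db1] [xc1 dx1] cd1 [tr1 sP1 dP1 r10 ir1] [Pl1 Pg1 Pb1 h1]]]]]] :=
  mollify_near cc xab e0.
have [c2 [d2 [r2 [P2 [[ac2 db2] [xc2 dx2] cd2 [tr2 sP2 dP2 r20 ir2] [Pl2 Pg2 Pb2 h2]]]]]] :=
  mollify_near cc yab e0.
pose Psi s := P1 s - P2 s.
have dPsi s : is_derive s 1 Psi (r1 s - r2 s).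
  exact: is_deriveB (dP1 s) (dP2 s).
pose m := Num.min c1 c2; pose M := Num.max d1 d2.
have Psi0 s : s \notin `[m, M] -> Psi s = 0.
  rewrite in_itv/= negb_and -!ltNge lt_min gt_max => /orP[/andP[/ltW s1 /ltW s2]|/andP[/ltW s1 /ltW s2]].
    by rewrite /Psi Pl1// Pl2// subrr.
  by rewrite /Psi Pg1// Pg2// subrr.
have tPsi : test Psi.
  split; first exact (smoothB sP1 sP2).
  by exists m, M; split => //; rewrite /m /M ?lt_min ?gt_max ?ac1 ?db1.
have bPsi : \int[leb]_s `|Psi s| <= `|x - y| + 2 * e.
  have mM : m <= M by rewrite ge_min (le_trans (ltW cd1))// le_max lexx.
  rewrite (@cont_supp_Rint _ (fun s => `|Psi s|) m M); last first.
    by move=> s hs; rewrite Psi0// normr0.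
  have cPsi := test_cont tPsi.
  apply: (@le_trans _ _ (\int[leb]_(s in `[m, M]) 1)).
    apply: le_Rintegral => //.
    - by apply: cont_int_itv => s; apply: continuous_comp; [exact: cPsi|exact: norm_continuous].
    - by apply: cont_int_itv; exact: cst_continuous.
    move=> s _; have /andP[? ?] := Pb1 s; have /andP[? ?] := Pb2 s.
    by rewrite /Psi ler_norml; apply/andP; split; lra.
  rewrite Rintegral_cst// mul1r; have := lebesgue_measure_itv `[m, M]%R => /= ->.
  have hM : M - m <= `|x - y| + 2 * e.
    have k1 := ler_norm (x - y); have k2 := ler_norm (y - x); rewrite distrC in k2.
    rewrite /M /m; case: (leP c1 c2) => _; case: (leP d1 d2) => _; lra.
  case: ifPn => _ /=; first exact: hM.
  by rewrite addr_ge0// mulr_ge0// ltW.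
have -> : c x - c y = - (\int[leb]_s ((cut c) s * r1 s) - c x) +
    (\int[leb]_s ((cut c) s * r2 s) - c y) + \int[leb]_s ((cut c) s * (r1 s - r2 s)).
  have -> : \int[leb]_s ((cut c) s * (r1 s - r2 s)) =
      \int[leb]_s ((cut c) s * r1 s) - \int[leb]_s ((cut c) s * r2 s).
    rewrite -RintegralB; [|exact: measurableT|exact: (L2_integrable Lc (test_L2 tr1))|exact: (L2_integrable Lc (test_L2 tr2))].
    by apply: eq_Rintegral => s _; rewrite mulrBr.
  by ring.
have h3 : `|\int[leb]_s ((cut c) s * (r1 s - r2 s))| <= K * (`|x - y| + 2 * e).
  have -> : (fun s => (cut c) s * (r1 s - r2 s)) = (fun s => (cut c) s * Psi^`()%classic s).
    by apply/funext => s; rewrite (derive1_is_derive dPsi).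
  rewrite hw// normrN; apply: le_trans (hK _ tPsi) _.
  by rewrite ler_wpM2l.
apply: le_trans (ler_normD _ _) _.
apply: le_trans (lerD (ler_normD _ _) h3) _.
by rewrite normrN; move: h1 h2; set A := `|_|; set B := `|_ - c y| => h1 h2; lra.
Qed.

Lemma int_cut_test u psi : test psi -> \int[leb]_s ((cut u) s * psi s) = \int[leb]_s (u s * psi s).
Proof.
move=> tp; apply: eq_Rintegral => s _; rewrite cutE; case: ifPn => // hs.
by rewrite (test_out tp hs) !mulr0.
Qed.

Lemma C1_wderiv u u' : (forall s, is_derive s 1 u (u' s)) -> continuous u' -> is_wderiv a b u u'.
Proof.
move=> du cu'; apply/is_wderivE => psi tp.
have tp' := test_derive tp.
have cp := test_cont tp; have cp' := test_cont tp'.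
have cu : continuous u by move=> s; exact: is_derive_continuous (du s).
rewrite !int_cut_test//; apply/eqP; rewrite -addr_eq0; apply/eqP.
have i1 : leb.-integrable setT (EFin \o (fun s => u s * psi^`()%classic s)).
  apply: (@cont_supp_integrable _ _ a b) => [s|s hs].
    by apply: cvgM; [exact: cu|exact: cp'].
  by rewrite (test_outc tp' hs) mulr0.
have i2 : leb.-integrable setT (EFin \o (fun s => u' s * psi s)).
  apply: (@cont_supp_integrable _ _ a b) => [s|s hs].
    by apply: cvgM; [exact: cu'|exact: cp].
  by rewrite (test_outc tp hs) mulr0.
rewrite -RintegralD//.
rewrite (@cont_supp_Rint _ _ a b); last first.
  by move=> s hs; rewrite (test_outc tp hs) (test_outc tp' hs) !mulr0 addr0.
have dup s : is_derive s 1 (fun s => u s * psi s) (u s * psi^`()%classic s + u' s * psi s).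
  have := is_deriveM (du s) (smooth_is_derive s (test_smooth tp)).
  by move=> h; apply: (is_derive_eq h); rewrite /GRing.scale /= (mulrC (psi s)).
have cc : continuous (fun s => u s * psi^`()%classic s + u' s * psi s).
  move=> s; apply: cvgD; apply: cvgM; [exact: cu|exact: cp'|exact: cu'|exact: cp].
rewrite (FTC2R (ltW ab) cc dup) !(@test_out _ a b psi) ?mulr0 ?subrr//.
- by rewrite in_itv/= ltxx.
- by rewrite in_itv/= ltxx andbF.
Qed.

Lemma itv_H2_parts u : itv_H2 a b u -> [/\ L2 (cut u), L2 (cut (wderiv a b u)),
  L2 (cut (wderiv a b (wderiv a b u))), is_wderiv a b u (wderiv a b u) &
  is_wderiv a b (wderiv a b u) (wderiv a b (wderiv a b u))].
Proof.
move=> [_ Lu /wderivP [L1 h1] /wderivP [L2' h2]].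
by split; [exact: Lu|exact: L1|exact: L2'|exact: h1|exact: h2].
Qed.

Lemma itv_H2_lin (k : R) u v : itv_H2 a b u -> itv_H2 a b v ->
  [/\ itv_H2 a b (fun s => k * u s + v s),
   \forall s \ae leb, (cut (wderiv a b (fun s => k * u s + v s))) s =
     k * (cut (wderiv a b u)) s + (cut (wderiv a b v)) s &
   \forall s \ae leb, (cut (wderiv a b (wderiv a b (fun s => k * u s + v s)))) s =
     k * (cut (wderiv a b (wderiv a b u))) s + (cut (wderiv a b (wderiv a b v))) s].
Proof.
move=> Hu Hv.
have [Lu Lu1 Lu2 hu1 hu2] := itv_H2_parts Hu; have [Lv Lv1 Lv2 hv1 hv2] := itv_H2_parts Hv.
have h1 := is_wderiv_lin k Lu Lv Lu1 Lv1 hu1 hv1.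
have h2 := is_wderiv_lin k Lu1 Lv1 Lu2 Lv2 hu2 hv2.
have L1 := itv_L2_lin k Lu1 Lv1; have L2' := itv_L2_lin k Lu2 Lv2.
have e1 := wderivE ab L1 h1.
have [Lw1 _] := wderivP (ex_intro _ _ (conj L1 h1)).
(* The second derivative is that of the chosen first derivative, so the linear rule has to be
   carried over along the almost everywhere equality [e1]. *)
have h2' : is_wderiv a b (wderiv a b (fun s => k * u s + v s)) _ :=
  is_wderiv_ae L1 Lw1 (ae_sym e1) h2.
have e2 := wderivE ab L2' h2'.
split.
- split.
  + have [cu _ _ _] := Hu; have [cv _ _ _] := Hv => s.
    apply: cvgD; last exact: cv.
    by apply: cvgM; [exact: cvg_cst|exact: cu].
  + exact: itv_L2_lin.
  + by exists (fun s => k * wderiv a b u s + wderiv a b v s); split; [exact: L1|exact: h1].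
  + by eexists; split; [exact: L2'|exact: h2'].
- by apply: ae_imp e1 => s h; exact: etrans h (cut_lin a b k _ _ s).
- by apply: ae_imp e2 => s h; exact: etrans h (cut_lin a b k _ _ s).
Qed.

Lemma C2_itv_H2 u u' u'' : (forall s, is_derive s 1 u (u' s)) ->
  (forall s, is_derive s 1 u' (u'' s)) -> continuous u'' -> itv_H2 a b u.
Proof.
move=> du du' cu''.
have cu : continuous u by move=> s; exact: is_derive_continuous (du s).
have cu' : continuous u' by move=> s; exact: is_derive_continuous (du' s).
have h1 := C1_wderiv du cu'; have h2 := C1_wderiv du' cu''.
have L f : continuous f -> itv_L2 a b f by move=> cf; apply: cont_itv_L2; exact: cont_within.
have [Lw _] := wderivP (ex_intro _ _ (conj (L _ cu') h1)).
have e1 := wderivE ab (L _ cu') h1.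
split; [exact: cont_within|exact: (L _ cu)|by exists u'; split; [exact: (L _ cu')|exact: h1]|].
exists u''; split; first exact: L.
exact: is_wderiv_ae (L _ cu') Lw (ae_sym e1) h2.
Qed.

End ItvH2.

Section Sqrt3.
Context {R : realType}.
Implicit Types x y z : R.

(** The Euclidean norm that assembles the H^2 norm from the L^2 norms of u, u' and u''; the laws of
    the H^2 norm follow from those of L^2 and of R^3. *)
Definition sqrt3 x y z := Num.sqrt (x ^+ 2 + y ^+ 2 + z ^+ 2).

Lemma sqrt3_ge0 x y z : 0 <= sqrt3 x y z. Proof. exact: sqrtr_ge0. Qed.

Lemma sqrt3_sqr x y z : sqrt3 x y z ^+ 2 = x ^+ 2 + y ^+ 2 + z ^+ 2.
Proof. by rewrite sqr_sqrtr// !addr_ge0// sqr_ge0. Qed.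

Lemma sqrt3_comp x y z : 0 <= x -> 0 <= y -> 0 <= z ->
  [/\ x <= sqrt3 x y z, y <= sqrt3 x y z & z <= sqrt3 x y z].
Proof.
move=> x0 y0 z0; have hx := sqr_ge0 x; have hy := sqr_ge0 y; have hz := sqr_ge0 z.
by split; rewrite -(@ler_pXn2r _ 2)//; rewrite ?nnegrE ?sqrt3_ge0// sqrt3_sqr; lra.
Qed.

Lemma sqrt3_le_sum x y z : 0 <= x -> 0 <= y -> 0 <= z -> sqrt3 x y z <= x + y + z.
Proof.
move=> x0 y0 z0; rewrite -(@ler_pXn2r _ 2)//; rewrite ?nnegrE ?sqrt3_ge0 ?addr_ge0//.
have h1 := mulr_ge0 x0 y0; have h2 := mulr_ge0 x0 z0; have h3 := mulr_ge0 y0 z0.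
rewrite sqrt3_sqr !expr2; lra.
Qed.

Lemma sqrt3_mono x y z x' y' z' : 0 <= x -> 0 <= y -> 0 <= z ->
  x <= x' -> y <= y' -> z <= z' -> sqrt3 x y z <= sqrt3 x' y' z'.
Proof.
move=> x0 y0 z0 xx yy zz; rewrite -(@ler_pXn2r _ 2)//; rewrite ?nnegrE ?sqrt3_ge0//.
rewrite !sqrt3_sqr; apply: lerD; first apply: lerD; rewrite lerXn2r// nnegrE//.
- exact: le_trans xx.
- exact: le_trans yy.
- exact: le_trans zz.
Qed.

(** Minkowski's inequality in R^3; the deficit in Cauchy-Schwarz is a sum of three squares
    (Lagrange's identity). *)
Lemma sqrt3D x y z x' y' z' :
  sqrt3 (x + x') (y + y') (z + z') <= sqrt3 x y z + sqrt3 x' y' z'.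
Proof.
rewrite -(@ler_pXn2r _ 2)//; rewrite ?nnegrE ?addr_ge0 ?sqrt3_ge0//.
rewrite [leRHS]sqrrD !sqrt3_sqr.
suff : x * x' + y * y' + z * z' <= sqrt3 x y z * sqrt3 x' y' z'.
  by move: (_ * sqrt3 _ _ _) => p; rewrite mulr2n !sqrrD; lra.
apply: le_trans (ler_norm _) _.
rewrite -(@ler_pXn2r _ 2)//; rewrite ?nnegrE ?mulr_ge0 ?sqrt3_ge0//.
rewrite exprMn !sqrt3_sqr real_normK ?num_real//.
have h1 := sqr_ge0 (x * y' - y * x'); have h2 := sqr_ge0 (x * z' - z * x').
have h3 := sqr_ge0 (y * z' - z * y').
rewrite -subr_ge0; apply: le_trans (addr_ge0 (addr_ge0 h1 h2) h3) _.
by rewrite le_eqVlt; apply/orP; left; apply/eqP; ring.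
Qed.

Lemma par3 x1 x2 x3 y1 y2 y3 p1 p2 p3 q1 q2 q3 :
  p1 + q1 = 2 * x1 + 2 * y1 -> p2 + q2 = 2 * x2 + 2 * y2 -> p3 + q3 = 2 * x3 + 2 * y3 ->
  p1 + p2 + p3 + (q1 + q2 + q3) = 2 * (x1 + x2 + x3) + 2 * (y1 + y2 + y3) :> R.
Proof. lra. Qed.

Lemma par_sqrt3 x1 x2 x3 y1 y2 y3 p1 p2 p3 q1 q2 q3 n1 n2 m1 m2 :
  n1 = sqrt3 p1 p2 p3 -> n2 = sqrt3 q1 q2 q3 -> m1 = sqrt3 x1 x2 x3 -> m2 = sqrt3 y1 y2 y3 ->
  p1 ^+ 2 + q1 ^+ 2 = 2 * x1 ^+ 2 + 2 * y1 ^+ 2 ->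
  p2 ^+ 2 + q2 ^+ 2 = 2 * x2 ^+ 2 + 2 * y2 ^+ 2 ->
  p3 ^+ 2 + q3 ^+ 2 = 2 * x3 ^+ 2 + 2 * y3 ^+ 2 ->
  n1 ^+ 2 + n2 ^+ 2 = 2 * m1 ^+ 2 + 2 * m2 ^+ 2.
Proof. by move=> -> -> -> ->; rewrite !sqrt3_sqr; exact: par3. Qed.

Lemma geo_step p q r t : p <= t -> q <= r + 2 - 2 * t ->
  p + q <= r + 2 - 2 * (2^-1 * t) :> R.
Proof. lra. Qed.

End Sqrt3.

#[local] Opaque wderiv is_wderiv.

(** * H^2 as a complete space with the parallelogram law *)

Section ItvHilbert.
Context {R : realType}.
Variables (a b : R).
Hypothesis ab : a < b.
Local Notation leb := (@lebesgue_measure R).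
Local Notation cut u := (u \_ `]a, b[).
Local Notation L2 f := (f \in Lfun leb 2%:E).
Local Notation nrm f := (fine ('N[leb]_2%:E[EFin \o f%R])%E).
Local Notation D1 u := (cut (wderiv a b u)).
Local Notation D2 u := (cut (wderiv a b (wderiv a b u))).
Local Notation N := (itv_H2norm a b).
Local Notation H := (itv_H2 a b).
Implicit Types (u v w psi c : R -> R) (s x y e r K : R).

Lemma NE u : N u = sqrt3 (nrm (cut u)) (nrm (D1 u)) (nrm (D2 u)).
Proof. by []. Qed.

Lemma nrm_lin (k : R) u v : H u -> H v ->
  let w := fun s => k * u s + v s in
  [/\ nrm (cut w) = nrm (fun s => k * (cut u) s + (cut v) s),
      nrm (D1 w) = nrm (fun s => k * (D1 u) s + (D1 v) s) &
      nrm (D2 w) = nrm (fun s => k * (D2 u) s + (D2 v) s)].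
Proof.
move=> Hu Hv w.
have [Hw e1 e2] := itv_H2_lin ab k Hu Hv.
have [Lu Lu1 Lu2 _ _] := itv_H2_parts Hu; have [Lv Lv1 Lv2 _ _] := itv_H2_parts Hv.
have [Lw Lw1 Lw2 _ _] := itv_H2_parts Hw.
split.
- apply: ae_nrm => //; first exact: (L2_lin k Lu Lv).
  by apply: aeW => s; rewrite cut_lin.
- by apply: ae_nrm => //; exact: (L2_lin k Lu1 Lv1).
- by apply: ae_nrm => //; exact: (L2_lin k Lu2 Lv2).
Qed.

Lemma NE_eq u x y z : nrm (cut u) = x -> nrm (D1 u) = y -> nrm (D2 u) = z ->
  N u = sqrt3 x y z.
Proof. by move=> <- <- <-. Qed.

Lemma H2norm_lin (k : R) u v : H u -> H v ->
  N (fun s => k * u s + v s) = sqrt3 (nrm (fun s => k * (cut u) s + (cut v) s))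
    (nrm (fun s => k * (D1 u) s + (D1 v) s)) (nrm (fun s => k * (D2 u) s + (D2 v) s)).
Proof. by move=> Hu Hv; have [e0 e1 e2] := nrm_lin k Hu Hv; exact: NE_eq e0 e1 e2. Qed.

Lemma H2normZ (k : R) u : H u -> N (fun s => k * u s) = `|k| * N u.
Proof.
move=> Hu; have [Lu Lu1 Lu2 _ _] := itv_H2_parts Hu.
(* Written as a combination of [u] with itself, so that [H2norm_lin] covers scaling too. *)
have -> : (fun s => k * u s) = (fun s => (k - 1) * u s + u s) by apply/funext => s; ring.
have E f : L2 f -> nrm (fun s => (k - 1) * f s + f s) = `|k| * nrm f.
  by move=> Lf; rewrite -nrmZ//; congr (fine (Lnorm _ _ _)); apply/funext => s /=; congr EFin; ring.
rewrite (H2norm_lin (k - 1) Hu Hu) (E _ Lu) (E _ Lu1) (E _ Lu2) NE.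
apply/eqP; rewrite -(@eqrXn2 _ 2)// ?sqrt3_ge0// ?mulr_ge0 ?sqrt3_ge0//.
by rewrite exprMn !sqrt3_sqr; apply/eqP; ring.
Qed.

Lemma H2normD u v : H u -> H v -> N (fun s => u s + v s) <= N u + N v.
Proof.
move=> Hu Hv.
have [Lu Lu1 Lu2 _ _] := itv_H2_parts Hu; have [Lv Lv1 Lv2 _ _] := itv_H2_parts Hv.
have -> : (fun s => u s + v s) = (fun s => 1 * u s + v s) by apply/funext => s; ring.
have E f g : L2 f -> L2 g -> nrm (fun s => 1 * f s + g s) <= nrm f + nrm g.
  move=> Lf Lg; have -> : (fun s => 1 * f s + g s) = (fun s => f s + g s).
    by apply/funext => s; rewrite mul1r.
  exact: nrmD.
rewrite (H2norm_lin 1 Hu Hv) (NE u) (NE v); apply: (le_trans _ (sqrt3D _ _ _ _ _ _)).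
by apply: sqrt3_mono; [exact: nrm_ge0|exact: nrm_ge0|exact: nrm_ge0|exact: (E _ _ Lu Lv)|
  exact: (E _ _ Lu1 Lv1)|exact: (E _ _ Lu2 Lv2)].
Qed.

Lemma H2_parallelogram u v : H u -> H v ->
  N (fun s => u s + v s) ^+ 2 + N (fun s => u s - v s) ^+ 2 = 2 * N u ^+ 2 + 2 * N v ^+ 2.
Proof.
move=> Hu Hv.
have [Lu Lu1 Lu2 _ _] := itv_H2_parts Hu; have [Lv Lv1 Lv2 _ _] := itv_H2_parts Hv.
have -> : (fun s => u s + v s) = (fun s => 1 * u s + v s) by apply/funext => s; ring.
have -> : (fun s => u s - v s) = (fun s => -1 * v s + u s) by apply/funext => s; ring.
have E f g : L2 f -> L2 g -> nrm (fun s => 1 * f s + g s) ^+ 2 + nrm (fun s => -1 * g s + f s) ^+ 2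
    = 2 * nrm f ^+ 2 + 2 * nrm g ^+ 2.
  move=> Lf Lg; rewrite -nrm_parallelogram//; congr (_ ^+ 2 + _ ^+ 2);
    congr (fine (Lnorm _ _ _)); apply/funext => s /=; congr EFin; ring.
have k0 := E _ _ Lu Lv; have k1 := E _ _ Lu1 Lv1; have k2 := E _ _ Lu2 Lv2.
exact: (par_sqrt3 (H2norm_lin 1 Hu Hv) (H2norm_lin (-1) Hv Hu) (NE u) (NE v) k0 k1 k2).
Qed.

Lemma nrm_le_H2norm u : [/\ nrm (cut u) <= N u, nrm (D1 u) <= N u & nrm (D2 u) <= N u].
Proof. by apply: sqrt3_comp; exact: nrm_ge0. Qed.

(** The dual bound for the pair (u, u') gives the sup bound and for the pair (u', u'') the Lipschitz
    bound; the factor 2 comes from estimating both L^2 norms in it by [N u]. *)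
Lemma H2_embedding : exists2 C, 0 <= C & forall u, H u ->
  (forall x, x \in `[a, b] -> `|u x| <= C * N u) /\
  (forall x y, x \in `[a, b] -> y \in `[a, b] -> `|u x - u y| <= C * N u * `|x - y|).
Proof.
have [C C0 hC] := wderiv_dual_bound ab.
exists (C * 2); first by rewrite mulr_ge0.
move=> u Hu; have [Lu Lu1 Lu2 h1 h2] := itv_H2_parts Hu.
have [cu _ _ _] := Hu.
have [n0 n1 n2] := nrm_le_H2norm u.
have hK x y : x <= N u -> y <= N u -> C * (x + y) <= C * 2 * N u.
  by move=> hx hy; rewrite -mulrA ler_wpM2l//; lra.
split.
- apply: dual_sup_bound cu _ => // psi tp.
  apply: le_trans (hC _ _ _ Lu Lu1 h1 tp) _.
  by rewrite ler_wpM2r ?Rintegral_ge0// hK.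
- move=> x y xab yab; apply: (dual_lipschitz ab cu h1) => //.
    by rewrite !mulr_ge0// sqrt3_ge0.
  move=> psi tp; apply: le_trans (hC _ _ _ Lu1 Lu2 h2 tp) _.
  by rewrite ler_wpM2r ?Rintegral_ge0// hK.
Qed.

Lemma ip_cvg (f : nat -> R -> R) g h (z : nat -> R) : (forall n, L2 (f n)) -> L2 g -> L2 h ->
  (forall n, nrm (fun x => f n x - g x) <= z n) -> z n @[n --> \oo] --> (0 : R) ->
  \int[leb]_x (f n x * h x) @[n --> \oo] --> \int[leb]_x (g x * h x).
Proof.
move=> Lf Lg Lh hz cz; apply/subr_cvg0/norm_cvg0P.
have hl : z n * nrm h @[n --> \oo] --> (0 : R).
  by rewrite -(mul0r (nrm h)); apply: cvgM => //; exact: cvg_cst.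
apply: (squeeze_cvgr _ (cvg_cst 0) hl); apply: nearW => n.
rewrite normr_ge0 /=; have := cauchy_schwarz (L2_B (Lf n) Lg) Lh.
have -> : \int[leb]_x ((f n x - g x) * h x) =
    \int[leb]_x (f n x * h x) - \int[leb]_x (g x * h x).
  rewrite -RintegralB; [|exact: measurableT|exact: L2_integrable|exact: L2_integrable].
  by apply: eq_Rintegral => x _; rewrite mulrBl.
by move=> h1; apply: le_trans h1 _; rewrite ler_wpM2r ?nrm_ge0.
Qed.

Lemma geo_cvg (C : R) : C * 2^-1 ^+ n @[n --> \oo] --> (0 : R).
Proof.
rewrite -(mulr0 C); apply: cvgM; first exact: cvg_cst.
by apply: cvg_expr; rewrite ger0_norm ?invr_ge0// invf_lt1// ltr1n.
Qed.

Lemma fast_limit (K : R) (f : nat -> R) : (forall n, `|f n.+1 - f n| <= K * 2^-1 ^+ n) ->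
  exists l : R, f n @[n --> \oo] --> l.
Proof.
move=> hf.
have K0 : 0 <= K by have := hf 0%N; rewrite expr0 mulr1; exact: le_trans.
have : cvgn (series (fun k => f k.+1 - f k)).
  apply: normed_cvg; apply: (@series_le_cvg _ _ (geometric K 2^-1)).
  - by move=> n /=.
  - by move=> n /=; rewrite mulr_ge0// exprn_ge0.
  - by move=> n /=; exact: hf.
  - by apply: is_cvg_geometric_series; rewrite ger0_norm ?invr_ge0// invf_lt1// ltr1n.
move=> /cvg_ex[l hl]; exists (f 0%N + l).
have -> : f = (fun n => f 0%N + series (fun k => f k.+1 - f k) n).
  by apply/funext => n; rewrite /series /= telescope_sumr// addrC subrK.
rewrite {2}/series /= big_geq// addr0; apply: cvgD => //; exact: cvg_cst.
Qed.

(** The sequence and its two derivatives converge in L^2 separately, and the weak derivative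
    relations pass to the limit in the pairings. The embedding supplies the continuous
    representative: the [c n] converge pointwise on [a, b] and share a Lipschitz constant, so their
    pointwise limit is Lipschitz and agrees almost everywhere with the L^2 limit. *)
Lemma H2_complete (c : nat -> R -> R) : (forall n, H (c n)) ->
  (forall n, N (fun s => c n.+1 s - c n s) <= 2^-1 ^+ n) ->
  exists l, H l /\ N (fun s => c n s - l s) @[n --> \oo] --> (0 : R).
Proof.
move=> Hc fast.
have [C C0 hC] := H2_embedding.
have HB u v : H u -> H v -> H (fun s => u s - v s).
  move=> Hu Hv; have [h _ _] := itv_H2_lin ab (-1) Hv Hu.
  by have -> : (fun s => u s - v s) = (fun s => -1 * v s + u s); [apply/funext => s; ring|].
have NB u v : H u -> H v ->
  [/\ nrm (cut (fun s => u s - v s)) = nrm (fun s => (cut u) s - (cut v) s),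
      nrm (D1 (fun s => u s - v s)) = nrm (fun s => (D1 u) s - (D1 v) s) &
      nrm (D2 (fun s => u s - v s)) = nrm (fun s => (D2 u) s - (D2 v) s)].
  move=> Hu Hv; have -> : (fun s => u s - v s) = (fun s => -1 * v s + u s).
    by apply/funext => s; ring.
  have F (f g : R -> R) : nrm (fun s => -1 * f s + g s) = nrm (fun s => g s - f s).
    by have -> : (fun s => -1 * f s + g s) = (fun s => g s - f s) by apply/funext => s; ring.
  have [e0 e1 e2] := nrm_lin (-1) Hv Hu.
  split; [exact: etrans e0 (F (cut v) (cut u))|exact: etrans e1 (F (D1 v) (D1 u))|].
  exact: etrans e2 (F (D2 v) (D2 u)).
have P n := itv_H2_parts (Hc n).
have L0 n : L2 (cut (c n)) by have [] := P n.
have L1 n : L2 (D1 (c n)) by have [] := P n.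
have L2' n : L2 (D2 (c n)) by have [] := P n.
have F0 n : nrm (fun s => (cut (c n.+1)) s - (cut (c n)) s) <= 2^-1 ^+ n.
  have [<- _ _] := NB _ _ (Hc n.+1) (Hc n); apply: le_trans (fast n).
  by have [] := nrm_le_H2norm (fun s => c n.+1 s - c n s).
have F1 n : nrm (fun s => (D1 (c n.+1)) s - (D1 (c n)) s) <= 2^-1 ^+ n.
  have [_ <- _] := NB _ _ (Hc n.+1) (Hc n); apply: le_trans (fast n).
  by have [] := nrm_le_H2norm (fun s => c n.+1 s - c n s).
have F2 n : nrm (fun s => (D2 (c n.+1)) s - (D2 (c n)) s) <= 2^-1 ^+ n.
  have [_ _ <-] := NB _ _ (Hc n.+1) (Hc n); apply: le_trans (fast n).
  by have [] := nrm_le_H2norm (fun s => c n.+1 s - c n s).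
have [g0 [Lg0 hg0 ag0]] := L2_complete L0 F0.
have [g1 [Lg1 hg1 _]] := L2_complete L1 F1.
have [g2 [Lg2 hg2 _]] := L2_complete L2' F2.
have lim_ex x : x \in `[a, b] -> exists l : R, c n x @[n --> \oo] --> l.
  move=> xab; apply: (@fast_limit C) => n.
  have [h _] := hC _ (HB _ _ (Hc n.+1) (Hc n)).
  by apply: le_trans (h x xab) _; rewrite ler_wpM2l.
pose l x := if x \in `[a, b] then lim (c n x @[n --> \oo]) else 0.
have cl x : x \in `[a, b] -> c n x @[n --> \oo] --> l x.
  by move=> xab; rewrite /l xab; apply/cvg_ex; exact: lim_ex.
have Nb n : N (c n) <= N (c 0%N) + 2 - 2 * 2^-1 ^+ n.
  elim: n => [|n IH]; first by rewrite expr0; lra.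
  have -> : c n.+1 = (fun s => (c n.+1 s - c n s) + c n s) by apply/funext => s; ring.
  apply: le_trans (H2normD (HB _ _ (Hc n.+1) (Hc n)) (Hc n)) _.
  by rewrite exprS; exact: geo_step (fast n) IH.
(* The increments have norms summing to at most 2, so this is a Lipschitz constant common to all
   [c n]. *)
pose K := C * (N (c 0%N) + 2).
have lipl x y : x \in `[a, b] -> y \in `[a, b] -> `|l x - l y| <= K * `|x - y|.
  move=> xab yab.
  have h1 : `|c n x - c n y| @[n --> \oo] --> `|l x - l y|.
    by apply: cvg_norm; apply: cvgB; exact: cl.
  apply: (ler_cvg_to h1 (cvg_cst _)); apply: nearW => n.
  have [_ h] := hC _ (Hc n); apply: le_trans (h x y xab yab) _.
  rewrite ler_wpM2r// /K ler_wpM2l//; apply: le_trans (Nb n) _.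
  by rewrite gerBl mulr_ge0// exprn_ge0.
have K0 : 0 <= K by rewrite mulr_ge0// addr_ge0// sqrt3_ge0.
have ctl : {within `[a, b], continuous l}.
  apply/subspace_continuousP => x xab; apply/cvgrPdist_lt => e e0.
  have K1 : 0 < K + 1 by lra.
  rewrite near_withinE; apply/nbhs_ballP; exists (e / (K + 1)); first exact: divr_gt0.
  move=> y; rewrite /ball /= => xy yab.
  apply: le_lt_trans (lipl _ _ xab yab) _.
  rewrite ltr_pdivlMr// in xy; apply: le_lt_trans xy; rewrite mulrC ler_wpM2l//; lra.
have Ll := cont_itv_L2 ab ctl.
have el : \forall s \ae leb, (cut l) s = g0 s.
  apply: ae_imp ag0 => s hs; rewrite cutE; apply/esym.
  apply: (cvg_unique _ hs) => //; case: ifPn => hsab; last first.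
    have -> : (fun n => (cut (c n)) s) = (fun=> 0).
      by apply/funext => n; rewrite cutE (negbTE hsab).
    exact: cvg_cst.
  have -> : (fun n => (cut (c n)) s) = c ^~ s by apply/funext => n; rewrite cutE hsab.
  by apply: cl; move: hsab; rewrite !in_itv/= => /andP[/ltW -> /ltW ->].
have cutL g : L2 g -> itv_L2 a b g.
  move=> Lg; apply: (@L2_dom _ _ _ leb (cut g) g _ Lg).
    apply/(@measurable_restrictT _ _ _ _ `]a, b[); first exact: measurable_itv.
    by apply: measurable_funTS; exact: (L2_measurable Lg).
  by move=> s; rewrite cutE; case: ifP => // _; rewrite normr0.
have w1 : is_wderiv a b l g1.
  apply/is_wderivE => psi tp.
  have td := test_derive tp.
  have A := ip_cvg L0 Lg0 (test_L2 td) hg0 (@geo_cvg 2).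
  have B := ip_cvg L1 Lg1 (test_L2 tp) hg1 (@geo_cvg 2).
  have -> : \int[leb]_s ((cut l) s * psi^`()%classic s) = \int[leb]_s (g0 s * psi^`()%classic s).
    have md := test_measurable td; apply: ae_Rintegral.
    - by apply: measurable_funM => //; exact: L2_measurable Ll.
    - by apply: measurable_funM => //; exact: L2_measurable Lg0.
    - by apply: ae_imp el => s ->.
  rewrite (int_cut_test g1 tp).
  apply: (cvg_unique _ A) => //.
  have -> : (fun n => \int[leb]_s ((cut (c n)) s * psi^`()%classic s)) =
      (fun n => - \int[leb]_s ((D1 (c n)) s * psi s)).
    by apply/funext => n; have [_ _ _ /is_wderivE h _] := P n; rewrite h.
  exact: cvgN.
have w2 : is_wderiv a b g1 g2.
  apply/is_wderivE => psi tp.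
  have td := test_derive tp.
  have A := ip_cvg L1 Lg1 (test_L2 td) hg1 (@geo_cvg 2).
  have B := ip_cvg L2' Lg2 (test_L2 tp) hg2 (@geo_cvg 2).
  rewrite (int_cut_test g1 td) (int_cut_test g2 tp).
  apply: (cvg_unique _ A) => //.
  have -> : (fun n => \int[leb]_s ((D1 (c n)) s * psi^`()%classic s)) =
      (fun n => - \int[leb]_s ((D2 (c n)) s * psi s)).
    by apply/funext => n; have [_ _ _ _ /is_wderivE h] := P n; rewrite h.
  exact: cvgN.
have G1 := cutL _ Lg1; have G2 := cutL _ Lg2.
have e1 := wderivE ab G1 w1.
have [Lw1 hw1] := wderivP (ex_intro _ _ (conj G1 w1)).
have w2' := is_wderiv_ae G1 Lw1 (ae_sym e1) w2.
have e2 := wderivE ab G2 w2'.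
have Hl : H l.
  by split; [exact: ctl|exact: Ll|exists g1|exists g2].
exists l; split => //.
(* Three components, each at distance at most twice the n-th power of 1/2. *)
apply: (squeeze_cvgr _ (cvg_cst 0) (@geo_cvg 6)); apply: nearW => n.
rewrite sqrt3_ge0 /=.
have [n0 n1 n2] := NB _ _ (Hc n) Hl.
have [_ Ll1 Ll2 _ _] := itv_H2_parts Hl.
have cutcut (f g : R -> R) s : `|(cut f) s - (cut g) s| <= `|(cut f) s - g s|.
  by rewrite !cutE; case: ifP => // _; rewrite subrr normr0.
have k0 : nrm (fun s => (cut (c n)) s - (cut l) s) <= 2 * 2^-1 ^+ n.
  rewrite -(ae_nrm (L2_B (L0 n) Lg0) (L2_B (L0 n) Ll)); first exact: hg0.
  by apply: ae_imp el => s ->.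
have k1 : nrm (fun s => (D1 (c n)) s - (D1 l) s) <= 2 * 2^-1 ^+ n.
  rewrite -(ae_nrm (L2_B (L1 n) G1) (L2_B (L1 n) Ll1)).
    apply: le_trans (hg1 n); apply: nrm_le; [exact: (L2_B (L1 n) G1)|exact: (L2_B (L1 n) Lg1)|].
    by move=> s; exact: cutcut.
  by apply: ae_imp e1 => s h; congr (_ - _); exact: (esym h).
have k2 : nrm (fun s => (D2 (c n)) s - (D2 l) s) <= 2 * 2^-1 ^+ n.
  rewrite -(ae_nrm (L2_B (L2' n) G2) (L2_B (L2' n) Ll2)).
    apply: le_trans (hg2 n); apply: nrm_le; [exact: (L2_B (L2' n) G2)|exact: (L2_B (L2' n) Lg2)|].
    by move=> s; exact: cutcut.
  by apply: ae_imp e2 => s h; congr (_ - _); exact: (esym h).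
rewrite (NE_eq n0 n1 n2); apply: le_trans (sqrt3_le_sum _ _ _) _;
  [exact: nrm_ge0|exact: nrm_ge0|exact: nrm_ge0|].
apply: le_trans (lerD (lerD k0 k1) k2) _; rewrite -!mulrDl ler_wpM2r ?exprn_ge0//; lra.
Qed.

End ItvHilbert.

(** * Abstract Tikhonov regularization *)

Section Tikhonov.
Context {R : realType} {E : lmodType R}.
Variables (H : E -> Prop) (N : E -> R).
Hypothesis H_lin : forall a u v, H u -> H v -> H (a *: u + v).
Hypothesis N_ge0 : forall u, 0 <= N u.
Hypothesis NZ : forall a u, H u -> N (a *: u) = `|a| * N u.
Hypothesis ND : forall u v, H u -> H v -> N (u + v) <= N u + N v.
Hypothesis Npar : forall u v, H u -> H v ->
  N (u + v) ^+ 2 + N (u - v) ^+ 2 = 2 * N u ^+ 2 + 2 * N v ^+ 2.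
Hypothesis N_complete : forall c : nat -> E, (forall n, H (c n)) ->
  (forall n, N (c n.+1 - c n) <= 2^-1 ^+ n) ->
  exists l, H l /\ N (c n - l) @[n --> \oo] --> (0 : R).

Local Lemma HD u v : H u -> H v -> H (u + v).
Proof. by move=> hu hv; have := H_lin 1 hu hv; rewrite scale1r. Qed.

Local Lemma HB u v : H u -> H v -> H (u - v).
Proof. by move=> hu hv; have := H_lin (-1) hv hu; rewrite scaleN1r addrC. Qed.

Local Lemma HZ a u : H u -> H (a *: u).
Proof.
by move=> hu; have := H_lin a hu (HB hu hu); rewrite subrr addr0.
Qed.

Local Lemma N_sym u v : H u -> H v -> N (u - v) = N (v - u).
Proof.
move=> hu hv; rewrite -(opprB u v) -(scaleN1r (u - v)) NZ; last exact: HB.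
by rewrite normrN1 mul1r.
Qed.

Local Lemma N_dist u v : H u -> H v -> `|N u - N v| <= N (u - v).
Proof.
move=> hu hv; have h1 := ND (HB hu hv) hv; have h2 := ND (HB hv hu) hu.
rewrite !subrK in h1 h2; rewrite (N_sym hv hu) in h2.
by rewrite ler_norml; apply/andP; split; lra.
Qed.

(** The form of the parallelogram law in which a lower bound for the norm of the midpoint bounds the
    distance. *)
Local Lemma N_mid u v : H u -> H v ->
  N (u - v) ^+ 2 = 2 * N u ^+ 2 + 2 * N v ^+ 2 - 4 * N (2^-1 *: (u + v)) ^+ 2.
Proof.
move=> hu hv; rewrite NZ; last exact: HD.
rewrite -(Npar hu hv) ger0_norm ?invr_ge0// exprMn.
by move: (N (u + v)) (N (u - v)) => x y; field.
Qed.

Local Lemma N_cvg (c : nat -> E) l : (forall n, H (c n)) -> H l ->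
  N (c n - l) @[n --> \oo] --> (0 : R) -> N (c n) @[n --> \oo] --> N l.
Proof.
move=> hc hl h; apply/subr_cvg0/norm_cvg0P.
apply: (squeeze_cvgr _ (cvg_cst 0) h); apply: nearW => n.
by rewrite normr_ge0 N_dist.
Qed.

(* The infima of N^2 over the K n increase to N(p)^2, so by the parallelogram
   law near-minimizers cluster at p; this replaces weak compactness. *)
Lemma nested_min (K : nat -> E -> Prop) (M : R) :
  (forall n c, K n c -> H c) -> (forall n c, K n.+1 c -> K n c) ->
  (forall n u v, K n u -> K n v -> K n (2^-1 *: (u + v))) ->
  (forall n c l, (forall k, K n (c k)) -> H l ->
    N (c k - l) @[k --> \oo] --> (0 : R) -> K n l) ->
  (forall n, exists c, K n c /\ N c <= M) ->
  exists p, [/\ forall n, K n p,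
    forall e, 0 < e -> exists n eta, 0 < eta /\
      forall c, K n c -> N c <= N p + eta -> N (c - p) <= e &
    forall c, (forall n, K n c) -> N p <= N c].
Proof.
move=> KH KS Kmid Kcl KM.
have Kle m n c : (m <= n)%N -> K n c -> K m c.
  by move=> /subnKC <-; elim: (n - m)%N => [|k IH]; rewrite ?addn0// addnS => /KS.
pose A n := [set N c ^+ 2 | c in K n].
pose m n := inf (A n).
have A0 n : A n !=set0 by have [c [Kc _]] := KM n; exists (N c ^+ 2), c.
have Alb n : has_lbound (A n) by exists 0 => _ [c _ <-]; exact: sqr_ge0.
have mlb n c : K n c -> m n <= N c ^+ 2.
  by move=> Kc; apply: ge_inf => //; exists c.
have mM n : m n <= M ^+ 2.
  have [c [Kc cM]] := KM n; apply: le_trans (mlb _ _ Kc) _.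
  by rewrite lerXn2r// nnegrE//; exact: le_trans cM.
have mnd i j : (i <= j)%N -> m i <= m j.
  move=> ij; apply: lb_le_inf => // _ [c Kc <-]; apply: mlb; exact: Kle Kc.
pose mm := sup (range m).
have rub : has_ubound (range m) by exists (M ^+ 2) => _ [n _ <-].
have mmm n : m n <= mm by apply: ub_le_sup => //; exists n.
have mapp e : 0 < e -> exists n, mm - e < m n.
  move=> e0; have [|_ [n _ <-] h] := @sup_adherent _ (range m) e e0.
    by split => //; exists (m 0%N), 0%N.
  by exists n.
(* Two consecutive approximate minimizers have squared norms at most [mm + e k], and that of their
   midpoint is at least [mm - e k]; the parallelogram law then bounds the squared gap by [8 * e k],
   the square of the k-th power of 1/2 required by [N_complete]. *)
pose e k : R := 4^-1 ^+ k / 8.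
have e0 k : 0 < e k by rewrite divr_gt0// exprn_gt0.
have /choice[q hq] : forall k, exists nc : nat * E,
    [/\ (k <= nc.1)%N, mm - e k < m nc.1, K nc.1 nc.2 &
        N nc.2 ^+ 2 < m nc.1 + e k].
  move=> k; have [n hn] := mapp _ (e0 k).
  have [|_ [c Kc <-] h] := @inf_adherent _ (A (maxn k n)) (e k) (e0 k).
    by split.
  exists (maxn k n, c); split => //=; first exact: leq_maxl.
  by apply: lt_le_trans hn _; apply: mnd; exact: leq_maxr.
pose p k := (q k).2.
have Hp k : H (p k) by have [_ _ h _] := hq k; exact: KH h.
have eS k : e k.+1 <= e k.
  rewrite /e exprS; have : 0 < (4^-1 ^+ k : R) by rewrite exprn_gt0.
  by move: (_ ^+ k) => z; lra.
have fast k : N (p k.+1 - p k) <= 2^-1 ^+ k.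
  rewrite -(@ler_pXn2r _ 2)//; rewrite ?nnegrE ?exprn_ge0//.
  rewrite N_mid//.
  have [_ a1 K1 b1] := hq k; have [_ a2 K2 b2] := hq k.+1.
  pose j := minn (q k).1 (q k.+1).1.
  have hj : mm - e k < m j.
    by rewrite /j /minn; case: ifP => // _; apply: le_lt_trans a2; rewrite lerB.
  have hmid : m j <= N (2^-1 *: (p k.+1 + p k)) ^+ 2.
    apply/mlb/Kmid; [apply: Kle K2|apply: Kle K1].
    - exact: geq_minr.
    - exact: geq_minl.
  have h1 := mmm (q k).1; have h2 := mmm (q k.+1).1; have h3 := eS k.
  have -> : (2^-1 ^+ k : R) ^+ 2 = 8 * e k.
    rewrite /e -exprM mulnC exprM (_ : 2^-1 ^+ 2 = 4^-1 :> R); last by field.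
    by move: (_ ^+ k) => z; field.
  rewrite -/(p k) -/(p k.+1) in b1 b2; lra.
have [l [Hl pl]] := N_complete Hp fast.
have Kl n : K n l.
  apply: (Kcl n (fun k => p (k + n)%N)) => //; last first.
    by move: pl; rewrite -(cvg_shiftn n).
  move=> k; have [kn _ h _] := hq (k + n)%N.
  by apply: Kle h; apply: leq_trans kn; exact: leq_addl.
have cNp := N_cvg Hp Hl pl.
have Nle : N l ^+ 2 <= mm.
  have c1 : N (p n) ^+ 2 @[n --> \oo] --> N l ^+ 2.
    by rewrite expr2; under eq_fun do rewrite expr2; exact: cvgM.
  have c2 : mm + e n @[n --> \oo] --> mm.
    rewrite -[X in _ --> X]addr0; apply: cvgD; first exact: cvg_cst.
    rewrite -[X in _ --> X](mul0r 8^-1); apply: cvgM; last exact: cvg_cst.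
    by apply: cvg_expr; rewrite ger0_norm ?invr_ge0// invf_lt1// ltr1n.
  apply: ler_cvg_to c1 c2 _; apply: nearW => n.
  have [_ _ _ h] := hq n; rewrite -/(p n) in h; have := mmm (q n).1; lra.
exists l; split => //.
- move=> eps eps0.
  have [n hn] : exists n, mm - eps ^+ 2 / 8 < m n by apply: mapp; rewrite divr_gt0// exprn_gt0.
  (* The parallelogram law at [c] and [l] leaves 4 (mm - m n), at most half of eps^2, and 4 N(l) eta
     + 2 eta^2. As eta <= 1 the latter is at most eta D / 2, the other half. *)
  pose D := 2 * (4 * N l + 2).
  have D0 : 0 < D by rewrite /D; have := N_ge0 l; lra.
  pose eta := Num.min 1 (eps ^+ 2 / D).
  have eta0 : 0 < eta by rewrite lt_min ltr01 divr_gt0// exprn_gt0.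
  have eta1 : eta <= 1 by rewrite ge_min lexx.
  have etaD : eta * D <= eps ^+ 2 by rewrite -ler_pdivlMr// ge_min lexx orbT.
  exists n, eta; split => // c Kc Nc.
  rewrite -(@ler_pXn2r _ 2)//; rewrite ?nnegrE ?(ltW eps0)//.
  rewrite N_mid//; last exact: KH Kc.
  have h1 := mlb _ _ (Kmid _ _ _ Kc (Kl n)).
  have h2 : N c ^+ 2 <= (N l + eta) ^+ 2.
    by rewrite lerXn2r// nnegrE// addr_ge0// ltW.
  have l0 := N_ge0 l; rewrite /D in etaD.
  have h3 : eta ^+ 2 <= eta by rewrite expr2 ler_piMl// ltW.
  rewrite sqrrD in h2; nra.
- move=> c Kc; rewrite -(@ler_pXn2r _ 2)//; rewrite ?nnegrE//.
  apply: le_trans Nle _; apply: ge_sup; first by exists (m 0%N), 0%N.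
  by move=> _ [n _ <-]; exact: mlb.
Qed.

(** What the minimization uses of c |-> |T c - y|: its sublevel sets are midpoint-convex and closed
    under [N]-convergence within [H]. *)
Definition residual (S : E -> R) := [/\ forall u, H u -> 0 <= S u,
  forall u v, H u -> H v -> S (2^-1 *: (u + v)) <= (S u + S v) / 2 &
  exists L, forall u v, H u -> H v -> `|S u - S v| <= L * N (u - v)].

Local Lemma residual_cvg S (c : nat -> E) l : residual S ->
  (forall n, H (c n)) -> H l ->
  N (c n - l) @[n --> \oo] --> (0 : R) -> S (c n) @[n --> \oo] --> S l.
Proof.
move=> [_ _ [L SL]] hc hl h; apply/subr_cvg0/norm_cvg0P.
have hL : L * N (c n - l) @[n --> \oo] --> (0 : R).
  by rewrite -(mulr0 L); apply: cvgM => //; exact: cvg_cst.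
apply: (squeeze_cvgr _ (cvg_cst 0) hL); apply: nearW => n.
by rewrite normr_ge0 SL.
Qed.

(** The penalty makes [J] strictly midpoint-convex in the quantitative form [Jmid]: the midpoint of
    two minimizers would fall below the infimum unless their [N]-distance is zero. Since [N] may
    vanish on nonzero elements, uniqueness is stated in terms of that distance. *)
Lemma tikhonov_exists (S : E -> R) (alpha : R) (c0 : E) : residual S ->
  0 < alpha -> H c0 -> exists c, [/\ H c,
    forall c', H c' ->
      S c ^+ 2 + alpha * N c ^+ 2 <= S c' ^+ 2 + alpha * N c' ^+ 2 &
    forall c', H c' -> (forall c'', H c'' ->
      S c' ^+ 2 + alpha * N c' ^+ 2 <= S c'' ^+ 2 + alpha * N c'' ^+ 2) ->
      N (c' - c) = 0].
Proof.
move=> rS a0 Hc0; have [S0 Smid [L SL]] := rS.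
pose J c := S c ^+ 2 + alpha * N c ^+ 2.
have J0 c : 0 <= J c by rewrite addr_ge0 ?sqr_ge0// mulr_ge0 ?sqr_ge0// ltW.
have Jmid u v : H u -> H v ->
    J (2^-1 *: (u + v)) <= (J u + J v) / 2 - alpha / 4 * N (u - v) ^+ 2.
  move=> hu hv; rewrite N_mid// /J.
  have h := Smid _ _ hu hv; have h0 := S0 _ (HZ 2^-1 (HD hu hv)).
  have hs : S (2^-1 *: (u + v)) ^+ 2 <= (S u ^+ 2 + S v ^+ 2) / 2.
    apply: (@le_trans _ _ (((S u + S v) / 2) ^+ 2)).
      by rewrite lerXn2r// nnegrE//; exact: le_trans h.
    by have := sqr_ge0 (S u - S v); rewrite exprMn !sqrrD sqrrN mulrN; lra.
  move: hs; move: (S _ ^+ 2) (N _ ^+ 2) (N u ^+ 2) (N v ^+ 2) => x y z w; lra.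
pose B := [set J c | c in H].
have B0 : B !=set0 by exists (J c0), c0.
have Blb : has_lbound B by exists 0 => _ [c _ <-].
have Jlb c : H c -> inf B <= J c by move=> Hc; apply: ge_inf => //; exists c.
pose K n c := H c /\ J c <= inf B + n.+1%:R^-1.
have n1 n : (n.+1%:R^-1 : R) <= 1 by rewrite invf_le1 ?ltr0n// ler1n.
have n0 n : (0 : R) < n.+1%:R^-1 by rewrite invr_gt0 ltr0n.
(* For an element with [J c <= inf B + 1] the penalty alone bounds N(c)^2 by (inf B + 1)/alpha, and
   N(c) <= 1 + N(c)^2. *)
have [|n c [Hc Jc]|n u v [hu Ju] [hv Jv]|n c l hc Hl cl|n|p [Kp _ _]] :=
    @nested_min K (1 + (inf B + 1) / alpha).
- by move=> n c [].
- split => //; apply: le_trans Jc _; rewrite lerD2l lef_pV2 ?posrE ?ltr0n//.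
  by rewrite ler_nat.
- split; first exact: HZ (HD hu hv).
  move: Ju Jv; move: (n.+1%:R^-1 : R) => z Ju Jv.
  apply: le_trans (Jmid _ _ hu hv) _.
  have : 0 <= alpha / 4 * N (u - v) ^+ 2 by rewrite mulr_ge0 ?sqr_ge0// divr_ge0// ltW.
  lra.
- split => //.
  have Hc k : H (c k) by have [] := hc k.
  have cS := residual_cvg rS Hc Hl cl; have cN := N_cvg Hc Hl cl.
  have cJ : J (c k) @[k --> \oo] --> J l.
    apply: cvgD; last apply: cvgM; rewrite ?expr2; first (under eq_fun do rewrite expr2).
    + exact: cvgM.
    + exact: cvg_cst.
    + by under eq_fun do rewrite expr2; exact: cvgM.
  apply: (ler_cvg_to cJ (cvg_cst _)); apply: nearW => k.
  by have [] := hc k.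
- have [|_ [c Hc <-] h] := @inf_adherent _ B n.+1%:R^-1 (n0 n); first by split.
  exists c; split; first by split => //; exact: ltW.
  have h2 : alpha * N c ^+ 2 <= inf B + 1.
    have : J c <= inf B + 1 by apply: le_trans (ltW h) _; rewrite lerD2l.
    by rewrite /J; have := sqr_ge0 (S c); lra.
  have h3 : N c ^+ 2 <= (inf B + 1) / alpha by rewrite ler_pdivlMr// mulrC.
  apply: le_trans (_ : 1 + N c ^+ 2 <= _); last by rewrite lerD2l.
  by have := sqr_ge0 (N c - 1); have := N_ge0 c; nra.
have Hp : H p by have [] := Kp 0%N.
have Jp : J p <= inf B.
  apply/ler_addgt0Pr => e e0.
  have [n hn] : exists n, n.+1%:R^-1 < e.
    have [n _ /(_ n (leqnn n)) h] := @near_infty_natSinv_lt R (PosNum e0).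
    by exists n.
  by have [_ h] := Kp n; apply: le_trans h _; rewrite lerD2l ltW.
exists p; split => // [c' Hc'|c' Hc' hmin].
  exact: le_trans Jp (Jlb _ Hc').
have h1 := Jmid _ _ Hc' Hp.
have h2 := Jlb _ (HZ 2^-1 (HD Hc' Hp)).
have h3 : J c' <= J p by exact: hmin.
apply/eqP; rewrite -(@eqrXn2 _ 2)// expr0n/= eq_le sqr_ge0 andbT.
have a4 : 0 < alpha / 4 by rewrite divr_gt0.
by rewrite -(pmulr_rle0 _ a4); lra.
Qed.

(** The perturbation estimate grows with [N c], so the order matters: the comparison with [p] first
    bounds the norm of the minimizer, which turns the factor 1 + N c into a constant; then a small
    perturbed residual gives a small exact one. *)
Lemma tikhonov_cvg (S0 : E -> R) (S : R -> E -> R) (C : R) (c0 : E) :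
  residual S0 -> 0 <= C -> H c0 -> S0 c0 = 0 ->
  (forall delta c, 0 < delta -> H c -> 0 <= S delta c) ->
  (forall delta c, 0 < delta -> H c ->
    `|S delta c - S0 c| <= C * delta * (1 + N c)) ->
  exists p, [/\ H p, S0 p = 0,
    forall c, H c -> S0 c = 0 -> N p <= N c,
    forall c, H c -> S0 c = 0 -> N c <= N p -> N (c - p) = 0 &
    forall (alpha : R -> R) (c : R -> E),
      (forall delta, 0 < delta -> 0 < alpha delta) ->
      alpha delta @[delta --> 0^'+] --> (0 : R) ->
      delta ^+ 2 / alpha delta @[delta --> 0^'+] --> (0 : R) ->
      (forall delta, 0 < delta -> H (c delta) /\
        forall c', H c' ->
          S delta (c delta) ^+ 2 + alpha delta * N (c delta) ^+ 2 <=
          S delta c' ^+ 2 + alpha delta * N c' ^+ 2) ->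
      N (c delta - p) @[delta --> 0^'+] --> (0 : R)].
Proof.
move=> rS C0 Hc0 S00 Sge SS0; have [S0ge Smid [L SL]] := rS.
pose K n c := H c /\ S0 c <= n.+1%:R^-1.
have n0 n : (0 : R) < n.+1%:R^-1 by rewrite invr_gt0 ltr0n.
have [|n c [Hc Jc]|n u v [hu Ju] [hv Jv]|n c l hc Hl cl|n|p [Kp pstab pmin]] :=
    @nested_min K (N c0).
- by move=> n c [].
- split => //; apply: le_trans Jc _; rewrite lef_pV2 ?posrE ?ltr0n//.
  by rewrite ler_nat.
- split; first exact: HZ (HD hu hv).
  move: Ju Jv; move: (n.+1%:R^-1 : R) => z Ju Jv.
  by apply: le_trans (Smid _ _ hu hv) _; lra.
- split => //.
  have Hc k : H (c k) by have [] := hc k.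
  apply: (ler_cvg_to (residual_cvg rS Hc Hl cl) (cvg_cst _)); apply: nearW => k.
  by have [] := hc k.
- by exists c0; split => //; split => //; rewrite S00 ltW.
have Hp : H p by have [] := Kp 0%N.
have S0p : S0 p = 0.
  apply/eqP; rewrite eq_le S0ge// andbT.
  apply/ler_addgt0Pr => e e0; rewrite add0r.
  have [n _ /(_ n (leqnn n)) hn] := @near_infty_natSinv_lt R (PosNum e0).
  by have [_ h] := Kp n; apply: le_trans h _; exact: ltW.
exists p; split => //.
- by move=> c Hc S0c; apply: pmin => n; split => //; rewrite S0c ltW.
- move=> c Hc S0c Nc; apply/eqP; rewrite eq_le N_ge0 andbT.
  apply/ler_addgt0Pr => e e0; rewrite add0r.
  have [n [eta [eta0 h]]] := pstab e e0.
  by apply: h; [split => //; rewrite S0c ltW|apply: le_trans Nc _; rewrite lerDl ltW].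
move=> alpha c alpha0 calpha cda hc.
apply/cvgr0Pnorm_le => e e0.
have [n [eta [eta0 hst]]] := pstab e e0.
pose s : R := n.+1%:R^-1.
have s0 : 0 < s by exact: n0.
(* The perturbed residual of [p] is at most [A * delta]; [D] is the same constant for elements of
   norm at most [N p + eta]. *)
pose A := C * (1 + N p).
have A0 : 0 <= A by rewrite mulr_ge0// addr_ge0.
pose D := C * (1 + N p + eta).
have D0 : 0 <= D by rewrite mulr_ge0// !addr_ge0// ltW.
have A1 : 0 < A ^+ 2 + 1 by have := sqr_ge0 A; lra.
have P1 : 0 < N p ^+ 2 + 1 by have := sqr_ge0 (N p); lra.
have D1 : 0 < D + 1 by lra.
near=> d.
have d0 : 0 < d by near: d; exact: nbhs_right_gt.
have a0 := alpha0 _ d0; have [Hcd hmin] := hc _ d0.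
(* [h1] keeps the norm of the minimizer within [eta] of that of [p]; [h2] and [h3] bound its
   perturbed residual by [s / 2]; [h4] bounds the change to the exact residual by [s / 2]. The added
   ones keep the denominators positive. *)
have h1 : d ^+ 2 / alpha d < eta ^+ 2 / (A ^+ 2 + 1).
  near: d; apply: (cvgr_lt 0) => //; by rewrite divr_gt0// exprn_gt0.
have h2 : alpha d < s ^+ 2 / 8 / (N p ^+ 2 + 1).
  near: d; apply: (cvgr_lt 0) => //; by rewrite !divr_gt0// exprn_gt0.
have h3 : d < Num.min 1 (s ^+ 2 / 8 / (A ^+ 2 + 1)).
  by near: d; apply: nbhs_right_lt; rewrite lt_min ltr01 !divr_gt0// exprn_gt0.
have h4 : d < s / 2 / (D + 1).
  by near: d; apply: nbhs_right_lt; rewrite !divr_gt0.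
rewrite ger0_norm//.
have Sp : S d p <= A * d.
  have := SS0 d p d0 Hp; rewrite S0p subr0 ger0_norm; last exact: Sge.
  by rewrite /A mulrAC.
have hJ : S d (c d) ^+ 2 + alpha d * N (c d) ^+ 2 <=
    A ^+ 2 * d ^+ 2 + alpha d * N p ^+ 2.
  apply: le_trans (hmin _ Hp) _; rewrite lerD2r -exprMn lerXn2r// ?nnegrE ?Sge//.
  by rewrite mulr_ge0// ltW.
have Sd2 := sqr_ge0 (S d (c d)).
have Ncd : N (c d) <= N p + eta.
  rewrite -(@ler_pXn2r _ 2)//; rewrite ?nnegrE ?addr_ge0// ?(ltW eta0)//.
  have k1 : alpha d * N (c d) ^+ 2 <= alpha d * (A ^+ 2 * (d ^+ 2 / alpha d) + N p ^+ 2).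
    have -> : alpha d * (A ^+ 2 * (d ^+ 2 / alpha d) + N p ^+ 2) =
        A ^+ 2 * d ^+ 2 + alpha d * N p ^+ 2 by field; rewrite gt_eqF.
    by lra.
  rewrite ler_pM2l// in k1; apply: le_trans k1 _.
  have k2 : A ^+ 2 * (d ^+ 2 / alpha d) <= eta ^+ 2.
    apply: (@le_trans _ _ ((A ^+ 2 + 1) * (d ^+ 2 / alpha d))).
      by rewrite ler_wpM2r ?lerDl// divr_ge0 ?sqr_ge0// ltW.
    by rewrite mulrC -ler_pdivlMr// ltW.
  rewrite sqrrD; have : 0 <= N p * eta by rewrite mulr_ge0// ltW.
  by rewrite mulr2n; lra.
apply: hst => //; split => //; rewrite -/s.
have Scd : S d (c d) <= s / 2.
  rewrite -(@ler_pXn2r _ 2)//; rewrite ?nnegrE ?Sge ?divr_ge0 ?(ltW s0)//.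
  have k1 : alpha d * N p ^+ 2 <= s ^+ 2 / 8.
    apply: (@le_trans _ _ (alpha d * (N p ^+ 2 + 1))).
      by rewrite ler_wpM2l ?lerDl// ltW.
    by rewrite -ler_pdivlMr// ltW.
  have [d1 dA] : d < 1 /\ d < s ^+ 2 / 8 / (A ^+ 2 + 1).
    by move: h3; rewrite lt_min => /andP[].
  have k2 : A ^+ 2 * d ^+ 2 <= s ^+ 2 / 8.
    apply: (@le_trans _ _ (d * (A ^+ 2 + 1))); last by rewrite -ler_pdivlMr// ltW.
    rewrite mulrC ler_pM ?sqr_ge0// ?lerDl// expr2 ler_piMl// ltW//.
  have k3 : 0 <= alpha d * N (c d) ^+ 2 by rewrite mulr_ge0 ?sqr_ge0// ltW.
  rewrite expr_div_n (_ : 2 ^+ 2 = 4 :> R); last by ring.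
  lra.
have := SS0 d (c d) d0 Hcd; rewrite ler_norml => /andP[k1 _].
have k2 : C * d * (1 + N (c d)) <= s / 2.
  apply: (@le_trans _ _ (d * (D + 1))); last by rewrite -ler_pdivlMr// ltW.
  rewrite /D; have : C * (N p + eta - N (c d)) >= 0 by rewrite mulr_ge0// subr_ge0.
  by move=> k; nra.
lra.
Unshelve. all: by end_near. Qed.

End Tikhonov.

(** * The measure on the periodicity cell *)

Section UnitInterval.
Context {R : realType}.
Local Notation leb := (@lebesgue_measure R).
Local Notation U := (uniform_prob (@ltr01 R)).
Local Open Scope ereal_scope.

Lemma measurable_shift (h : R) : measurable_fun [set: R] (fun x : R => x + h)%R.
Proof. by apply: measurable_funD => //; exact: measurable_cst. Qed.

Lemma lebesgue_shift (h : R) (A : set (measurableTypeR R)) : measurable A ->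
  leb A = leb ((fun x : R => (x + h)%R) @^-1` A).
Proof.
have mphi : @measurable_fun _ _ (measurableTypeR R) (measurableTypeR R) setT (fun x : R => (x + h)%R).
  exact: measurable_shift.
pose phi : {mfun measurableTypeR R >-> measurableTypeR R} :=
  @mfun_Sub _ _ (measurableTypeR R) (measurableTypeR R) _ (mem_set mphi).
apply: (@lebesgue_measure_unique R (pushforward leb phi)) => X [[a b] /= _ <-].
rewrite /pushforward /=.
have -> : (fun x : R => (x + h)%R) @^-1` `]a, b] = `](a - h)%R, (b - h)%R]%classic.
  by apply/funext => x; apply/propext; rewrite /= !in_itv/= ltrBlDr lerBrDr.
rewrite !lebesgue_measure_itv/= !lte_fin ltrD2r; case: ifP => // _.
by rewrite -!EFinB; congr EFin; ring.
Qed.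

Lemma ge0_integral_shift (h : R) (D : set R) (f : R -> \bar R) : measurable D ->
  measurable_fun D f -> (forall x, 0 <= f x) ->
  \int[leb]_(x in D) f x = \int[leb]_(x in (fun x => x + h)%R @^-1` D) f (x + h)%R.
Proof.
move=> mD mf f0.
have mphi : measurable_fun [set: measurableTypeR R] (fun x : measurableTypeR R => (x + h)%R : measurableTypeR R).
  exact: measurable_shift.
have := @ge0_integral_pushforward _ _ _ _ _ _ mphi leb D f mD mf.
move=> <-; last by move=> x _; exact: f0.
apply: eq_measure_integral => A mA _.
exact: (lebesgue_shift h mA).
Qed.

Lemma integral_U (f : R -> \bar R) : measurable_fun setT f -> (forall x, 0 <= f x) ->
  \int[U]_x f x = \int[leb]_(x in `[0%R, 1%R]) f x.
Proof. by move=> mf f0; rewrite (@integral_uniform R)// subr0 invr1 mul1e. Qed.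

(** Periodicity reduces to 0 <= h < 1. Then [h, 1 + h] is cut at 1, and the piece beyond 1 is moved
    back by one period to fill [0, h]. *)
Lemma U_shift (h : R) (f : R -> \bar R) : measurable_fun setT f -> (forall x, 0 <= f x) ->
  (forall x, f (x + 1)%R = f x) -> \int[U]_x f (x + h)%R = \int[U]_x f x.
Proof.
move=> mf f0 f1.
have mfh c : measurable_fun setT (fun x : R => f (x + c)%R).
  by apply: (measurableT_comp mf); exact: measurable_shift.
have fn (n : nat) x : f (x + n%:R)%R = f x.
  elim: n => [|n IH]; first by rewrite addr0.
  by rewrite -natr1 addrA f1.
have fz (z : int) x : f (x + z%:~R)%R = f x.
  case: (intP z) => [|n|n]; first by rewrite addr0.
    exact: fn.
  by rewrite mulrNz -[in RHS](subrK n.+1%:R x) fn.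
wlog h01 : h / (0 <= h < 1)%R.
  move=> H; have := H (h - (Num.floor h)%:~R)%R _.
  have -> : (fun x => f (x + (h - (Num.floor h)%:~R))%R) = (fun x => f (x + h)%R).
    apply/funext => x; have := fz (Num.floor h) (x + (h - (Num.floor h)%:~R))%R.
    by rewrite -addrA subrK => ->.
  apply; rewrite subr_ge0 ge_floor/= ltrBlDl.
  by have := lt_succ_floor h; rewrite intrD addrC.
have /andP[h0 h1] := h01.
rewrite !integral_U//.
have E1 : \int[leb]_(x in `[0%R, 1%R]) f (x + h)%R = \int[leb]_(x in `[h, (1 + h)%R]) f x.
  rewrite (ge0_integral_shift h (D := `[h, (1 + h)%R]))//; last exact: measurable_funTS.
  congr (integral _ _ _); apply/funext => x; apply/propext.
  by rewrite /= !in_itv/= lerDr lerD2r.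
rewrite E1.
have S1 : `[h, (1 + h)%R]%classic = `[h, 1%R] `|` `]1%R, (1 + h)%R] :> set R.
  by rewrite -itv_bndbnd_setU ?bnd_simp//; [exact: ltW|rewrite lerDl].
have S2 : `[0%R, 1%R]%classic = `[0%R, h[ `|` `[h, 1%R] :> set R.
  by rewrite -itv_bndbnd_setU ?bnd_simp//; exact: ltW.
rewrite S1 S2 ge0_integral_setU//; last 2 first.
- exact: measurable_funTS.
- apply/disj_setPS => x /= [] /=; rewrite !in_itv/= => /andP[_ h2] /andP[h3 _].
  by have := lt_le_trans h3 h2; rewrite ltxx.
rewrite ge0_integral_setU//; last 2 first.
- exact: measurable_funTS.
- apply/disj_setPS => x /= [] /=; rewrite !in_itv/= => /andP[_ h2] /andP[h3 _].
  by have := lt_le_trans h2 h3; rewrite ltxx.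
rewrite addeC; congr (_ + _).
rewrite (ge0_integral_shift 1%R (D := `]1%R, (1 + h)%R]))//; last exact: measurable_funTS.
have -> : (fun x => (x + 1)%R) @^-1` `]1%R, (1 + h)%R] = `]0%R, h]%classic.
  by apply/funext => x; apply/propext; rewrite /= !in_itv/= -[X in (X < _)%R]add0r ltrD2r (addrC 1%R h) lerD2r.
transitivity (\int[leb]_(x in `]0%R, h]) f x); first by apply: eq_integral => x _; exact: f1.
rewrite integral_itv_obnd_cbnd; last exact: measurable_funTS.
by rewrite -integral_itv_bndo_bndc//; exact: measurable_funTS.
Qed.

End UnitInterval.

Lemma prob_cst {dd} {T : measurableType dd} {R : realType} (P : probability T R) (c : \bar R) :
  (\int[P]_x c = c)%E.
Proof. by rewrite integral_cst//=; have -> := probability_setT P; rewrite mule1. Qed.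

Section Cell.
Context {R : realType}.
Local Notation U := (uniform_prob (@ltr01 R)).
Local Notation cell := (cell_measure R).
Local Open Scope ereal_scope.

Definition upd (d : nat) (x : d.-tuple R) (i : 'I_d) (s : R) : d.-tuple R :=
  [tuple if j == i then s else tnth x j | j < d].

Lemma tnth_upd d (x : d.-tuple R) i s j :
  tnth (upd x i s) j = if j == i then s else tnth x j.
Proof. by rewrite tnth_mktuple. Qed.

Lemma measurable_upd d (i : 'I_d) :
  measurable_fun [set: d.-tuple R * measurableTypeR R] (fun p => upd p.1 i p.2).
Proof.
apply/measurable_fun_tnthP => j.
have -> : (@tnth d R ^~ j) \o (fun p : d.-tuple R * measurableTypeR R => upd p.1 i p.2) =
    (if j == i then (fun p => p.2) else (fun p => tnth p.1 j)).
  by apply/funext => p; rewrite /= tnth_upd; case: ifP.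
case: ifP => _; first exact: measurable_snd.
by apply: (measurableT_comp (measurable_tnth j)); exact: measurable_fst.
Qed.

Lemma cell_rec d (G : d.+1.-tuple R -> \bar R) : measurable_fun setT G -> (forall x, 0 <= G x) ->
  \int[cell d.+1]_x G x = \int[(U \x cell d)%E]_p G (cons_pair p).
Proof.
move=> mG G0.
exact: (@ge0_integral_pushforward _ _ _ _ _ _ (@measurable_cons_pair R d) (U \x cell d)%E setT G).
Qed.

Lemma measurable_cons_comp d (G : d.+1.-tuple R -> \bar R) : measurable_fun setT G ->
  measurable_fun [set: measurableTypeR R * d.-tuple R] (fun p => G (cons_pair p)).
Proof. by move=> mG; apply: (measurableT_comp mG); exact: measurable_cons_pair. Qed.

Lemma upd_cons0 d (s r : R) (x : d.-tuple R) : upd (cons_pair (s, x)) ord0 r = cons_pair (r, x).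
Proof.
apply: eq_from_tnth => j; rewrite tnth_upd; case: (unliftP ord0 j) => [k ->|->].
  by rewrite eq_sym (negbTE (neq_lift _ _)) /cons_pair/= !tnthS.
by rewrite eqxx.
Qed.

Lemma upd_consS d (s r : R) (x : d.-tuple R) i :
  upd (cons_pair (s, x)) (lift ord0 i) r = cons_pair (s, upd x i r).
Proof.
apply: eq_from_tnth => j; rewrite tnth_upd; case: (unliftP ord0 j) => [k ->|->].
  by rewrite (inj_eq lift_inj) /cons_pair/= !tnthS tnth_upd.
by rewrite (negbTE (neq_lift _ _)).
Qed.

Lemma measurable_upd_comp d (G : d.-tuple R -> \bar R) i : measurable_fun setT G ->
  measurable_fun [set: d.-tuple R * measurableTypeR R] (fun p => G (upd p.1 i p.2)).
Proof. by move=> mG; apply: (measurableT_comp mG); exact: measurable_upd. Qed.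

Lemma measurable_avg d (G : d.-tuple R -> \bar R) i : measurable_fun setT G ->
  (forall x, 0 <= G x) -> measurable_fun setT (fun x => \int[U]_r G (upd x i r)).
Proof.
move=> mG G0.
exact: (@measurable_fun_fubini_tonelli_F _ _ _ _ R U (fun p => G (upd p.1 i p.2))
  (measurable_upd_comp i mG)).
Qed.

(** Reduces questions about one coordinate to the uniform measure on [0, 1]. At the head coordinate
    the inner average no longer depends on that coordinate, so the remaining integral over it is
    that of a constant; other coordinates are reached by induction with the head fixed. *)
Lemma cell_avg d (G : d.-tuple R -> \bar R) i : measurable_fun setT G ->
  (forall x, 0 <= G x) ->
  \int[cell d]_x G x = \int[cell d]_x \int[U]_r G (upd x i r).
Proof.
elim: d G i => [G [] //|d IH G i mG G0].
rewrite !cell_rec//; last 2 first.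
- exact: measurable_avg.
- by move=> x; exact: integral_ge0.
have mGc := measurable_cons_comp mG.
have m1 x : measurable_fun setT (fun s : R => G (cons_pair (s, x))).
  by apply: (measurableT_comp mGc); exact: measurable_pair2.
have m2 s : measurable_fun setT (fun x : d.-tuple R => G (cons_pair (s, x))).
  by apply: (measurableT_comp mGc); exact: measurable_pair1.
have mA := measurable_cons_comp (measurable_avg i mG G0).
case: (unliftP ord0 i) => [j ->|->] in mA *.
- rewrite (@fubini_tonelli1 _ _ _ _ R U (cell d) _ mGc)// (@fubini_tonelli1 _ _ _ _ R U (cell d) _ mA); last by move=> p; exact: integral_ge0.
  apply: eq_integral => s _; rewrite /fubini_F (IH _ j (m2 s))//.
  by apply: eq_integral => x _; apply: eq_integral => r _; rewrite upd_consS.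
- rewrite (@fubini_tonelli2 _ _ _ _ R U (cell d) _ mGc)// (@fubini_tonelli2 _ _ _ _ R U (cell d) _ mA); last by move=> p; exact: integral_ge0.
  apply: eq_integral => x _; rewrite /fubini_G.
  under [RHS]eq_integral => s _.
    under eq_integral do rewrite upd_cons0.
    over.
  exact: (esym (prob_cst U _)).
Qed.

Definition tshift d (i : 'I_d) (h : R) (x : d.-tuple R) := upd x i (tnth x i + h)%R.

Lemma tshift_upd d i h (x : d.-tuple R) r : tshift i h (upd x i r) = upd x i (r + h)%R.
Proof.
by rewrite /tshift; apply: eq_from_tnth => j; rewrite !tnth_upd eqxx; case: (j == i).
Qed.

Lemma measurable_tshift d (i : 'I_d) h : measurable_fun setT (tshift i h : d.-tuple R -> _).
Proof.
apply/measurable_fun_tnthP => j.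
have -> : (@tnth d R ^~ j) \o tshift i h =
    (if j == i then (fun x => tnth x i + h)%R else (fun x => tnth x j)).
  by apply/funext => p; rewrite /= tnth_upd; case: ifP.
case: ifP => _; last exact: measurable_tnth.
by apply: measurable_funD; [exact: measurable_tnth|exact: measurable_cst].
Qed.

Lemma ge0_cell_shift d (G : d.-tuple R -> \bar R) i h : measurable_fun setT G ->
  (forall x, 0 <= G x) -> (forall x, G (tshift i 1%R x) = G x) ->
  \int[cell d]_x G (tshift i h x) = \int[cell d]_x G x.
Proof.
move=> mG G0 G1.
have mGs : measurable_fun setT (fun x => G (tshift i h x)).
  by apply: (measurableT_comp mG); exact: measurable_tshift.
apply: (etrans (cell_avg i mGs (fun x => G0 _))); apply: (etrans _ (esym (cell_avg i mG G0))).
apply: eq_integral => x _.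
have mg : measurable_fun setT (fun r : measurableTypeR R => G (upd x i r)).
  apply: (@measurableT_comp _ _ _ _ _ _ (fun p => G (upd p.1 i p.2)) _ (fun r => (x, r))).
    exact: measurable_upd_comp.
  exact: measurable_pair1.
under eq_integral do rewrite tshift_upd.
apply: (U_shift h mg) => // r.
by rewrite -tshift_upd G1.
Qed.

Lemma cell_shift d (G : d.-tuple R -> \bar R) i h : measurable_fun setT G ->
  (forall x, G (tshift i 1%R x) = G x) ->
  \int[cell d]_x G (tshift i h x) = \int[cell d]_x G x.
Proof.
move=> mG G1; rewrite integralE [RHS]integralE; congr (_ - _).
- have h1 x : (G^\+) (tshift i 1%R x) = (G^\+) x by rewrite !funeposE G1.
  transitivity (\int[cell d]_x (G^\+) (tshift i h x)).
    by apply: eq_integral => x _; rewrite !funeposE.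
  exact: (ge0_cell_shift h (measurable_funepos mG) (funepos_ge0 G) h1).
- have h1 x : (G^\-) (tshift i 1%R x) = (G^\-) x by rewrite !funenegE G1.
  transitivity (\int[cell d]_x (G^\-) (tshift i h x)).
    by apply: eq_integral => x _; rewrite !funenegE.
  exact: (ge0_cell_shift h (measurable_funeneg mG) (funeneg_ge0 G) h1).
Qed.

Lemma cell_marginal d (i : 'I_d) (f : R -> \bar R) : measurable_fun setT f ->
  (forall s, 0 <= f s) -> \int[cell d]_x f (tnth x i) = \int[U]_s f s.
Proof.
move=> mf f0.
have mG : measurable_fun setT (fun x : d.-tuple R => f (tnth x i)).
  by apply: (measurableT_comp mf); exact: measurable_tnth.
apply: (etrans (cell_avg i mG (fun x => f0 _))).
under eq_integral => x _.
  under eq_integral do rewrite tnth_upd eqxx.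
  over.
exact: prob_cst.
Qed.

End Cell.

(** * Test functions on the torus *)

Section TorusCalculus.
Context {R : realType} {d : nat}.
Implicit Types (u v w psi : 'rV[R]_d -> R) (i j : 'I_d) (x y : 'rV[R]_d).
Local Notation e i := (delta_mx 0 i : 'rV[R]_d).
Local Notation row := (@row_of_tuple R d).
Local Notation periodic := (@Defs.periodic R d).

Lemma row_tshift i (h : R) (x : d.-tuple R) : row (tshift i h x) = row x + h *: e i.
Proof.
apply/rowP => j; rewrite !mxE tnth_upd eqxx /=; case: eqP => [->|_].
  by rewrite mulr1.
by rewrite mulr0 addr0.
Qed.

Lemma coord_add_e (h : R) x i j : (x + h *: e i) 0 j = x 0 j + h * (j == i)%:R.
Proof. by rewrite !mxE eqxx. Qed.

Lemma is_derive_line u x (v : 'rV[R]_d) (s df : R) :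
  is_derive (x + s *: v) v u df <-> is_derive s 1 (fun r : R => u (x + r *: v)) df.
Proof.
have E : (fun h : R => h^-1 *: ((u \o shift (x + s *: v)) (h *: v) - u (x + s *: v))) =
    (fun h : R => h^-1 *: (((fun r : R => u (x + r *: v)) \o shift s) (h *: 1) - u (x + s *: v))).
  apply/funext => h /=; congr (_ *: (u _ - _)).
  by rewrite addrC -addrA -scalerDl (addrC s) [h *: 1]mulr1.
split=> [[d1 d2]|[d1 d2]]; split.
- by move: d1; rewrite /derivable E.
- by move: d2; rewrite /derive E.
- by move: d1; rewrite /derivable -E.
- by move: d2; rewrite /derive -E.
Qed.

Lemma is_derive_line0 u x (v : 'rV[R]_d) (df : R) :
  is_derive x v u df <-> is_derive (0 : R) 1 (fun r : R => u (x + r *: v)) df.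
Proof. by rewrite -is_derive_line scale0r addr0. Qed.

Lemma derive_funE u (u' : 'rV[R]_d -> R) (v : 'rV[R]_d) :
  (forall x, is_derive x v u (u' x)) -> 'D_v u = u'.
Proof. by move=> h; apply/funext => x; exact: derive_val. Qed.

Lemma addcont u v : continuous u -> continuous v -> continuous (fun x => u x + v x).
Proof. by move=> cu cv x; apply: (@cvgD _ _ _ (nbhs x) _ u v); [exact: cu|exact: cv]. Qed.

Lemma mulcont u v : continuous u -> continuous v -> continuous (fun x => u x * v x).
Proof. by move=> cu cv x; apply: (@cvgM _ _ (nbhs x) _ u v); [exact: cu|exact: cv]. Qed.

Lemma CkS k u (u' : 'I_d -> 'rV[R]_d -> R) : continuous u ->
  (forall i x, is_derive x (e i) u (u' i x)) -> (forall i, torus_Ck k (u' i)) ->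
  torus_Ck k.+1 u.
Proof.
move=> cu du hu'; split => // i; split.
  by move=> x; have h := du i x; exact: ex_derive.
by rewrite (derive_funE (du i)).
Qed.

Lemma Ck_cont k u : torus_Ck k u -> continuous u.
Proof. by case: k => [[]|k []]. Qed.

Lemma Ck0 u : continuous u -> torus_Ck 0 u.
Proof. by move=> cu; split => // x; exact: (cu x). Qed.

Lemma Ck_derive k u i x : torus_Ck k.+1 u -> is_derive x (e i) u ('D_(e i) u x).
Proof. by move=> [_ /(_ i)[h _]]; exact: derivableP. Qed.

Lemma CkW k u : torus_Ck k.+1 u -> torus_Ck k u.
Proof.
elim: k u => [u [cu _]|k IH u [cu hu]]; first by split.
split => // i; have [du hu'] := hu i; split => //; exact: IH.
Qed.

Lemma Ck_cst k (c : R) : torus_Ck k (cst c : 'rV[R]_d -> R).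
Proof.
elim: k c => [c|k IH c]; first by apply: Ck0; exact: cst_continuous.
apply: (@CkS k (cst c) (fun _ => cst 0)).
- exact: cst_continuous.
- by move=> i; exact: IH.
Qed.

Lemma CkD k u v : torus_Ck k u -> torus_Ck k v -> torus_Ck k (fun x => u x + v x).
Proof.
elim: k u v => [u v hu hv|k IH u v hu hv].
  by apply: Ck0; exact: addcont (Ck_cont hu) (Ck_cont hv).
apply: (@CkS _ _ (fun i x => 'D_(e i) u x + 'D_(e i) v x)).
- exact: addcont (Ck_cont hu) (Ck_cont hv).
- move=> i x; exact: is_deriveD (Ck_derive i x hu) (Ck_derive i x hv).
- by move=> i; apply: IH; [have [_ /(_ i)[]] := hu|have [_ /(_ i)[]] := hv].
Qed.

Lemma CkM k u v : torus_Ck k u -> torus_Ck k v -> torus_Ck k (fun x => u x * v x).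
Proof.
elim: k u v => [u v hu hv|k IH u v hu hv].
  by apply: Ck0; exact: mulcont (Ck_cont hu) (Ck_cont hv).
apply: (@CkS _ _ (fun i x => u x * 'D_(e i) v x + v x * 'D_(e i) u x)).
- exact: mulcont (Ck_cont hu) (Ck_cont hv).
- move=> i x; exact: is_deriveM (Ck_derive i x hu) (Ck_derive i x hv).
- move=> i; apply: CkD; apply: IH.
  + exact: CkW hu.
  + by have [_ /(_ i)[]] := hv.
  + exact: CkW hv.
  + by have [_ /(_ i)[]] := hu.
Qed.

Lemma coord_derive (g : R -> R) (dg : R) x i j : is_derive (x 0 j) 1 g dg ->
  is_derive x (e i) (fun y : 'rV[R]_d => g (y 0 j)) (dg * (j == i)%:R).
Proof.
move=> hg; apply/is_derive_line0.
have -> : (fun r : R => g ((x + r *: e i) 0 j)) = g \o (fun r : R => x 0 j + r * (j == i)%:R).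
  by apply/funext => r /=; rewrite coord_add_e.
apply: is_derive1_comp; first by rewrite mul0r addr0.
have h := is_deriveD (is_derive_cst (x 0 j) (0 : R) 1)
  (is_deriveM (is_derive_id (0 : R) 1) (is_derive_cst ((j == i)%:R : R) (0 : R) 1)).
by apply: (is_derive_eq h); rewrite /GRing.scale /= mul0r add0r add0r mulr1.
Qed.

Lemma coord_cont j : continuous (fun y : 'rV[R]_d => y 0 j).
Proof. exact: coord_continuous. Qed.

Lemma coord_comp_cont (g : R -> R) j : continuous g -> continuous (fun y : 'rV[R]_d => g (y 0 j)).
Proof.
move=> cg x; apply: (@continuous_comp _ _ _ (fun y : 'rV[R]_d => y 0 j) g).
  exact: coord_cont.
exact: cg.
Qed.

Lemma Ck_coord k (g : R -> R) j : smooth g -> torus_Ck k (fun y : 'rV[R]_d => g (y 0 j)).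
Proof.
elim: k g => [|k IH] g sg.
  by apply: Ck0; apply: coord_comp_cont; exact: smooth_continuous.
apply: (@CkS _ _ (fun i x => g^`()%classic (x 0 j) * (j == i)%:R)).
- by apply: coord_comp_cont; exact: smooth_continuous.
- by move=> i x; apply: coord_derive; exact: smooth_is_derive.
- by move=> i; apply: CkM; [apply: IH; exact: smooth_derive|exact: Ck_cst].
Qed.

Lemma trans_cont (v : 'rV[R]_d) : continuous (fun x : 'rV[R]_d => x + v).
Proof.
by move=> x; apply: (@cvgD _ _ _ (nbhs x) _ id (cst v)); [exact: cvg_id|exact: cvg_cst].
Qed.

Lemma comp_trans_cont u (v : 'rV[R]_d) : continuous u -> continuous (fun x => u (x + v)).
Proof.
by move=> cu x; apply: (@continuous_comp _ _ _ (fun x => x + v) u); [exact: trans_cont|exact: cu].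
Qed.

Lemma Ck_trans k u (v : 'rV[R]_d) : torus_Ck k u -> torus_Ck k (fun x => u (x + v)).
Proof.
elim: k u => [u hu|k IH u hu].
  by apply: Ck0; exact: comp_trans_cont (Ck_cont hu).
apply: (@CkS _ _ (fun i x => 'D_(e i) u (x + v))).
- exact: comp_trans_cont (Ck_cont hu).
- move=> i x; have /is_derive_line0 h := Ck_derive i (x + v) hu; apply/is_derive_line0.
  have -> : (fun r : R => u (x + r *: e i + v)) = (fun r : R => u (x + v + r *: e i)).
    by apply/funext => r; rewrite addrAC.
  exact: h.
- by move=> i; have [_ /(_ i)[_ h]] := hu; exact: (IH ('D_(e i) u) h).
Qed.

Local Notation test := (@torus_test R d).

Lemma torus_test_cont psi : test psi -> continuous psi.
Proof. by move=> [_ /(_ 0%N)]; exact: Ck_cont. Qed.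

Lemma torus_test_is_derive psi i x : test psi -> is_derive x (e i) psi ('D_(e i) psi x).
Proof. by move=> [_ /(_ 1%N)]; exact: Ck_derive. Qed.

Lemma torus_test_cst (c : R) : test (cst c).
Proof. by split=> [//|k]; exact: Ck_cst. Qed.

Lemma torus_test_mul psi psi' : test psi -> test psi' -> test (fun x => psi x * psi' x).
Proof.
move=> [p1 h1] [p2 h2]; split=> [i x|k]; first by rewrite p1 p2.
exact: CkM.
Qed.

Lemma torus_test_trans psi (v : 'rV[R]_d) : test psi -> test (fun x => psi (x + v)).
Proof.
move=> [p1 h1]; split=> [i x|k]; first by rewrite addrAC p1.
exact: Ck_trans.
Qed.

Lemma torus_test_derive psi i : test psi -> test ('D_(e i) psi).
Proof.
move=> [p1 h1]; split=> [j x|k]; last by have [_ /(_ i)[]] := h1 k.+1.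
have /is_derive_line0 h := @torus_test_is_derive psi i (x + e j) (conj p1 h1).
have /is_derive_line0 h' := @torus_test_is_derive psi i x (conj p1 h1).
have E : (fun r : R => psi (x + e j + r *: e i)) = (fun r : R => psi (x + r *: e i)).
  by apply/funext => r; rewrite addrAC p1.
rewrite E in h.
by rewrite -(@derive_val _ _ _ _ _ _ _ h) (@derive_val _ _ _ _ _ _ _ h').
Qed.

Lemma torus_test_coord (g : R -> R) j : smooth g -> (forall s, g (s + 1) = g s) ->
  test (fun y => g (y 0 j)).
Proof.
move=> sg pg; split=> [i x|k]; last exact: Ck_coord.
have := coord_add_e 1 x i j; rewrite scale1r => ->.
by case: (j == i); rewrite ?mulr1 ?mulr0 ?addr0.
Qed.

Lemma torus_test_prod (g : 'I_d -> R -> R) (s : seq 'I_d) : (forall i, smooth (g i)) ->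
  (forall i r, g i (r + 1) = g i r) -> test (fun y => \prod_(i <- s) g i (y 0 i)).
Proof.
move=> sg pg; elim: s => [|i s IH].
  have -> : (fun y : 'rV[R]_d => \prod_(i <- [::]) g i (y 0 i)) = cst 1.
    by apply/funext => y; rewrite big_nil.
  exact: torus_test_cst.
have -> : (fun y : 'rV[R]_d => \prod_(i <- i :: s) g i (y 0 i)) =
    (fun y => g i (y 0 i) * \prod_(i <- s) g i (y 0 i)).
  by apply/funext => y; rewrite big_cons.
by apply: torus_test_mul => //; apply: torus_test_coord; [exact: sg|exact: pg].
Qed.

Lemma periodic_int u i x (z : int) : periodic u -> u (x + z%:~R *: e i) = u x.
Proof.
move=> pu; have h (n : nat) y : u (y + n%:R *: e i) = u y.
  elim: n => [|n IH]; first by rewrite scale0r addr0.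
  by rewrite -natr1 scalerDl scale1r addrA pu.
case: (intP z) => [|n|n]; first by rewrite scale0r addr0.
  exact: h.
by rewrite mulrNz scaleNr -[in RHS](subrK (n.+1%:R *: e i) x) h.
Qed.

Lemma periodic_sum u x (z : 'I_d -> int) (s : seq 'I_d) : periodic u ->
  u (x + \sum_(i <- s) (z i)%:~R *: e i) = u x.
Proof.
move=> pu; elim: s x => [|i s IH] x; first by rewrite big_nil addr0.
by rewrite big_cons addrA IH periodic_int.
Qed.

Lemma periodic_row u x (z : 'I_d -> int) : periodic u ->
  u (x + \row_i (z i)%:~R) = u x.
Proof.
move=> pu; rewrite -[RHS](periodic_sum x z (index_enum _) pu); congr (u (x + _)).
apply/rowP => j; rewrite mxE summxE (bigD1 j)//= big1 ?addr0.
  by rewrite !mxE !eqxx mulr1.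
by move=> i ij; rewrite !mxE eqxx/= eq_sym (negbTE ij) mulr0.
Qed.

Lemma periodic_bounded u : periodic u -> continuous u ->
  exists2 M, 0 <= M & forall x, `|u x| <= M.
Proof.
move=> pu cu.
pose K := [set v : 'rV[R]_d | forall i, `[0, 1]%classic (v ord0 i)].
have cK : compact K by apply: (@rV_compact R d (fun _ => `[0, 1]%classic)) => i; exact: segment_compact.
have /compact_bounded[M [_ hM]] : compact (u @` K).
  by apply: continuous_compact => //; exact: continuous_subspaceT.
exists (`|M| + 1); first by rewrite addr_ge0.
move=> x; rewrite -(periodic_row x (fun i => - Num.floor (x 0 i)) pu).
apply: (hM (`|M| + 1)); first by rewrite (le_lt_trans (ler_norm _))// ltrDl.
exists (x + \row_i (- Num.floor (x 0 i))%:~R) => // i /=.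
rewrite in_itv/= !mxE mulrNz subr_ge0 ge_floor/= lerBlDl.
by apply: ltW; have := lt_succ_floor (x 0 i); rewrite intrD addrC.
Qed.

(* The values on the grid n^-1 Z^d are taken on countably many boxes. *)
Lemma cont_measurable u : continuous u -> measurable_fun setT (u \o row).
Proof.
move=> cu.
pose k (n : nat) (t : d.-tuple R) : {ffun 'I_d -> int} :=
  [ffun i => Num.floor (n.+1%:R * tnth t i)].
pose F (n : nat) (z : {ffun 'I_d -> int}) : R := u (\row_i ((z i)%:~R / n.+1%:R)).
apply: (@measurable_fun_cvg _ (d.-tuple R) R setT (fun n t => F n (k n t)) (u \o row)).
- move=> n _ B mB; rewrite setTI.
  have -> : (fun t => F n (k n t)) @^-1` B =
      \bigcup_(z : {ffun 'I_d -> int}) (if F n z \in B then k n @^-1` [set z] else set0).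
    apply/seteqP; split=> [t /= hx|t [z _] /=].
      by exists (k n t) => //; rewrite mem_set.
    by case: ifPn => // hz /= ->; exact: set_mem.
  apply: countable_bigcupT_measurable; first exact: countableP.
  move=> z; case: ifPn => // _.
  have -> : k n @^-1` [set z] = \bigcap_(i in [set: 'I_d])
      ((@tnth d R ^~ i) @^-1` [set s : R | (z i)%:~R <= n.+1%:R * s < (z i + 1)%:~R]).
    apply/seteqP; split=> [t /= <- i _ /=|t /= h].
      by rewrite ffunE ge_floor lt_succ_floor.
    apply/ffunP => i; rewrite ffunE; apply: floor_def; exact: (h i Logic.I).
  apply: fin_bigcap_measurable; first exact: finite_finset.
  move=> i _; rewrite -[X in measurable X]setTI; apply: measurable_tnth => //.
  have -> : [set s : R | (z i)%:~R <= n.+1%:R * s < (z i + 1)%:~R] =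
      `[(z i)%:~R / n.+1%:R, (z i + 1)%:~R / n.+1%:R[%classic.
    by apply/funext => s; apply/propext; rewrite /= in_itv/= ler_pdivrMr// ltr_pdivlMr// (mulrC s).
  exact: measurable_itv.
- move=> t _; apply: (@cvg_comp _ _ _ (fun n : nat => \row_i ((k n t i)%:~R / n.+1%:R) : 'rV[R]_d) u \oo (nbhs (row t)) _ _ (cu (row t))).
  apply/cvgrPdist_lt => eps eps0; near=> n.
  have hn : n.+1%:R^-1 < eps by near: n; exact: near_infty_natSinv_lt (PosNum eps0).
  rewrite /Num.norm /= mx_normrE; apply/bigmax_ltP; split => // -[i j] _ /=.
  have -> : (row t - \row_i0 ((k n t i0)%:~R / n.+1%:R)) i j = tnth t j - (Num.floor (n.+1%:R * tnth t j))%:~R / n.+1%:R.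
    by rewrite !mxE ffunE.
  have p0 : 0 < (n.+1%:R : R) by rewrite ltr0n.
  have h1 := ge_floor (n.+1%:R * tnth t j).
  have h2 := lt_succ_floor (n.+1%:R * tnth t j); rewrite intrD in h2.
  have -> : tnth t j - (Num.floor (n.+1%:R * tnth t j))%:~R / n.+1%:R =
      (n.+1%:R * tnth t j - (Num.floor (n.+1%:R * tnth t j))%:~R) / n.+1%:R.
    by rewrite mulrBl mulrAC mulfV ?mul1r// gt_eqF.
  apply: le_lt_trans hn; rewrite normrM [X in _ * X]ger0_norm ?invr_ge0 ?ler0n//.
  rewrite ler_piMl ?invr_ge0 ?ler0n// ger0_norm ?subr_ge0// lerBlDl ltW//.
Unshelve. all: by end_near. Qed.

Local Notation mu := (cell_measure R d).
Local Notation L2 f := (f \in Lfun mu 2%:E).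

Lemma bounded_L2 (f : d.-tuple R -> R) (M : R) : measurable_fun setT f -> (forall t : d.-tuple R, `|f t| <= M) -> L2 f.
Proof.
move=> mf hM; apply: (L2_dom mf (@Lfun_cst _ _ _ mu M 2)) => x /=.
exact: le_trans (hM x) (ler_norm _).
Qed.

Lemma cont_L2 u : periodic u -> continuous u -> L2 (u \o row).
Proof.
move=> pu cu; have [M M0 hM] := periodic_bounded pu cu.
by apply: (@bounded_L2 _ M); [exact: cont_measurable|move=> x; exact: hM].
Qed.

Lemma torus_test_L2 psi : test psi -> L2 (psi \o row).
Proof. by move=> tp; apply: cont_L2; [exact: (proj1 tp)|exact: torus_test_cont]. Qed.

Lemma torus_int_shift u i (h : R) : periodic u -> measurable_fun setT (u \o row) ->
  torus_int (fun x => u (x + h *: e i)) = torus_int u.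
Proof.
move=> pu mu'; rewrite /torus_int /Rintegral; congr fine.
have := @cell_shift R d (EFin \o (u \o row)) i h.
have -> : (fun x : d.-tuple R => (EFin \o (u \o row)) (tshift i h x)) =
    (fun x : d.-tuple R => (u (row x + h *: e i))%:E).
  by apply/funext => t /=; rewrite row_tshift.
apply; first exact/measurable_EFinP.
by move=> t /=; rewrite row_tshift scale1r pu.
Qed.

Lemma measurable_trans u i (h : R) : measurable_fun setT (u \o row) ->
  measurable_fun setT (fun x : d.-tuple R => u (row x + h *: e i)).
Proof.
move=> mu'; have -> : (fun x : d.-tuple R => u (row x + h *: e i)) = (u \o row) \o tshift i h.
  by apply/funext => t /=; rewrite row_tshift.
by apply: measurableT_comp => //; exact: measurable_tshift.
Qed.

End TorusCalculus.

(** * Test functions on the torus separate integrable functions *)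

Section TorusUniqueness.
Context {R : realType} {d : nat}.
Implicit Types (u v w psi : 'rV[R]_d -> R) (i j : 'I_d) (x y : 'rV[R]_d) (t : d.-tuple R)
  (r s q : R).
Local Notation row := (@row_of_tuple R d).
Local Notation mu := (cell_measure R d).
Local Notation test := (@torus_test R d).

Lemma smooth_sin (k c : R) : smooth (fun s : R => sin (k * s + c)).
Proof.
have h : smooth (fun s : R => k * s + (c - pi / 2)).
  exact (smoothD (@smoothZ R k _ (@smooth_id R)) (@smooth_cst R (c - pi / 2))).
have -> : (fun s : R => sin (k * s + c)) = (fun s : R => cos (k * s + (c - pi / 2))).
  by apply/funext => s; rewrite addrA cosBpihalf.
exact (smooth_comp (@smooth_cos R) h).
Qed.

(* Positive exactly on ]-p, q[ + Z, as p + q <= 1. *)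
Definition arc (p q s : R) : R := sin (pi * s + pi * p) * sin (- pi * s + pi * q).

Lemma smooth_arc p q : smooth (arc p q).
Proof. exact (smoothM (@smooth_sin pi (pi * p)) (@smooth_sin (- pi) (pi * q))). Qed.

Lemma arc_periodic p q s : arc p q (s + 1) = arc p q s.
Proof.
rewrite /arc.
have -> : pi * (s + 1) + pi * p = (pi * s + pi * p) + pi by rewrite mulrDr mulr1 addrAC.
rewrite sinDpi.
have -> : - pi * s + pi * q = (- pi * (s + 1) + pi * q) + pi.
  by ring.
by rewrite sinDpi mulrN mulNr.
Qed.

Lemma arc_gt0 p q s : p + q <= 1 -> - p < s < q -> 0 < arc p q s.
Proof.
move=> pq /andP[ps sq]; have pi0 := pi_gt0 R.
rewrite /arc mulr_gt0//; apply: sin_gt0_pi.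
- rewrite -mulrDr mulr_gt0 ?pmulr_rlt0//=; last by lra.
  rewrite -[ltRHS]mulr1 ltr_pM2l//; lra.
- rewrite mulNr -mulrN -mulrDr mulr_gt0//=; last by lra.
  rewrite -[ltRHS]mulr1 ltr_pM2l//; lra.
Qed.

Lemma arc_le0 p q s : 0 <= p + q <= 1 -> q <= s <= 1 - p -> arc p q s <= 0.
Proof.
move=> /andP[pq0 pq] /andP[qs sp]; have pi0 := pi_gt0 R.
have -> : arc p q s = - (sin (pi * (s + p)) * sin (pi * (s - q))).
  have -> : arc p q s = sin (pi * (s + p)) * sin (- (pi * (s - q))).
    by rewrite /arc; congr (sin _ * sin _); ring.
  by rewrite sinN mulrN.
have h r : 0 <= r <= 1 -> 0 <= sin (pi * r).
  move=> /andP[r0 r1]; apply: sin_ge0_pi; rewrite mulr_ge0//= ?(ltW pi0)//.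
  by rewrite -[leRHS]mulr1 ler_pM2l.
by rewrite oppr_le0 mulr_ge0// h//; lra.
Qed.

(** A smooth periodic substitute for the indicator of s < q, faithful in the limit only for s in ]0,
    1[, which is almost everywhere on the cell. For q outside ]0, 1[ that indicator is constant
    there, hence the two constant cases. *)
Definition cutoff (q : R) (m : nat) : R -> R :=
  if q <= 0 then cst 0 else if 1 <= q then cst 1
  else fun s => en 0 (m.+1%:R * arc 0 q s).

Lemma smooth_cutoff q m : smooth (cutoff q m).
Proof.
rewrite /cutoff; case: ifP => _; first exact (@smooth_cst R 0).
case: ifP => _; first exact (@smooth_cst R 1).
exact (smooth_comp (@smooth_en R 0) (@smoothZ R m.+1%:R _ (@smooth_arc 0 q))).
Qed.

Lemma cutoff_periodic q m s : cutoff q m (s + 1) = cutoff q m s.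
Proof.
rewrite /cutoff; case: ifP => _ //; case: ifP => _ //.
by rewrite arc_periodic.
Qed.

Lemma cutoff_bound q m s : 0 <= cutoff q m s <= 1.
Proof.
rewrite /cutoff; case: ifP => _ /=; first by rewrite lexx ler01.
case: ifP => _ /=; first by rewrite lexx ler01.
by rewrite en_ge0 en0_le1.
Qed.

Lemma cutoff_cvg q s : 0 < s < 1 -> cutoff q m s @[m --> \oo] --> ((s < q)%R%:R : R).
Proof.
move=> s01; have /andP[s0 s1] := s01; rewrite /cutoff.
case: (boolP (q <= 0)) => q0.
  have -> : (s < q) = false by apply/negbTE; rewrite -leNgt; lra.
  exact: cvg_cst.
case: (boolP (1 <= q)) => q1.
  have -> : (s < q) = true by apply: lt_le_trans q1.
  exact: cvg_cst.
case: ltP => sq.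
  apply: en0_cvg1; apply: arc_gt0; lra.
have -> : (fun m : nat => en 0 (m.+1%:R * arc 0 q s)) = (fun=> 0).
  apply/funext => m; apply: en0_eq0; rewrite mulr_ge0_le0//.
  by apply: arc_le0; lra.
exact: cvg_cst.
Qed.

Definition ray (q : 'I_d -> R) : set (d.-tuple R) := [set t | forall i, tnth t i < q i].

Definition rays : set (set (d.-tuple R)) := [set A | exists q : 'I_d -> R, A = ray q].

Lemma rays_setI : setI_closed rays.
Proof.
move=> A B [p ->] [q ->]; exists (fun i => Num.min (p i) (q i)).
apply/seteqP; split=> t /=.
  by move=> [h h'] i; rewrite lt_min h h'.
by move=> h; split=> i; have := h i; rewrite lt_min => /andP[].
Qed.

Lemma measurable_ray (q : 'I_d -> R) : measurable (ray q).
Proof.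
have -> : ray q = \bigcap_(i in [set: 'I_d]) ((@tnth d R ^~ i) @^-1` `]-oo, q i[%classic).
  apply/seteqP; split=> t /= h i; first by move=> _ /=; rewrite in_itv /=; exact: h.
  by have := h i Logic.I; rewrite /= in_itv.
apply: fin_bigcap_measurable; first exact: finite_finset.
move=> i _; rewrite -[X in measurable X]setTI; apply: measurable_tnth => //.
Qed.

(** A half-space bounding one coordinate is the union over n of the rays whose other bounds are
    n. *)
Lemma rays_generate : @measurable _ (d.-tuple R) = <<s rays >>.
Proof.
apply/seteqP; split; last first.
  apply: smallest_sub; first exact: sigma_algebra_measurable.
  by move=> _ [q ->]; exact: measurable_ray.
pose T' := g_sigma_algebraType rays.
have h : measurable_fun [set: T'] (idfun : T' -> d.-tuple R).
  apply/measurable_fun_tnthP => i.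
  apply: (measurability _ (RGenInftyO.measurableE R)) => _ [_ [c ->] <-].
  rewrite setTI.
  have -> : (fun t : T' => tnth t i) @^-1` `]-oo, c[%classic =
      \bigcup_(n : nat) (ray (fun j => if j == i then c else n%:R)).
    apply/seteqP; split=> t /=.
      rewrite in_itv /= => tc.
      pose M := \sum_(j < d) `|tnth t j|.
      exists (Num.truncn M).+1 => // j /=; case: eqP => [->//|_].
      apply: le_lt_trans (truncnS_gt M); apply: le_trans (ler_norm _) _.
      by rewrite /M (bigD1 j)//= lerDl sumr_ge0.
    by move=> [n _ /(_ i)]; rewrite eqxx in_itv.
  apply: bigcupT_measurable => n; apply: sub_sigma_algebra; eexists; reflexivity.
by move=> A mA; have := h measurableT _ mA; rewrite setTI.
Qed.

(** The i-th marginal of the cell measure is uniform, so the faces where a coordinate is 0 or 1 are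
    null. *)
Lemma cell_coord_ae (P : R -> Prop) (i : 'I_d) : (forall s, 0 < s < 1 -> P s) ->
  \forall t \ae mu, P (tnth t i).
Proof.
move=> hP; pose N := ~` `]0, 1[%classic : set R.
have mN : measurable N by exact: measurableC.
exists ((@tnth d R ^~ i) @^-1` N); split.
- by rewrite -[X in measurable X]setTI; exact: measurable_tnth.
- have h := @cell_marginal R d i (EFin \o \1_N).
  have e : (\int[mu]_t (EFin \o \1_N) (tnth t i))%E = mu ((@tnth d R ^~ i) @^-1` N).
    transitivity (mu (((@tnth d R ^~ i) @^-1` N) `&` setT)); last by rewrite setIT.
    rewrite -integral_indic//; last first.
      by rewrite -[X in measurable X]setTI; exact: measurable_tnth.
  rewrite -e h; last 2 first.
    by apply/measurable_EFinP; exact: measurable_indic.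
    by move=> s /=; rewrite lee_fin.
  rewrite integral_U; last 2 first.
    by apply/measurable_EFinP; exact: measurable_indic.
    by move=> s /=; rewrite lee_fin.
  rewrite integral_indic//.
  have -> : N `&` `[0, 1] = [set 0; 1].
    apply/seteqP; split=> s /=; rewrite !in_itv /=.
      move=> [/negP h1 /andP[s0 s1]]; move: h1.
      rewrite negb_and -!leNgt => /orP[s2|s2]; [left|right]; lra.
    by case=> ->; rewrite /N /= in_itv /= ltxx ?andbF ?lexx ?ler01; split.
  by apply: countable_lebesgue_measure0; apply: finite_set_countable; exact: finite_set2.
- by move=> t /= h /= h'; apply: h; apply: hP; rewrite /= in_itv in h'.
Qed.

(** Products of cutoffs are test functions, bounded by 1 and converging almost everywhere to the
    indicator of a ray. By dominated convergence [u] integrates to zero over every ray, and the rays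
    form a generating pi-system. *)
Lemma torus_ae0 u : mu.-integrable setT (EFin \o (u \o row)) -> (forall psi, test psi -> torus_int (u \* psi) = 0) ->
  \forall t \ae mu, u (row t) = 0.
Proof.
move=> iu hu.
have mu0 : measurable_fun setT (u \o row) by apply/measurable_EFinP; exact: measurable_int iu.
have u0 : \int[mu]_t u (row t) = 0.
  have := hu (cst 1) (torus_test_cst 1); rewrite /torus_int.
  by move=> <-; apply: eq_Rintegral => t _ /=; rewrite mulr1.
apply: (@pi_system_ae0 _ _ _ mu rays (u \o row) rays_generate rays_setI iu u0).
move=> _ [q ->].
pose psi (m : nat) y := \prod_(i <- index_enum 'I_d) cutoff (q i) m (y 0 i).
have tpsi m : test (psi m).
  exact (@torus_test_prod R d (fun i => cutoff (q i) m) (index_enum _)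
    (fun i => @smooth_cutoff (q i) m) (fun i => @cutoff_periodic (q i) m)).
have psib m y : `|psi m y| <= 1.
  rewrite /psi; elim: (index_enum _) => [|i l IH]; first by rewrite big_nil normr1.
  rewrite big_cons normrM mulr_ile1// ger0_norm//; by case/andP: (cutoff_bound (q i) m (y 0 i)).
have mpsi m : measurable_fun setT (psi m \o row) by exact: (L2_measurable (torus_test_L2 (tpsi m))).
pose F (m : nat) t := u (row t) * psi m (row t).
have mF m : measurable_fun setT (F m).
  exact: (measurable_funM mu0 (mpsi m)).
have mlim : measurable_fun setT (fun t => u (row t) * \1_(ray q) t).
  by apply: measurable_funM; [exact: mu0|exact: measurable_indic (measurable_ray q)].
have cv : \forall t \ae mu, setT t -> F m t @[m --> \oo] --> u (row t) * \1_(ray q) t.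
  have : \forall t \ae mu, forall i : 'I_d, 0 < tnth t i < 1.
    apply: filter_forall => i; exact: (@cell_coord_ae (fun s => 0 < s < 1)).
  apply: ae_imp => t ht _; apply: cvgMr.
  have -> : \1_(ray q) t = \prod_(i <- index_enum 'I_d) (tnth t i < q i)%R%:R :> R.
    rewrite indicE; have [h|h] := pselect (ray q t).
      by rewrite mem_set// big1// => i _; rewrite h.
    have [i hi] : exists i, ~~ (tnth t i < q i).
      by apply: contrapT => h'; apply: h => i; apply: contrapT => /negP hi; apply: h'; exists i.
    by rewrite memNset// (bigD1 i)//= (negbTE hi) mul0r.
  rewrite /psi; elim: (index_enum _) => [|i l IH].
    have -> : (fun n : nat => \prod_(i <- [::]) cutoff (q i) n (row t 0 i)) = cst 1.
      by apply/funext => n; rewrite big_nil.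
    rewrite big_nil; exact: cvg_cst.
  have -> : (fun n : nat => \prod_(i <- i :: l) cutoff (q i) n (row t 0 i)) =
     (fun n : nat => cutoff (q i) n (tnth t i) * \prod_(i <- l) cutoff (q i) n (row t 0 i)).
    by apply/funext => n; rewrite big_cons mxE.
  by rewrite big_cons; apply: cvgM => //; exact: cutoff_cvg.
have iu' : mu.-integrable setT (EFin \o (fun t => `|u (row t)|)).
  by have := integrable_norm iu.
have Fu m t : setT t -> `|F m t| <= `|u (row t)|.
  by move=> _; rewrite /F normrM ler_piMr.
have lim := dominated_cvgR measurableT mF mlim cv iu' Fu.
have E m : \int[mu]_t F m t = 0 by exact: hu (tpsi m).
have {}lim : (0 : R) @[m --> \oo] --> \int[mu]_t (u (row t) * \1_(ray q) t).
  by apply: cvg_trans lim; apply: near_eq_cvg; apply: nearW => m; rewrite E.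
have -> : \int[mu]_(t in ray q) (u (row t)) = \int[mu]_t (u (row t) * \1_(ray q) t).
  rewrite Rintegral_mkcond; apply: eq_Rintegral => t _.
  by rewrite patchE indicE; case: ifPn; rewrite ?mulr1 ?mulr0.
exact: (cvg_unique _ lim (cvg_cst 0)).
Qed.

End TorusUniqueness.

(** * Weak derivatives on the torus *)

Section WeakPartial.
Context {R : realType} {d : nat}.
Implicit Types (u v w psi : 'rV[R]_d -> R) (i j : 'I_d) (x y : 'rV[R]_d) (t : d.-tuple R)
  (r s q : R) (k : nat).
Local Notation row := (@row_of_tuple R d).
Local Notation mu := (cell_measure R d).
Local Notation L2 f := (f \in Lfun mu 2%:E).
Local Notation test := (@torus_test R d).
Local Notation tL2 := (@torus_L2 R d).
Local Notation periodic := (@Defs.periodic R d).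
Local Notation e i := (delta_mx 0 i : 'rV[R]_d).
Local Notation "u =ae v" := (\forall t \ae mu, u (row t) = v (row t)) (at level 70).

Lemma tL2_meas u : tL2 u -> measurable_fun setT (u \o row).
Proof. by move=> [_ h]; exact: L2_measurable h. Qed.

Lemma tL2_lin (a : R) u v : tL2 u -> tL2 v -> tL2 (fun x => a * u x + v x).
Proof.
move=> [pu Lu] [pv Lv]; split; first by move=> i x; rewrite pu pv.
exact: L2_eq (L2_lin a Lu Lv) _.
Qed.

Lemma tL2_0 : tL2 (cst 0).
Proof. by split; [|exact: L2_0]. Qed.

Lemma tL2_Z (a : R) u : tL2 u -> tL2 (fun x => a * u x).
Proof.
by move=> [pu Lu]; split; [move=> i x; rewrite pu|exact: (L2_Z a Lu)].
Qed.

Lemma tL2_D u v : tL2 u -> tL2 v -> tL2 (fun x => u x + v x).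
Proof.
by move=> [pu Lu] [pv Lv]; split; [move=> i x; rewrite pu pv|exact: (L2_D Lu Lv)].
Qed.

Lemma tL2_B u v : tL2 u -> tL2 v -> tL2 (fun x => u x - v x).
Proof.
by move=> [pu Lu] [pv Lv]; split; [move=> i x; rewrite pu pv|exact: (L2_B Lu Lv)].
Qed.

Lemma tL2_sum (s : seq 'I_d) (g : 'I_d -> 'rV[R]_d -> R) : (forall i, tL2 (g i)) ->
  tL2 (fun x => \sum_(i <- s) g i x).
Proof.
move=> hg; elim: s => [|i s IH].
  have -> : (fun x => \sum_(i <- [::]) g i x) = cst 0 by apply/funext => x; rewrite big_nil.
  exact: tL2_0.
have -> : (fun x => \sum_(i <- i :: s) g i x) = (fun x => g i x + \sum_(i <- s) g i x).
  by apply/funext => x; rewrite big_cons.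
exact: tL2_D.
Qed.

Lemma tL2_cont u : periodic u -> continuous u -> tL2 u.
Proof. by move=> pu cu; split => //; exact: cont_L2. Qed.

Lemma tL2_test psi : test psi -> tL2 psi.
Proof. by move=> tp; split; [exact: (proj1 tp)|exact: torus_test_L2]. Qed.

Lemma tL2_integrable1 u : tL2 u -> mu.-integrable setT (EFin \o (u \o row)).
Proof.
move=> [_ Lu]; have := L2_integrable Lu (@Lfun_cst _ _ _ mu 1 2).
by apply: eq_integrable => // t _ /=; rewrite mulr1.
Qed.

Lemma tint_lin (a : R) u v w : tL2 u -> tL2 v -> tL2 w ->
  torus_int (fun x => (a * u x + v x) * w x) =
  a * torus_int (fun x => u x * w x) + torus_int (fun x => v x * w x).
Proof. by move=> [_ Lu] [_ Lv] [_ Lw]; exact: (ip_lin a Lu Lv Lw). Qed.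

Lemma tintC u v : torus_int (fun x => u x * v x) = torus_int (fun x => v x * u x).
Proof. by apply: eq_Rintegral => t _; rewrite mulrC. Qed.

Lemma tint_ae u v w : tL2 u -> tL2 v -> tL2 w -> u =ae v ->
  torus_int (fun x => u x * w x) = torus_int (fun x => v x * w x).
Proof.
move=> Lu Lv Lw uv; apply: ae_Rintegral.
- exact: (measurable_funM (tL2_meas Lu) (tL2_meas Lw)).
- exact: (measurable_funM (tL2_meas Lv) (tL2_meas Lw)).
- by apply: ae_imp uv => t /= ->.
Qed.

Lemma tint_CS u v : tL2 u -> tL2 v ->
  `|torus_int (fun x => u x * v x)| <= torus_L2norm u * torus_L2norm v.
Proof. by move=> [_ Lu] [_ Lv]; exact: (cauchy_schwarz Lu Lv). Qed.

Lemma is_wpartial_unique i u w w' : tL2 w -> tL2 w' ->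
  is_wpartial i u w -> is_wpartial i u w' -> w =ae w'.
Proof.
move=> Lw Lw' hw hw'.
have L : tL2 (fun x => w x - w' x) by exact: tL2_B.
have : (fun x => w x - w' x) =ae cst 0.
  apply: torus_ae0 (tL2_integrable1 L) _ => psi tp.
  have Lp := tL2_test tp.
  have E : torus_int ((fun x => w x - w' x) \* psi) =
      torus_int (fun x => (-1 * w' x + w x) * psi x).
    by apply: eq_Rintegral => t _ /=; congr (_ * _); ring.
  rewrite E tint_lin// mulN1r.
  have := hw _ tp; rewrite hw'// => /oppr_inj h.
  by apply/eqP; rewrite addrC subr_eq0; apply/eqP; rewrite -[LHS]h.
by apply: ae_imp => t /= /eqP; rewrite subr_eq0 => /eqP.
Qed.

Lemma is_wpartial_lin i (a : R) u v w w' : tL2 u -> tL2 v -> tL2 w -> tL2 w' ->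
  is_wpartial i u w -> is_wpartial i v w' ->
  is_wpartial i (fun x => a * u x + v x) (fun x => a * w x + w' x).
Proof.
move=> Lu Lv Lw Lw' hw hw' psi tp.
have Lp := tL2_test tp; have Lp' := tL2_test (torus_test_derive i tp).
rewrite [LHS]tint_lin// [X in - X]tint_lin//.
have -> : torus_int (fun x => u x * 'D_(e i) psi x) = - torus_int (w \* psi) by exact: hw.
have -> : torus_int (fun x => v x * 'D_(e i) psi x) = - torus_int (w' \* psi) by exact: hw'.
by rewrite opprD mulrN.
Qed.

Lemma is_wpartial_ae i u v w : tL2 u -> tL2 v -> u =ae v ->
  is_wpartial i u w -> is_wpartial i v w.
Proof.
move=> Lu Lv uv hw psi tp; rewrite -hw//; symmetry.
exact: (tint_ae Lu Lv (tL2_test (torus_test_derive i tp)) uv).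
Qed.

(** The conclusion is an equality of functions, not merely almost everywhere: [u] and [v] have the
    same set of weak derivatives, and the choice depends on that set alone. *)
Lemma wpartial_ae i u v : tL2 u -> tL2 v -> u =ae v -> wpartial i u = wpartial i v.
Proof.
move=> Lu Lv uv; rewrite /wpartial; congr (xget _ _).
apply/seteqP; split=> w [Lw hw]; split => //.
  exact: is_wpartial_ae uv hw.
by apply: is_wpartial_ae hw => //; exact: ae_sym.
Qed.

Definition has_wpartial i u := exists w, tL2 w /\ is_wpartial i u w.

Lemma wpartialP i u : has_wpartial i u -> tL2 (wpartial i u) /\ is_wpartial i u (wpartial i u).
Proof. by move=> h; exact: (xgetPex (cst 0) h). Qed.

Lemma wpartialE i u w : tL2 w -> is_wpartial i u w -> wpartial i u =ae w.
Proof.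
move=> Lw hw; have [L h] : tL2 (wpartial i u) /\ is_wpartial i u (wpartial i u).
  by apply: wpartialP; exists w.
exact: is_wpartial_unique L Lw h hw.
Qed.

Lemma torus_H_L2 k u : torus_H k u -> tL2 u.
Proof. by case: k => [|k] []. Qed.

Lemma torus_HS k i u : torus_H k.+1 u ->
  [/\ has_wpartial i u, torus_H k (wpartial i u), tL2 (wpartial i u) &
      is_wpartial i u (wpartial i u)].
Proof.
move=> [Lu /(_ i)[h h']]; split => //; first exact: (proj1 (wpartialP h)).
exact: (proj2 (wpartialP h)).
Qed.

Lemma torus_H_weak k u : torus_H k.+1 u -> torus_H k u.
Proof.
elim: k u => [|k IH] u [Lu hu]; first by split.
split => // i; have [h h'] := hu i; split => //; exact: IH.
Qed.

Lemma torus_H_ae k u v : tL2 v -> u =ae v -> torus_H k u -> torus_H k v.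
Proof.
case: k => [|k] Lv uv [Lu hu]; first by split.
split => // i; have [[w [Lw hw]] h'] := hu i; split.
  by exists w; split => //; exact: is_wpartial_ae uv hw.
by rewrite -(wpartial_ae i Lu Lv uv).
Qed.

Lemma wpartial_lin i (a : R) u v : tL2 u -> tL2 v -> has_wpartial i u -> has_wpartial i v ->
  has_wpartial i (fun x => a * u x + v x) /\
  wpartial i (fun x => a * u x + v x) =ae (fun x => a * wpartial i u x + wpartial i v x).
Proof.
move=> Lu Lv /wpartialP[Lw hw] /wpartialP[Lw' hw'].
have L := tL2_lin a Lw Lw'; have h := is_wpartial_lin a Lu Lv Lw Lw' hw hw'.
by split; [eexists; split; [exact: L|exact: h]|exact: wpartialE L h].
Qed.

Lemma torus_H_lin k (a : R) u v : torus_H k u -> torus_H k v ->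
  torus_H k (fun x => a * u x + v x).
Proof.
elim: k u v => [|k IH] u v hu hv.
  by split => //; apply: tL2_lin; [exact: torus_H_L2 hu|exact: torus_H_L2 hv].
have Lu := torus_H_L2 hu; have Lv := torus_H_L2 hv.
split => [|i]; first exact: tL2_lin.
have [e1 hu1 L1 _] := torus_HS i hu; have [e2 hv1 L2 _] := torus_HS i hv.
have [h ae] := wpartial_lin a Lu Lv e1 e2; split => //.
apply: torus_H_ae (IH _ _ hu1 hv1); first exact: (proj1 (wpartialP h)).
exact: ae_sym.
Qed.

Lemma torus_L2norm_ge0 u : 0 <= torus_L2norm u.
Proof. exact: nrm_ge0. Qed.

Lemma torus_L2norm_ae u v : tL2 u -> tL2 v -> u =ae v -> torus_L2norm u = torus_L2norm v.
Proof. by move=> [_ Lu] [_ Lv]; exact: ae_nrm. Qed.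

Lemma torus_L2normD u v : tL2 u -> tL2 v ->
  torus_L2norm (fun x => u x + v x) <= torus_L2norm u + torus_L2norm v.
Proof. by move=> [_ Lu] [_ Lv]; exact: (nrmD Lu Lv). Qed.

Lemma torus_L2normZ (a : R) u : tL2 u -> torus_L2norm (fun x => a * u x) = `|a| * torus_L2norm u.
Proof. by move=> [_ Lu]; exact: (nrmZ a Lu). Qed.

Lemma torus_L2norm_mulb u v (M : R) : measurable_fun setT (u \o row) -> tL2 v ->
  (forall x, `|u x| <= M) -> 0 <= M ->
  torus_L2norm (fun x => u x * v x) <= M * torus_L2norm v.
Proof. by move=> mu' [_ Lv] hM M0; exact: (nrm_mulb mu' Lv (fun t => hM (row t)) M0). Qed.

Lemma tL2_mulb u v (M : R) : periodic u -> measurable_fun setT (u \o row) -> tL2 v ->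
  (forall x, `|u x| <= M) -> tL2 (fun x => u x * v x).
Proof.
move=> pu mu' [pv Lv] hM; split; first by move=> i x; rewrite pu pv.
exact: (L2_mulb mu' Lv (fun t => hM (row t))).
Qed.

Lemma torus_Hsqnorm_ge0 k u : 0 <= torus_Hsqnorm k u.
Proof.
elim: k u => [|k IH] u /=; first by rewrite addr0 sqr_ge0.
by rewrite addr_ge0 ?sqr_ge0// sumr_ge0.
Qed.

Lemma torus_Hnorm_ge0 k u : 0 <= torus_Hnorm k u.
Proof. exact: sqrtr_ge0. Qed.

Lemma torus_L2norm_le_Hnorm k u : torus_L2norm u <= torus_Hnorm k u.
Proof.
rewrite -[leLHS]ger0_norm ?torus_L2norm_ge0// -sqrtr_sqr ler_wsqrtr//.
case: k => [|k] /=; first by rewrite addr0.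
by rewrite lerDl sumr_ge0// => i _; exact: torus_Hsqnorm_ge0.
Qed.

Lemma torus_Hnorm_wpartial k i u : torus_Hnorm k (wpartial i u) <= torus_Hnorm k.+1 u.
Proof.
rewrite ler_wsqrtr//= (bigD1 i)//= addrCA lerDl addr_ge0 ?sqr_ge0//.
by rewrite sumr_ge0// => j _; exact: torus_Hsqnorm_ge0.
Qed.

Lemma torus_HZ k (a : R) u : torus_H k u -> torus_H k (fun x => a * u x).
Proof.
move=> hu; have L := torus_H_L2 hu.
have := torus_H_lin (a - 1) hu hu; congr (torus_H k _).
by apply/funext => x; rewrite mulrBl mul1r subrK.
Qed.

Lemma torus_H_D k u v : torus_H k u -> torus_H k v -> torus_H k (fun x => u x + v x).
Proof.
move=> hu hv; have := torus_H_lin 1 hu hv; congr (torus_H k _).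
by apply/funext => x; rewrite mul1r.
Qed.

Lemma torus_H_B k u v : torus_H k u -> torus_H k v -> torus_H k (fun x => u x - v x).
Proof.
move=> hu hv; have := torus_H_lin (-1) hv hu; congr (torus_H k _).
by apply/funext => x; rewrite mulN1r addrC.
Qed.

Lemma wpartialZ k i (a : R) u : torus_H k.+1 u ->
  wpartial i (fun x => a * u x) =ae (fun x => a * wpartial i u x).
Proof.
move=> hu; have L := torus_H_L2 hu; have [h _ _ _] := torus_HS i hu.
have [_] := wpartial_lin (a - 1) L L h h.
have -> : (fun x => (a - 1) * u x + u x) = (fun x => a * u x).
  by apply/funext => x; rewrite mulrBl mul1r subrK.
by apply: ae_imp => t ->; rewrite mulrBl mul1r subrK.
Qed.

Lemma wpartialB k i u v : torus_H k.+1 u -> torus_H k.+1 v ->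
  wpartial i (fun x => u x - v x) =ae (fun x => wpartial i u x - wpartial i v x).
Proof.
move=> hu hv; have Lu := torus_H_L2 hu; have Lv := torus_H_L2 hv.
have [h _ _ _] := torus_HS i hu; have [h' _ _ _] := torus_HS i hv.
have [_] := wpartial_lin (-1) Lv Lu h' h.
have -> : (fun x => -1 * v x + u x) = (fun x => u x - v x).
  by apply/funext => x; rewrite mulN1r addrC.
by apply: ae_imp => t ->; rewrite mulN1r addrC.
Qed.

Lemma torus_Hnorm1Z (a : R) u : torus_H 1 u ->
  torus_Hnorm 1 (fun x => a * u x) = `|a| * torus_Hnorm 1 u.
Proof.
move=> hu; have L := torus_H_L2 hu.
rewrite /torus_Hnorm -(sqrtr_sqr a) -sqrtrM ?sqr_ge0//; congr Num.sqrt.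
rewrite /= torus_L2normZ// exprMn mulrDr real_normK ?num_real//; congr (_ + _).
rewrite mulr_sumr; apply: eq_bigr => i _; rewrite !addr0.
have [_ _ Lw _] := torus_HS i hu; have h' := torus_HZ a hu.
have [_ _ Lw' _] := torus_HS i h'.
rewrite (@torus_L2norm_ae _ (fun x => a * wpartial i u x)) ?torus_L2normZ ?exprMn ?real_normK ?num_real//.
  exact: tL2_Z.
exact: wpartialZ hu.
Qed.

Lemma torus_H_0 k : torus_H k (cst 0 : 'rV[R]_d -> R).
Proof.
have wp i : is_wpartial i (cst 0 : 'rV[R]_d -> R) (cst 0).
  move=> psi tp; have E v : torus_int (cst 0 \* v) = 0.
    rewrite /torus_int /Rintegral (eq_integral (cst 0%E)) ?integral0//.
    by move=> t _; rewrite /= mul0r.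
  by rewrite !E oppr0.
elim: k => [|k IH]; first by split => //; exact: tL2_0.
split => [|i]; first exact: tL2_0.
split; first by exists (cst 0); split; [exact: tL2_0|].
have h := wpartialE tL2_0 (wp i).
apply: torus_H_ae IH; last exact: ae_sym.
apply: (proj1 (wpartialP _)); exists (cst 0); split => //; exact: tL2_0.
Qed.

End WeakPartial.

(** * The dual of H^1 *)

Section DualSpace.
Context {R : realType} {d : nat}.
Implicit Types (u v w : 'rV[R]_d -> R) (i j : 'I_d) (l : ('rV[R]_d -> R) -> R)
  (g : 'I_d -> 'rV[R]_d -> R) (a C : R).
Local Notation row := (@row_of_tuple R d).
Local Notation mu := (cell_measure R d).
Local Notation tL2 := (@torus_L2 R d).
Local Notation "u =ae v" := (\forall t \ae mu, u (row t) = v (row t)) (at level 70).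

Lemma tL2_integrable u v : tL2 u -> tL2 v ->
  mu.-integrable setT (EFin \o (fun t => u (row t) * v (row t))).
Proof. by move=> [_ Lu] [_ Lv]; exact: (L2_integrable Lu Lv). Qed.

Lemma tint_sum (s : seq 'I_d) g g' : (forall i, tL2 (g i)) -> (forall i, tL2 (g' i)) ->
  mu.-integrable setT (EFin \o (fun t => \sum_(i <- s) g i (row t) * g' i (row t))) /\
  torus_int (fun x => \sum_(i <- s) g i x * g' i x) =
  \sum_(i <- s) torus_int (fun x => g i x * g' i x).
Proof.
move=> Lg Lg'; elim: s => [|i s [I1 I2]].
  have -> : (fun x : 'rV[R]_d => \sum_(i <- [::]) g i x * g' i x) = cst 0.
    by apply/funext => x; rewrite big_nil.
  rewrite big_nil; split.
    have -> : (fun t : d.-tuple R => \sum_(i <- [::]) g i (row t) * g' i (row t)) = cst 0.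
      by apply/funext => x; rewrite big_nil.
    exact: integrable0.
  by rewrite /torus_int /Rintegral integral0.
have I := tL2_integrable (Lg i) (Lg' i).
have E (x : 'rV[R]_d) : \sum_(i <- i :: s) g i x * g' i x =
    1 * (g i x * g' i x) + \sum_(i <- s) g i x * g' i x by rewrite big_cons mul1r.
split.
  have := integrableD measurableT I I1; apply: eq_integrable => // t _ /=.
  by rewrite E mul1r.
rewrite big_cons -I2 -[X in X + _]mul1r /torus_int -(Rint_lin 1 I I1).
by apply: eq_Rintegral => t _; exact: E.
Qed.

Lemma wdivE g v : (forall i, tL2 (g i)) -> torus_H 1 v ->
  wdiv g v = - \sum_(i < d) torus_int (fun x => g i x * wpartial i v x).
Proof.
move=> Lg hv; rewrite /wdiv (proj2 (tint_sum (index_enum _) Lg _))//.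
by move=> i; have [] := torus_HS i hv.
Qed.

Lemma wdiv_bound g v : (forall i, tL2 (g i)) -> torus_H 1 v ->
  `|wdiv g v| <= (\sum_(i < d) torus_L2norm (g i)) * torus_Hnorm 1 v.
Proof.
move=> Lg hv; rewrite wdivE// normrN mulr_suml.
apply: le_trans (ler_norm_sum _ _ _) _; apply: ler_sum => i _.
have [_ _ Lw _] := torus_HS i hv.
apply: le_trans (tint_CS (Lg i) Lw) _; rewrite ler_wpM2l ?torus_L2norm_ge0//.
apply: le_trans (torus_L2norm_le_Hnorm 0 _) _; exact: torus_Hnorm_wpartial.
Qed.

Lemma wdiv_linr g a u v : (forall i, tL2 (g i)) -> torus_H 1 u -> torus_H 1 v ->
  wdiv g (fun x => a * u x + v x) = a * wdiv g u + wdiv g v.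
Proof.
move=> Lg hu hv; have huv := torus_H_lin a hu hv.
rewrite !wdivE// mulrN -opprD; congr (- _).
rewrite mulr_sumr -big_split; apply: eq_bigr => i _ /=.
have Lu := torus_H_L2 hu; have Lv := torus_H_L2 hv.
have [h _ L _] := torus_HS i hu; have [h' _ L' _] := torus_HS i hv.
have [_ _ L'' _] := torus_HS i huv.
have [_ ae] := wpartial_lin a Lu Lv h h'.
rewrite !(tintC (g i)) -tint_lin//; apply: tint_ae => //; exact: tL2_lin.
Qed.

Lemma wdiv_linl g g' a v : (forall i, tL2 (g i)) -> (forall i, tL2 (g' i)) -> torus_H 1 v ->
  wdiv (fun i x => a * g i x + g' i x) v = a * wdiv g v + wdiv g' v.
Proof.
move=> Lg Lg' hv; rewrite !wdivE//; last by move=> i; exact: tL2_lin.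
rewrite mulrN -opprD; congr (- _).
rewrite mulr_sumr -big_split; apply: eq_bigr => i _ /=.
by have [_ _ L _] := torus_HS i hv; exact: tint_lin.
Qed.

Lemma wdiv_ae g g' v : (forall i, tL2 (g i)) -> (forall i, tL2 (g' i)) -> torus_H 1 v ->
  (forall i, g i =ae g' i) -> wdiv g v = wdiv g' v.
Proof.
move=> Lg Lg' hv gg; rewrite !wdivE//; congr (- _); apply: eq_bigr => i _.
by have [_ _ L _] := torus_HS i hv; apply: tint_ae.
Qed.

Lemma Hm1_wdiv g : (forall i, tL2 (g i)) -> Hm1 (wdiv g).
Proof.
move=> Lg; split; first by move=> a u v hu hv; exact: wdiv_linr.
by exists (\sum_(i < d) torus_L2norm (g i)) => v hv; exact: wdiv_bound.
Qed.

Lemma Hm1_lin a l l' : Hm1 l -> Hm1 l' -> Hm1 (fun v => a * l v + l' v).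
Proof.
move=> [h1 [C hC]] [h1' [C' hC']]; split.
  by move=> k u v hu hv; rewrite h1// h1'//; ring.
exists (`|a| * C + C') => v hv; apply: le_trans (ler_normD _ _) _.
by rewrite normrM mulrDl -mulrA lerD ?ler_wpM2l ?hC ?hC'.
Qed.

Lemma Hm1_D l l' : Hm1 l -> Hm1 l' -> Hm1 (l \+ l').
Proof.
move=> h h'; have := Hm1_lin 1 h h'; congr (Hm1 _).
by apply/funext => v; rewrite mul1r.
Qed.

Lemma Hm1_B l l' : Hm1 l -> Hm1 l' -> Hm1 (l \- l').
Proof.
move=> h h'; have := Hm1_lin (-1) h' h; congr (Hm1 _).
by apply/funext => v; rewrite mulN1r addrC.
Qed.

Lemma Hm1_Z a l : Hm1 l -> Hm1 (a \*o l).
Proof.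
move=> h; have := Hm1_lin (a - 1) h h; congr (Hm1 _).
by apply/funext => v; rewrite mulrBl mul1r subrK.
Qed.

Lemma torus_Hnorm1_0 : torus_Hnorm 1 (cst 0 : 'rV[R]_d -> R) = 0.
Proof.
have := @torus_Hnorm1Z R d 0 _ (torus_H_0 1); rewrite normr0 mul0r => h.
by rewrite -[RHS]h; congr (torus_Hnorm 1 _); apply/funext => x; rewrite mul0r.
Qed.

Lemma Hm1_0 l : Hm1 l -> l (cst 0) = 0.
Proof.
move=> [_ [C hC]]; have := hC _ (torus_H_0 1).
by rewrite torus_Hnorm1_0 mulr0 normr_le0 => /eqP.
Qed.

Lemma Hm1normZ a l v : Hm1 l -> torus_H 1 v -> l (fun x => a * v x) = a * l v.
Proof.
move=> hl hv; have [lin _] := hl.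
have := lin a v (cst 0) hv (torus_H_0 1); rewrite (Hm1_0 hl) addr0 => <-.
by congr l; apply/funext => x /=; rewrite addr0.
Qed.

Let dset l := [set r | exists v, [/\ torus_H 1 v, torus_Hnorm 1 v <= 1 & r = `|l v|]].

Lemma dset_neq0 l : dset l !=set0.
Proof.
exists `|l (cst 0)|, (cst 0); split => //; first exact: torus_H_0.
by rewrite torus_Hnorm1_0.
Qed.

Lemma Hm1norm_le C l : 0 <= C -> (forall v, torus_H 1 v -> `|l v| <= C * torus_Hnorm 1 v) ->
  Hm1norm l <= C.
Proof.
move=> C0 hC; apply: ge_sup; first exact: dset_neq0.
move=> _ [v [hv v1 ->]]; apply: le_trans (hC v hv) _.
by rewrite ler_piMr.
Qed.

Lemma dset_sup l : Hm1 l -> has_sup (dset l).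
Proof.
move=> [_ [C hC]]; split; first exact: dset_neq0.
exists `|C| => _ [v [hv v1 ->]]; apply: le_trans (hC v hv) _.
apply: le_trans (ler_norm _) _; rewrite normrM ler_piMr//.
by rewrite ger0_norm ?torus_Hnorm_ge0.
Qed.

Lemma Hm1norm_bound l v : Hm1 l -> torus_H 1 v -> `|l v| <= Hm1norm l * torus_Hnorm 1 v.
Proof.
move=> hl hv; have [_ [C hC]] := hl.
(* A test function of norm zero cannot be normalized; there boundedness with the constant [C] gives
   [l v = 0]. *)
have [N0|N0] := eqVneq (torus_Hnorm 1 v) 0.
  by have := hC v hv; rewrite N0 !mulr0.
have Np : 0 < torus_Hnorm 1 v by rewrite lt_neqAle eq_sym N0 torus_Hnorm_ge0.
have : `|l (fun x => (torus_Hnorm 1 v)^-1 * v x)| <= Hm1norm l.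
  apply: ub_le_sup; first by have [] := dset_sup hl.
  exists (fun x => (torus_Hnorm 1 v)^-1 * v x); split; [exact: torus_HZ hv| |by []].
  by rewrite torus_Hnorm1Z// ger0_norm ?invr_ge0 ?torus_Hnorm_ge0// mulVf.
rewrite Hm1normZ// normrM ger0_norm ?invr_ge0 ?torus_Hnorm_ge0//.
by rewrite mulrC ler_pdivrMr.
Qed.

Lemma Hm1norm_ge0 l : Hm1 l -> 0 <= Hm1norm l.
Proof.
move=> hl; apply: le_trans (_ : `|l (cst 0)| <= _) => //.
apply: ub_le_sup; first by have [] := dset_sup hl.
exists (cst 0); split => //; first exact: torus_H_0.
by rewrite torus_Hnorm1_0.
Qed.

Lemma Hm1norm_eq0 l l' : Hm1 l -> Hm1 l' -> Hm1norm (l \- l') = 0 -> Hm1_eq l l'.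
Proof.
move=> hl hl' h v hv; have := Hm1norm_bound (Hm1_B hl hl') hv.
by rewrite h mul0r normr_le0 subr_eq0 => /eqP.
Qed.

Lemma Hm1_eq_norm l l' : Hm1_eq l l' -> Hm1norm (l \- l') <= 0.
Proof. by move=> h; apply: Hm1norm_le => // v hv /=; rewrite h// subrr normr0 mul0r. Qed.

End DualSpace.

(** * Sobolev embedding *)

Section Kernel.
Context {R : realType}.
Implicit Types (f F : R -> R) (s r : R).

Lemma periodic1_int f s (z : int) : (forall s, f (s + 1) = f s) -> f (s + z%:~R) = f s.
Proof.
move=> pf; have h (n : nat) r : f (r + n%:R) = f r.
  elim: n => [|n IH]; first by rewrite addr0.
  by rewrite -natr1 addrA pf.
case: (intP z) => [|n|n]; first by rewrite addr0.
  exact: h.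
by rewrite mulrNz -[in RHS](subrK (n.+1%:R) s) h.
Qed.

Lemma frac01 s : 0 <= s - (Num.floor s)%:~R < 1.
Proof.
by rewrite subr_ge0 ge_floor/= ltrBlDl; have := lt_succ_floor s; rewrite intrD addrC.
Qed.

Lemma derive_ge0_mono f F (a b : R) : (forall s, is_derive s 1 F (f s)) -> (forall s, 0 <= f s) ->
  a <= b -> F a <= F b.
Proof.
move=> dF f0 ab.
have cF : continuous F by move=> s; exact: is_derive_continuous (dF s).
have [c _] := MVT_segment ab (fun x _ => dF x) (cont_within cF).
by move=> h; rewrite -subr_ge0 h mulr_ge0// subr_ge0.
Qed.

(* Testing against K - 1 costs one weak derivative, since K - 1 has the bounded periodic primitive k. *)
Lemma periodic_kernel (eta : R) : 0 < eta -> eta <= 1 / 2 -> exists (K k : R -> R),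
  [/\ smooth K, smooth k, (forall s, is_derive s 1 k (K s - 1)),
      (forall s, K (s + 1) = K s) /\ (forall s, k (s + 1) = k s) &
      forall s, [/\ `|k s| <= 1, 0 <= K s & K s != 0 -> exists z : int, `|s - z%:~R| < eta]].
Proof.
move=> eta0 eta1.
pose B s := en 0 (arc eta eta s).
have sB : smooth B by exact (smooth_comp (@smooth_en R 0) (@smooth_arc R eta eta)).
have pB s : B (s + 1) = B s by rewrite /B arc_periodic.
have B0 s : 0 <= B s by exact: en_ge0.
have [F dF] := antiderivative (smooth_continuous sB).
have sF : smooth F by exact (smoothS dF sB).
have cF := smooth_continuous sF.
pose J := F 1 - F 0.
have J0 : 0 < J.
  have [c] := MVT eta0 (fun x _ => dF x) (cont_within cF).
  rewrite in_itv/= subr0 => /andP[c0 ce] E.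
  have : 0 < F eta - F 0.
    rewrite E mulr_gt0// en0_gt0; apply: arc_gt0; lra.
  have : F eta <= F 1 by apply: (derive_ge0_mono dF B0); lra.
  rewrite /J; lra.
pose K s := J^-1 * B s; pose k s := J^-1 * (F s - F 0) - s.
have dk s : is_derive s 1 k (K s - 1).
  have h1 := is_deriveB (dF s) (is_derive_cst (F 0) s 1).
  have h := is_deriveB (is_deriveZ J^-1 h1) (is_derive_id s 1).
  by apply: (is_derive_eq h); rewrite /K /GRing.scale /= subr0.
have sK : smooth K by exact (@smoothZ R J^-1 B sB).
have sk : smooth k by exact (smoothS dk (smoothB sK (@smooth_cst R 1))).
have pK s : K (s + 1) = K s by rewrite /K pB.
(* The normalized primitive of [K] gains 1 over each period, which subtracting [s] cancels. *)
have pk s : k (s + 1) = k s.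
  have d1 (r : R) : is_derive r 1 (fun r => k (r + 1) - k r) 0.
    have hs : is_derive r 1 (fun r : R => r + 1) (1 : R).
      have h := is_deriveD (is_derive_id r 1) (is_derive_cst (1 : R) r 1).
      by apply: (is_derive_eq h); rewrite addr0.
    have h := is_deriveB (@is_derive1_comp R k (fun r => r + 1) r (K (r + 1) - 1) 1 (dk (r + 1)) hs) (dk r).
    by apply: (is_derive_eq h); rewrite /GRing.scale /= mulr1 pK subrr.
  have := is_derive_0_is_cst s 0 d1; rewrite add0r /k subrr mulr0 subr0.
  by rewrite -/J mulVf ?gt_eqF// subrr sub0r oppr0 => /eqP; rewrite subr_eq0 => /eqP.
exists K, k; split => // s; split.
(* On one period the normalized primitive and [r] both lie between 0 and 1, so their difference is
   at most 1 in modulus whatever [eta] is. *)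
- rewrite -[s](subrK (Num.floor s)%:~R) periodic1_int//.
  have /andP[r0 r1] := frac01 s; move: (s - _) r0 r1 => r r0 r1.
  have h0 : 0 <= J^-1 * (F r - F 0).
    by rewrite mulr_ge0 ?invr_ge0 ?(ltW J0)// subr_ge0; exact: (derive_ge0_mono dF B0).
  have h1 : J^-1 * (F r - F 0) <= 1.
    rewrite mulrC ler_pdivrMr// mul1r lerB//; apply: (derive_ge0_mono dF B0); exact: ltW.
  by rewrite /k ler_norml; move: (J^-1 * _) h0 h1 => c; lra.
- by rewrite /K mulr_ge0// invr_ge0 ltW.
- rewrite /K mulf_eq0 negb_or => /andP[_ hB].
  have : 0 < arc eta eta s by rewrite -en0_gt0 lt_neqAle eq_sym hB B0.
  rewrite -[s](subrK (Num.floor s)%:~R) periodic1_int; last exact: arc_periodic.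
  have /andP[r0 r1] := frac01 s; move: (s - _) r0 r1 => r r0 r1 ha.
  have [re|re] := ltP r eta.
    exists (Num.floor s); rewrite addrK ger0_norm//.
  have [re'|re'] := ltP (1 - eta) r.
    exists (Num.floor s + 1); rewrite intrD opprD addrA addrK ltr0_norm; lra.
  have : arc eta eta r <= 0 by apply: arc_le0; lra.
  by rewrite leNgt ha.
Qed.

End Kernel.

Section Sobolev.
Context {R : realType} {d : nat}.
Implicit Types (u v w psi th : 'rV[R]_d -> R) (i j : 'I_d) (x y : 'rV[R]_d) (t : d.-tuple R)
  (k : nat).
Local Notation row := (@row_of_tuple R d).
Local Notation mu := (cell_measure R d).
Local Notation test := (@torus_test R d).
Local Notation tL2 := (@torus_L2 R d).
Local Notation periodic := (@Defs.periodic R d).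
Local Notation e i := (delta_mx 0 i : 'rV[R]_d).

Lemma derive_seq_cvg u x (v : 'rV[R]_d) (df : R) (h : nat -> R) : is_derive x v u df ->
  (forall n, h n != 0) -> h n @[n --> \oo] --> (0 : R) ->
  (h n)^-1 * (u (x + h n *: v) - u x) @[n --> \oo] --> df.
Proof.
move=> [du <-] h0 hc; rewrite /derive.
have /cvgr_dnbhsP/(_ h) : (fun h : R => h^-1 *: ((u \o shift x) (h *: v) - u x)) @ 0^' -->
    lim ((fun h : R => h^-1 *: ((u \o shift x) (h *: v) - u x)) @ 0^') by exact: du.
move=> /(_ (conj h0 hc)).
by under eq_fun => n do rewrite /= [h n *: v + x]addrC.
Qed.

Lemma tint_cst (c : R) : torus_int (cst c : 'rV[R]_d -> R) = c.
Proof. exact: (congr1 fine (prob_cst mu c%:E)). Qed.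

Lemma torus_L2norm1 : torus_L2norm (cst 1 : 'rV[R]_d -> R) = 1.
Proof.
have := nrm_sqr (proj2 (tL2_test (@torus_test_cst R d 1))).
have -> : \int[mu]_t ((cst 1 \o row) t * (cst 1 \o row) t) = torus_int (cst 1 : 'rV[R]_d -> R).
  by apply: eq_Rintegral => t _ /=; rewrite mulr1.
rewrite tint_cst -/(torus_L2norm _) => /eqP; rewrite sqrf_eq1 => /orP[/eqP//|/eqP h].
by have := torus_L2norm_ge0 (cst 1 : 'rV[R]_d -> R); rewrite h; lra.
Qed.

Lemma torus_HnormS n u : torus_Hnorm n u <= torus_Hnorm n.+1 u.
Proof.
rewrite ler_wsqrtr//; elim: n u => [|n IH] u; rewrite [leRHS]/= [leLHS]/=.
  by rewrite lerD2l sumr_ge0// => i _; exact: (torus_Hsqnorm_ge0 0).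
by rewrite lerD2l; apply: ler_sum => i _; exact: IH.
Qed.

Lemma torus_H_leq m n u : (m <= n)%N -> torus_H n u -> torus_H m u.
Proof.
move=> /subnKC <-; elim: (n - m)%N => [|k IH]; first by rewrite addn0.
by rewrite addnS => h; apply: IH; exact: torus_H_weak h.
Qed.

Lemma torus_Hnorm_leq m n u : (m <= n)%N -> torus_Hnorm m u <= torus_Hnorm n u.
Proof.
move=> /subnKC <-; elim: (n - m)%N => [|k IH]; first by rewrite addn0.
by rewrite addnS; apply: le_trans IH (torus_HnormS _ _).
Qed.

Lemma tint_lin1 (a : R) u v : tL2 u -> tL2 v ->
  torus_int (fun x => a * u x + v x) = a * torus_int u + torus_int v.
Proof. by move=> Lu Lv; exact: (Rint_lin a (tL2_integrable1 Lu) (tL2_integrable1 Lv)). Qed.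

(** Difference quotients have integral zero by shift invariance and converge boundedly to the
    derivative. *)
Lemma tint_derive0 psi i : test psi -> torus_int ('D_(e i) psi) = 0.
Proof.
move=> tp; have [M M0 hM] := periodic_bounded (proj1 (torus_test_derive i tp)) (torus_test_cont (torus_test_derive i tp)).
pose h (n : nat) : R := n.+1%:R^-1.
pose F (n : nat) t := (h n)^-1 * (psi (row t + h n *: e i) - psi (row t)).
have h0 n : 0 < h n by rewrite invr_gt0 ltr0n.
have mp := tL2_meas (tL2_test tp).
have mps n := measurable_trans i (h n) mp.
have mF n : measurable_fun setT (F n).
  by apply: measurable_funM => //; apply: measurable_funB.
have dline x (r : R) : is_derive r 1 (fun r : R => psi (x + r *: e i)) ('D_(e i) psi (x + r *: e i)).
  by apply/is_derive_line; exact: torus_test_is_derive.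
have bF n t : setT t -> `|F n t| <= M.
  move=> _; rewrite /F normrM ger0_norm ?invr_ge0 ?(ltW (h0 n))// mulrC ler_pdivrMr//.
  have cl : continuous (fun r : R => psi (row t + r *: e i)).
    by move=> r; exact: is_derive_continuous (dline (row t) r).
  have [c _] := MVT (h0 n) (fun r _ => dline (row t) r) (cont_within cl).
  rewrite scale0r addr0 subr0 => ->; rewrite normrM (ger0_norm (ltW (h0 n))).
  by rewrite ler_wpM2r ?(ltW (h0 n)).
have cF t : F n t @[n --> \oo] --> 'D_(e i) psi (row t).
  apply: derive_seq_cvg; [exact: torus_test_is_derive|by move=> n; rewrite gt_eqF|exact: cvg_harmonic].
have cst_int : mu.-integrable setT (EFin \o cst M).
  exact: (tL2_integrable1 (tL2_test (@torus_test_cst R d M))).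
have lim := @dominated_cvgR _ _ _ mu setT F ('D_(e i) psi \o row) (cst M) measurableT mF
  (tL2_meas (tL2_test (torus_test_derive i tp))) (aeW _ (fun t _ => cF t)) cst_int bF.
have E n : \int[mu]_t F n t = 0.
  have ts := torus_test_trans (h n *: e i) tp.
  have -> : \int[mu]_t F n t =
      torus_int (fun x => (h n)^-1 * psi (x + h n *: e i) + - (h n)^-1 * psi x).
    by apply: eq_Rintegral => t _; rewrite /F; ring.
  rewrite tint_lin1; last 2 first.
    exact: tL2_test ts.
    exact: tL2_Z (tL2_test tp).
  rewrite torus_int_shift//; last exact: (proj1 tp).
  have En : torus_int (fun x => - (h n)^-1 * psi x) = - (h n)^-1 * torus_int psi + torus_int (cst 0 : 'rV[R]_d -> R).
    rewrite -tint_lin1; [|exact: tL2_test tp|exact: tL2_0].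
    by apply: eq_Rintegral => t _ /=; rewrite addr0.
  by rewrite En tint_cst addr0 mulNr subrr.
have {}lim : (0 : R) @[m --> \oo] --> torus_int ('D_(e i) psi).
  by apply: cvg_trans lim; apply: near_eq_cvg; apply: nearW => m; rewrite E.
exact: (cvg_unique _ lim (cvg_cst 0)).
Qed.

Lemma tintZ (a : R) u : tL2 u -> torus_int (fun x => a * u x) = a * torus_int u.
Proof.
move=> Lu; have := tint_lin1 a Lu (@tL2_0 R d); rewrite tint_cst addr0 => <-.
by apply: eq_Rintegral => t _ /=; rewrite addr0.
Qed.

Lemma tint_le u v : tL2 u -> tL2 v -> (forall x, u x <= v x) -> torus_int u <= torus_int v.
Proof.
move=> Lu Lv uv; apply: le_Rintegral => //; by [exact: tL2_integrable1|move=> t _; exact: uv].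
Qed.

Lemma cont_coordwise u x (eps : R) : continuous u -> 0 < eps ->
  exists2 eta, 0 < eta & forall y, (forall i, `|y 0 i - x 0 i| < eta) -> `|u y - u x| <= eps.
Proof.
move=> cu eps0; have /cvgrPdist_le/(_ _ eps0) := cu x.
move=> /nbhs_normP[r /= r0 hr]; exists r => // y hy.
rewrite distrC; apply: hr => /=.
rewrite /Num.norm /= mx_normrE; apply/bigmax_ltP; split => // -[i j] _ /=.
by rewrite !mxE distrC (ord1 i).
Qed.

Definition inv_along i u := forall x (r : R), u (x + r *: e i) = u x.

(* Moving one coordinate kernel at a time onto u costs at most one derivative per coordinate. *)
Section OneKernel.
Variables (K k : 'I_d -> R -> R).
Hypothesis sK : forall i, smooth (K i).
Hypothesis sk : forall i, smooth (k i).
Hypothesis dk : forall i (s : R), is_derive s 1 (k i) (K i s - 1).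
Hypothesis pK : forall i s, K i (s + 1) = K i s.
Hypothesis pk : forall i s, k i (s + 1) = k i s.
Hypothesis k1 : forall i s, `|k i s| <= 1.

Let P (s : seq 'I_d) y := \prod_(i <- s) K i (y 0 i).

Let tP s : test (P s). Proof. exact: torus_test_prod. Qed.

Let P_inv s i : i \notin s -> inv_along i (P s).
Proof.
move=> si x r; rewrite /P; apply: eq_big_seq => j js.
rewrite coord_add_e; case: eqP => [ji|_]; last by rewrite mulr0 addr0.
by move: js si; rewrite ji => ->.
Qed.

(** Neither [th] nor [P s] depends on the coordinate [i], so multiplying them by K_i - 1, the
    derivative of k_i, produces an exact partial derivative. *)
Let split_kernel th i s : test th -> inv_along i th -> i \notin s ->
  let psi := fun x => (th x * P s x) * k i (x 0 i) in
  test psi /\ forall x, th x * P (i :: s) x = th x * P s x + 'D_(e i) psi x.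
Proof.
move=> tt it si psi; have tp : test psi.
  by apply: torus_test_mul; [exact: torus_test_mul|exact: torus_test_coord].
split => // x.
have d1 : is_derive x (e i) (fun x => th x * P s x) 0.
  apply/is_derive_line0.
  have -> : (fun r : R => th (x + r *: e i) * P s (x + r *: e i)) = cst (th x * P s x).
    by apply/funext => r /=; rewrite it P_inv.
  exact: is_derive_cst.
have d2 := @coord_derive R d (k i) (K i (x 0 i) - 1) x i i (dk i (x 0 i)).
have h := is_deriveM d1 d2.
rewrite (@derive_val _ _ _ _ _ _ _ h) /GRing.scale /= mulr0 addr0 eqxx mulr1.
by rewrite {1}/P big_cons -/(P s x); ring.
Qed.

Lemma kernel_int1 s : uniq s -> torus_int (P s) = 1.
Proof.
elim: s => [_|i s IH /= /andP[si us]].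
  have -> : P [::] = cst 1 by apply/funext => x; rewrite /P big_nil.
  exact: tint_cst.
have [tp E] := @split_kernel (cst 1) i s (torus_test_cst 1) (fun _ _ => erefl) si.
have -> : P (i :: s) = (fun x => 1 * P s x + 'D_(e i) (fun x => (cst 1 x * P s x) * k i (x 0 i)) x).
  by apply/funext => x; rewrite -E /= mul1r.
rewrite tint_lin1; [|exact: tL2_test (tP s)|exact: tL2_test (torus_test_derive i tp)].
by rewrite IH// mul1r tint_derive0// addr0.
Qed.

(** The factor [th] collects the bounded primitives left behind by integrations by parts. Each
    coordinate splits the integral in two, one term without its kernel and one with a derivative
    moved onto [u]; this doubles the constant and raises the order by one. *)
Lemma kernel_bound s u th : uniq s -> torus_H (size s) u -> test th -> (forall x, `|th x| <= 1) ->
  (forall i, i \in s -> inv_along i th) ->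
  `|torus_int (fun x => u x * (th x * P s x))| <= 2 ^+ size s * torus_Hnorm (size s) u.
Proof.
elim: s u th => [|i s IH] u th us hu tt th1 it.
  have -> : P [::] = cst 1 by apply/funext => x; rewrite /P big_nil.
  have -> : (fun x => u x * (th x * cst 1 x)) = (fun x => u x * th x).
    by apply/funext => x; rewrite /= mulr1.
  rewrite expr0 mul1r; apply: le_trans (tint_CS (torus_H_L2 hu) (tL2_test tt)) _.
  apply: le_trans (torus_L2norm_le_Hnorm 0 u); rewrite ler_piMr ?torus_L2norm_ge0//.
  have := @torus_L2norm_mulb R d th (cst 1) 1 (tL2_meas (tL2_test tt)) (tL2_test (torus_test_cst 1)) th1 ler01.
  rewrite torus_L2norm1 mulr1; congr (torus_L2norm _ <= _).
  by apply/funext => x; rewrite mulr1.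
move: us => /= /andP[si us].
have Lu := torus_H_L2 hu; have [_ hu' Lw hw] := torus_HS i hu.
have [tp E] := @split_kernel th i s tt (it i (mem_head _ _)) si.
set psi := (fun x => (th x * P s x) * k i (x 0 i)) in tp E.
have -> : torus_int (fun x => u x * (th x * P (i :: s) x)) =
    torus_int (fun x => u x * (th x * P s x)) - torus_int (fun x => wpartial i u x * ((th x * k i (x 0 i)) * P s x)).
  have -> : torus_int (fun x => wpartial i u x * ((th x * k i (x 0 i)) * P s x)) =
      torus_int (wpartial i u \* psi).
    by apply: eq_Rintegral => t _; rewrite /psi /=; ring.
  rewrite -[X in - X]opprK -(hw psi tp) opprK.
  have -> : torus_int (fun x => u x * (th x * P (i :: s) x)) =
      torus_int (fun x => (1 * (th x * P s x) + 'D_(e i) psi x) * u x).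
    by apply: eq_Rintegral => t _; rewrite E mul1r mulrC.
  rewrite tint_lin//; last 2 first.
  - by apply: tL2_test; exact: torus_test_mul.
  - exact: tL2_test (torus_test_derive i tp).
  by rewrite mul1r !(tintC u).
apply: le_trans (ler_normB _ _) _.
have its j : j \in s -> inv_along j th by move=> js; apply: it; rewrite inE js orbT.
have b1 := IH u th us (torus_H_weak hu) tt th1 its.
have b2 : `|torus_int (fun x => wpartial i u x * ((th x * k i (x 0 i)) * P s x))| <=
    2 ^+ size s * torus_Hnorm (size s) (wpartial i u).
  apply: IH => //.
  - by apply: torus_test_mul => //; exact: torus_test_coord.
  - by move=> x; rewrite normrM mulr_ile1.
  - move=> j js x r; rewrite it ?inE ?js ?orbT//; congr (_ * k i _).
    rewrite coord_add_e; case: eqP => [ij|_]; last by rewrite mulr0 addr0.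
    by move: js si; rewrite ij => ->.
have n1 : torus_Hnorm (size s) u <= torus_Hnorm (size s).+1 u by exact: torus_HnormS.
have n2 := torus_Hnorm_wpartial (size s) i u.
rewrite exprS.
have p2 : 0 <= 2 ^+ size s :> R by rewrite exprn_ge0.
apply: le_trans (lerD b1 b2) _; rewrite -mulrDr -mulrA mulrCA ler_wpM2l//.
by rewrite mulr_natl mulr2n lerD.
Qed.

End OneKernel.

(** The kernel bound does not depend on the width [eta], while testing against a narrow kernel
    product recovers [u x] up to [eps]. At most three coordinates give the third power of 2. *)
Lemma Sobolev u x : (d <= 3)%N -> continuous u -> torus_H 3 u -> `|u x| <= 8 * torus_Hnorm 3 u.
Proof.
move=> d3 cu hu; apply/ler_addgt0Pl => eps eps0.
have pu : periodic u := proj1 (torus_H_L2 hu).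
have [eta' eta'0 heta'] := cont_coordwise x cu eps0.
pose eta := Num.min eta' (1 / 2).
have eta0 : 0 < eta by rewrite lt_min eta'0/=; lra.
have eta1 : eta <= 1 / 2 by rewrite ge_min lexx orbT.
have heta y : (forall i, `|y 0 i - x 0 i| < eta) -> `|u y - u x| <= eps.
  by move=> h; apply: heta' => i; apply: lt_le_trans (h i) _; rewrite ge_min lexx.
have [K [k [sK sk dk [pK pk] hk]]] := periodic_kernel eta0 eta1.
pose Kx i (s : R) := K (s - x 0 i); pose kx i (s : R) := k (s - x 0 i).
have sKx i : smooth (Kx i) by exact (@smooth_shift R K (x 0 i) sK).
have skx i : smooth (kx i) by exact (@smooth_shift R k (x 0 i) sk).
have dkx i (s : R) : is_derive s 1 (kx i) (Kx i s - 1).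
  have hs : is_derive s 1 (fun r : R => r - x 0 i) (1 : R).
    have h := is_deriveB (is_derive_id s 1) (is_derive_cst (x 0 i) s 1).
    by apply: (is_derive_eq h); rewrite subr0.
  have h := @is_derive1_comp R k (fun r => r - x 0 i) s (K (s - x 0 i) - 1) 1 (dk _) hs.
  by apply: (is_derive_eq h); rewrite /GRing.scale /= mulr1.
have pKx i (s : R) : Kx i (s + 1) = Kx i s by rewrite /Kx addrAC pK.
have pkx i (s : R) : kx i (s + 1) = kx i s by rewrite /kx addrAC pk.
have kx1 i (s : R) : `|kx i s| <= 1 by have [] := hk (s - x 0 i).
pose l := enum 'I_d.
have ul : uniq l by exact: enum_uniq.
have sl : size l = d by rewrite size_enum_ord.
pose P y := \prod_(i <- l) Kx i (y 0 i).
have tP : test P by exact: torus_test_prod.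
have P0 y : 0 <= P y.
  by rewrite /P prodr_ge0// => i _; have [] := hk (y 0 i - x 0 i).
have IP : torus_int P = 1 by exact: (kernel_int1 sKx skx dkx pKx pkx).
(* On the support of [P] each coordinate of [y] is close to that of [x] modulo an integer;
   periodicity of [u] removes the integers. *)
have supp y : P y != 0 -> `|u y - u x| <= eps.
  rewrite /P => Py; have hz i : exists z : int, `|y 0 i - x 0 i - z%:~R| < eta.
    have [_ _ h] := hk (y 0 i - x 0 i); apply: h.
    apply: contraNneq Py => h; rewrite (bigD1_seq i)//= ?mem_enum// /Kx h mul0r//.
  pose z i := xget 0 [set z : int | `|y 0 i - x 0 i - z%:~R| < eta].
  have hz' i : `|y 0 i - x 0 i - (z i)%:~R| < eta by exact: (xgetPex 0 (hz i)).
  rewrite -(periodic_row y (fun i => - z i) pu); apply: heta => i.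
  by rewrite !mxE mulrNz addrAC.
have hd : torus_H d u by exact: torus_H_leq hu.
have bnd : `|torus_int (fun y => u y * P y)| <= 8 * torus_Hnorm 3 u.
  have := @kernel_bound Kx kx sKx skx dkx pKx pkx kx1 l u (cst 1) ul.
  rewrite sl => /(_ hd (torus_test_cst 1)) h.
  have -> : torus_int (fun y => u y * P y) = torus_int (fun y => u y * (cst 1 y * P y)).
    by apply: eq_Rintegral => t _ /=; rewrite mul1r.
  apply: le_trans (h _ _) _.
  - by move=> y; rewrite normr1.
  - by [].
  apply: ler_pM; rewrite ?exprn_ge0 ?torus_Hnorm_ge0//; last exact: torus_Hnorm_leq.
  by case: (d) d3 => [|[|[|[|]]]]//= _; rewrite ?expr0 ?expr1 ?exprS; lra.
have Lu := torus_H_L2 hu; have LP := tL2_test tP.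
have LuP : tL2 (fun y => u y * P y).
  have [M _ hM] := periodic_bounded (proj1 tP) (torus_test_cont tP).
  have := tL2_mulb (proj1 tP) (tL2_meas LP) Lu hM.
  by congr (tL2 _); apply/funext => y; rewrite mulrC.
have dev y : (u x - eps) * P y <= u y * P y <= (u x + eps) * P y.
  have [->|/supp] := eqVneq (P y) 0; first by rewrite !mulr0 lexx.
  by rewrite ler_norml => /andP[h1 h2]; rewrite !ler_wpM2r//; lra.
have IZ c : torus_int (fun y => c * P y) = c by rewrite tintZ// IP mulr1.
have LZ c : tL2 (fun y => c * P y) by exact: tL2_Z.
have up : torus_int (fun y => u y * P y) <= u x + eps.
  by rewrite -[leRHS]IZ; apply: tint_le => // y; have /andP[] := dev y.
have lo : u x - eps <= torus_int (fun y => u y * P y).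
  by rewrite -[leLHS]IZ; apply: tint_le => // y; have /andP[] := dev y.
by move: bnd up lo; set I := torus_int _; rewrite !ler_norml; lra.
Qed.

End Sobolev.

(** * The chain rule *)

Section RealFubini.
Context d1 d2 (T1 : measurableType d1) (T2 : measurableType d2) (R : realType).
Variable m1 : {sigma_finite_measure set T1 -> \bar R}.
Variable m2 : {sigma_finite_measure set T2 -> \bar R}.
Variable P : T1 * T2 -> R.
Hypothesis iP : (m1 \x m2)%E.-integrable setT (EFin \o P).

(** Inner integrals in Fubini's theorem are extended-real and finite only almost everywhere; taking
    real parts changes them on a null set, which makes iterated real integrals meaningful. *)
Lemma ae_fine_integrable d (T : measurableType d) (m : {measure set T -> \bar R}) (F : T -> \bar R) :
  m.-integrable setT F ->
  m.-integrable setT (EFin \o (fun x => fine (F x))) /\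
  (\int[m]_x (fine (F x))%:E = \int[m]_x F x)%E.
Proof.
move=> iF; have mF := measurable_int _ iF.
have mfF : measurable_fun setT (EFin \o (fun x => fine (F x))).
  by apply/measurable_EFinP; exact: measurableT_comp mF.
have ae : ae_eq m setT (EFin \o (fun x => fine (F x))) F.
  have := integrable_ae measurableT iF; apply: filterS => x /= h _.
  by rewrite fineK// h.
split; last by apply: ae_eq_integral.
apply/integrableP; split=> //; have /integrableP[_] := iF; apply: le_lt_trans.
rewrite (@ae_eq_integral _ _ _ m setT (fun x => `|F x|%E) (fun x => `|(EFin \o (fun x => fine (F x))) x|%E))//.
- exact: measurableT_comp.
- exact: measurableT_comp.
- by apply: filterS ae => x h hx; congr (`|_|%E); exact: (h hx).
Qed.

Lemma Rfubini_integrable :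
  m1.-integrable setT (EFin \o (fun x => \int[m2]_y P (x, y))).
Proof.
have := @integrable_fubini_F _ _ T1 T2 R m1 m2 (EFin \o P) iP.
by move=> /ae_fine_integrable[].
Qed.

Let swap_integrable : (m2 \x m1)%E.-integrable setT (EFin \o (fun p => P (p.2, p.1))).
Proof.
have mP : measurable_fun setT (EFin \o P) by exact: measurable_int iP.
apply/integrable12ltyP => /=.
  rewrite (_ : EFin \o _ = (EFin \o P) \o (fun p : T2 * T1 => (p.2, p.1)))//.
  apply: (@measurableT_comp _ _ _ _ _ _ (EFin \o P) _ (fun p : T2 * T1 => (p.2, p.1))) => //.
  exact: (measurable_fun_pair measurable_snd measurable_fst).
have /integrable21ltyP h := iP; exact: h.
Qed.

Lemma Rfubini :
  \int[m1]_x \int[m2]_y P (x, y) = \int[m2]_y \int[m1]_x P (x, y).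
Proof.
rewrite /Rintegral; congr fine.
have [_ ->] := ae_fine_integrable (@integrable_fubini_F _ _ T1 T2 R m1 m2 (EFin \o P) iP).
have [_ ->] := ae_fine_integrable (@integrable_fubini_F _ _ T2 T1 R m2 m1 _ swap_integrable).
exact: Fubini.
Qed.

End RealFubini.

Section Average.
Context {R : realType}.
Local Notation U := (uniform_prob (@ltr01 R)).
Local Notation leb := (@lebesgue_measure R).

Lemma Rintegral_U (g : R -> R) : measurable_fun setT g ->
  \int[U]_s g s = \int[leb]_(s in `[0, 1]) g s.
Proof.
move=> mg; rewrite /Rintegral; congr fine.
rewrite integralE [RHS]integralE; have mE : measurable_fun setT (EFin \o g) by exact/measurable_EFinP.
congr (_ - _)%E; apply: integral_U => //.
- exact: measurable_funepos.
- exact: measurable_funeneg.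
Qed.

Lemma U_FTC (g G : R -> R) : continuous g -> (forall s : R, is_derive s 1 G (g s)) ->
  \int[U]_s g s = G 1 - G 0.
Proof.
move=> cg dG; rewrite Rintegral_U; first by apply: FTC2R.
exact: continuous_measurable_fun.
Qed.

Lemma U_bounded_integrable (g : R -> R) (M : R) : measurable_fun setT g ->
  (forall s, `|g s| <= M) -> U.-integrable setT (EFin \o g).
Proof.
move=> mg hM; apply: measurable_bounded_integrable => //.
- by rewrite /= probability_setT ltry.
- exists M; split; first exact: num_real.
  by move=> x Mx s _; apply: le_trans (hM s) (ltW Mx).
Qed.

Lemma U_dev (g : R -> R) (M c eps : R) : measurable_fun setT g -> (forall s, `|g s| <= M) ->
  (forall s, 0 <= s <= 1 -> `|g s - c| <= eps) -> `|\int[U]_s g s - c| <= eps.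
Proof.
move=> mg gM hg; rewrite Rintegral_U//.
have I01 (k : R) : \int[leb]_(s in `[0, 1]) k = k.
  rewrite Rintegral_cst//; have := lebesgue_measure_itv `[0, 1]%R => /= ->.
  by rewrite lte_fin ltr01/= subr0 mulr1.
have ig : leb.-integrable `[0, 1] (EFin \o g).
  apply: measurable_bounded_integrable => //.
  - have := lebesgue_measure_itv `[0, 1]%R => /= ->; rewrite lte_fin ltr01; exact: ltry.
  - exact: measurable_funTS.
  - exists M; split; first exact: num_real.
    by move=> x Mx s _; apply: le_trans (gM s) (ltW Mx).
have ic (k : R) : leb.-integrable `[0, 1] (EFin \o cst k).
  by apply: cont_int_itv; exact: cst_continuous.
have up : \int[leb]_(s in `[0, 1]) g s <= c + eps.
  rewrite -[leRHS]I01; apply: le_Rintegral => //; first exact: ic.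
  by move=> s /=; rewrite in_itv /= => /hg; rewrite ler_norml; lra.
have lo : c - eps <= \int[leb]_(s in `[0, 1]) g s.
  rewrite -[leLHS]I01; apply: le_Rintegral => //; first exact: ic.
  by move=> s /=; rewrite in_itv /= => /hg; rewrite ler_norml; lra.
by rewrite ler_norml; move: up lo; set I := \int[_]_(_ in _) _; lra.
Qed.

End Average.

Section Arith.
Context {R : realType}.
Implicit Types (a b c e M N : R).

Lemma half_gt0 e M : 0 < e -> 0 <= M -> 0 < e / (2 * (M + 1)).
Proof. by move=> e0 M0; rewrite divr_gt0// mulr_gt0//; lra. Qed.

Lemma half_sum e M N : 0 < e -> 0 <= M -> 0 <= N ->
  e / (2 * (M + 1)) * M + N * (e / (2 * (N + 1))) <= e.
Proof.
have h (K : R) : 0 < e -> 0 <= K -> e / (2 * (K + 1)) * K <= e / 2.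
  move=> e0 K0; rewrite mulrAC ler_pdivrMr; last by lra.
  have -> : e / 2 * (2 * (K + 1)) = e * (K + 1) by field.
  by rewrite ler_pM2l//; lra.
move=> e0 M0 N0; have := lerD (h M e0 M0) (h N e0 N0).
by rewrite [N * _]mulrC -splitr.
Qed.

Lemma between_dist a b c e r : `|a - c| <= e -> `|b - c| <= e -> a <= r <= b \/ b <= r <= a ->
  `|r - c| <= e.
Proof. by rewrite !ler_norml => /andP[? ?] /andP[? ?] [] /andP[? ?]; lra. Qed.

Lemma between_bound a b r M : `|a| <= M -> `|b| <= M -> a <= r <= b \/ b <= r <= a -> - M <= r <= M.
Proof. by rewrite !ler_norml => /andP[? ?] /andP[? ?] [] /andP[? ?]; lra. Qed.

End Arith.

(** * Steklov averages and the chain rule *)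

Section Steklov.
Context {R : realType} {d : nat}.
Implicit Types (u v w psi g : 'rV[R]_d -> R) (i j : 'I_d) (x y : 'rV[R]_d) (t : d.-tuple R).
Local Notation U := (uniform_prob (@ltr01 R)).
Local Notation leb := (@lebesgue_measure R).
Local Notation row := (@row_of_tuple R d).
Local Notation mu := (cell_measure R d).
Local Notation test := (@torus_test R d).
Local Notation tL2 := (@torus_L2 R d).
Local Notation periodic := (@Defs.periodic R d).
Local Notation e i := (delta_mx 0 i : 'rV[R]_d).

(** The mean of [u] over the segment from x to x + h e_i. Applied to a weak derivative it takes the
    place of the difference quotient of the function. *)
Definition steklov i (h : R) u x : R := \int[U]_s u (x + (h * s) *: e i).

Lemma measurable_line i (h : R) u : measurable_fun setT (u \o row) ->
  measurable_fun [set: d.-tuple R * measurableTypeR R]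
    (fun p => u (row p.1 + (h * p.2) *: e i)).
Proof.
move=> mu'.
have -> : (fun p : d.-tuple R * measurableTypeR R => u (row p.1 + (h * p.2) *: e i)) =
    (u \o row) \o ((fun p : d.-tuple R * measurableTypeR R => upd p.1 i p.2) \o
      (fun p : d.-tuple R * measurableTypeR R => (p.1, tnth p.1 i + h * p.2))).
  by apply/funext => p /=; rewrite -row_tshift.
apply: measurableT_comp => //; apply: measurableT_comp; first exact: measurable_upd.
apply: measurable_fun_pair; first exact: measurable_fst.
apply: measurable_funD.
  by apply: (measurableT_comp (measurable_tnth i)); exact: measurable_fst.
apply: measurable_funM; first exact: measurable_cst.
exact: measurable_snd.
Qed.

Lemma line_integrable i (h M : R) w g : tL2 w -> measurable_fun setT (g \o row) ->
  (forall x, `|g x| <= M) ->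
  (mu \x U)%E.-integrable setT
    (EFin \o (fun p : d.-tuple R * measurableTypeR R => w (row p.1 + (h * p.2) *: e i) * g (row p.1))).
Proof.
move=> Lw mg hM; have mw := tL2_meas Lw.
have mF : measurable_fun setT (fun p : d.-tuple R * measurableTypeR R =>
    w (row p.1 + (h * p.2) *: e i) * g (row p.1)).
  apply: measurable_funM; first exact: measurable_line.
  by apply: (@measurableT_comp _ _ _ _ _ _ (g \o row) _ fst) => //; exact: measurable_fst.
apply/integrable21ltyP; first exact/measurable_EFinP.
have M0 : 0 <= M by apply: le_trans (hM 0).
have /integrableP[_ fw] := tL2_integrable1 Lw.
set C := (M%:E * \int[mu]_t `|(w (row t))%:E|)%E.
(* By shift invariance the translate by [h * s] has the same L^1 norm for all [s], so integrating
   over the cell first gives a bound uniform in [s]. *)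
have inner (s : R) : (\int[mu]_t `|(w (row t + (h * s) *: e i) * g (row t))%:E| <= C)%E.
  have shift_eq : (\int[mu]_t `|(w (row t + (h * s) *: e i))%:E| = \int[mu]_t `|(w (row t))%:E|)%E.
    have := @ge0_cell_shift R d (fun t => `|(w (row t))%:E|)%E i (h * s).
    have -> : (fun t => `|(w (row (tshift i (h * s) t)))%:E|%E) =
        (fun t => `|(w (row t + (h * s) *: e i))%:E|%E) by apply/funext => t; rewrite row_tshift.
    apply => //; first by apply: measurableT_comp => //; exact/measurable_EFinP.
    by move=> t; rewrite row_tshift scale1r (proj1 Lw).
  have mws : measurable_fun setT (fun t => w (row t + (h * s) *: e i)) by exact: measurable_trans.
  have mwsa : measurable_fun setT (fun t => `|(w (row t + (h * s) *: e i))%:E|%E).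
    by apply: measurableT_comp => //; exact/measurable_EFinP.
  rewrite /C -shift_eq -(ge0_integralZl mu measurableT mwsa (fun t _ => abse_ge0 _)); last by rewrite lee_fin.
  apply: ge0_le_integral => //.
  - apply: measurableT_comp => //; apply/measurable_EFinP.
    exact: (measurable_funM mws mg).
  - exact: measurable_funeM.
  - by move=> t _; rewrite -EFinM lee_fin normrM mulrC ler_wpM2r.
have Clt : (C < +oo)%E by rewrite /C; apply: lte_mul_pinfty.
apply: le_lt_trans Clt; rewrite -[leRHS](prob_cst U).
apply: ge0_le_integral => //; last by move=> s _; exact: inner.
- by move=> s _; apply: integral_ge0.
- have := @measurable_fun_fubini_tonelli_G _ _ _ _ R mu
    (fun p : d.-tuple R * measurableTypeR R => `|(w (row p.1 + (h * p.2) *: e i) * g (row p.1))%:E|)%E.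
  apply => //; apply: measurableT_comp => //; exact/measurable_EFinP.
Qed.

Lemma steklov_integrable i (h : R) w : tL2 w ->
  mu.-integrable setT (EFin \o (steklov i h w \o row)).
Proof.
move=> Lw; have m1 : measurable_fun setT ((cst 1 : 'rV[R]_d -> R) \o row) by exact: measurable_cst.
have h1 x : `|(cst 1 : 'rV[R]_d -> R) x| <= (1 : R) by rewrite normr1.
have := Rfubini_integrable (line_integrable i h Lw m1 h1).
apply: eq_integrable => // t _ /=; congr (_%:E).
by apply: eq_Rintegral => s _; rewrite mulr1.
Qed.

Lemma line_integrable_r i (h M : R) w g : tL2 w -> periodic g -> measurable_fun setT (g \o row) ->
  (forall x, `|g x| <= M) ->
  (mu \x U)%E.-integrable setT
    (EFin \o (fun p : d.-tuple R * measurableTypeR R => w (row p.1) * g (row p.1 + (h * p.2) *: e i))).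
Proof.
move=> Lw pg mg hM.
have m1 : measurable_fun setT ((cst 1 : 'rV[R]_d -> R) \o row) by exact: measurable_cst.
have h1 x : `|(cst 1 : 'rV[R]_d -> R) x| <= (1 : R) by rewrite normr1.
have mM : measurable_fun setT ((cst M : 'rV[R]_d -> R) \o row) by exact: measurable_cst.
have hM' x : `|(cst M : 'rV[R]_d -> R) x| <= `|M| by [].
have := line_integrable i 0 Lw mM hM'; apply: le_integrable => //.
- apply/measurable_EFinP; apply: measurable_funM; last exact: measurable_line.
  by apply: (@measurableT_comp _ _ _ _ _ _ (w \o row) _ fst) => //; first [exact: tL2_meas|exact: measurable_fst].
- move=> p _; rewrite /= lee_fin mul0r scale0r addr0 !normrM ler_wpM2l//.
  exact: le_trans (hM _) (ler_norm _).
Qed.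

Lemma line_section i (h : R) g t : measurable_fun setT (g \o row) ->
  measurable_fun [set: measurableTypeR R] (fun s : measurableTypeR R => g (row t + (h * s) *: e i)).
Proof.
move=> mg; exact: (measurableT_comp (measurable_line i h mg) (pair1_measurable t)).
Qed.

Lemma steklov_bound i (h M : R) g t : measurable_fun setT (g \o row) -> (forall x, `|g x| <= M) ->
  `|steklov i h g (row t)| <= M.
Proof.
move=> mg hM; rewrite -[steklov _ _ _ _]subr0.
apply: (@U_dev _ _ M 0 M); first exact: line_section.
- by move=> s; exact: hM.
- by move=> s _; rewrite subr0.
Qed.

Lemma bounded_integrable g v (M : R) : mu.-integrable setT (EFin \o (g \o row)) ->
  measurable_fun setT (v \o row) -> (forall t, `|v (row t)| <= M) ->
  mu.-integrable setT (EFin \o (fun t => g (row t) * v (row t))).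
Proof.
move=> ig mv hM; have := integrableZl measurableT M ig.
apply: le_integrable => //.
- apply/measurable_EFinP; apply: measurable_funM => //.
  by apply/measurable_EFinP; exact: measurable_int ig.
- move=> t _; rewrite /= lee_fin !normrM mulrC ler_wpM2r//.
  exact: le_trans (hM _) (ler_norm _).
Qed.

(** Fubini alone treats the second pairing; the first needs in addition a shift by h s. The common
    value, with [s] outermost, is part of the statement because the weak derivative relation is
    applied to each translate of the test function separately. *)
Lemma steklov_adjoint i (h M : R) w g : tL2 w -> periodic g -> measurable_fun setT (g \o row) ->
  (forall x, `|g x| <= M) ->
  torus_int (fun x => steklov i h w x * g x) =
  \int[U]_s torus_int (fun x => w x * g (x + (- h * s) *: e i)) /\
  torus_int (fun x => w x * steklov i (- h) g x) =
  \int[U]_s torus_int (fun x => w x * g (x + (- h * s) *: e i)).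
Proof.
move=> Lw pg mg hM; split.
  have iP := line_integrable i h Lw mg hM.
  have := Rfubini iP => /= E.
  transitivity (\int[mu]_t \int[U]_s (w (row t + (h * s) *: e i) * g (row t))).
    have m1 : measurable_fun setT ((cst 1 : 'rV[R]_d -> R) \o row) by exact: measurable_cst.
    have h1 x : `|(cst 1 : 'rV[R]_d -> R) x| <= (1 : R) by rewrite normr1.
    have iS := steklov_integrable i h Lw.
    apply: ae_Rintegral.
    - by apply: measurable_funM => //; apply/measurable_EFinP; exact: measurable_int iS.
    - by apply/measurable_EFinP; exact: measurable_int (Rfubini_integrable iP).
    have := ae_integrable1 (line_integrable i h Lw m1 h1); apply: ae_imp => t it.
    rewrite /steklov -RintegralZr//.
    by move: it; apply: eq_integrable => // s _ /=; rewrite mulr1.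
  rewrite E; apply: eq_Rintegral => s _.
  have mwg : measurable_fun setT ((fun x => w x * g (x + (- h * s) *: e i)) \o row).
    by apply: measurable_funM; [exact: tL2_meas|exact: measurable_trans].
  have pwg : periodic (fun x => w x * g (x + (- h * s) *: e i)).
    by move=> j x; rewrite (proj1 Lw) addrAC pg.
  rewrite -(torus_int_shift i (h * s) pwg mwg); apply: eq_Rintegral => t _ /=.
  by rewrite -addrA -scalerDl mulNr subrr scale0r addr0.
have iP := line_integrable_r i (- h) Lw pg mg hM.
have := Rfubini iP => /= <-; apply: eq_Rintegral => t _ /=.
rewrite /steklov -RintegralZl//; apply: (@U_bounded_integrable _ _ M); first exact: line_section.
by move=> s; exact: hM.
Qed.

Lemma line_cont i (h : R) psi x : test psi -> continuous (fun s : R => psi (x + (h * s) *: e i)).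
Proof.
move=> tp s; have hd : is_derive (h * s) 1 (fun r : R => psi (x + r *: e i)) ('D_(e i) psi (x + (h * s) *: e i)).
  by apply/is_derive_line; exact: torus_test_is_derive.
apply: (@continuous_comp _ _ _ (fun s : R => h * s) (fun r : R => psi (x + r *: e i))).
  exact: mulrl_continuous.
exact: is_derive_continuous hd.
Qed.

Lemma steklov_derive i (h : R) psi x : h != 0 -> test psi ->
  steklov i h ('D_(e i) psi) x = h^-1 * (psi (x + h *: e i) - psi x).
Proof.
move=> h0 tp; pose G (s : R) := h^-1 * psi (x + (h * s) *: e i).
have dG (s : R) : is_derive s 1 G ('D_(e i) psi (x + (h * s) *: e i)).
  have hd : is_derive (h * s) 1 (fun r : R => psi (x + r *: e i)) ('D_(e i) psi (x + (h * s) *: e i)).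
    by apply/is_derive_line; exact: torus_test_is_derive.
  have hs : is_derive s 1 (fun s : R => h * s) h.
    by apply: (is_derive_eq (is_deriveZ h (is_derive_id s 1))); rewrite /GRing.scale /= mulr1.
  have hc := is_deriveZ h^-1 (@is_derive1_comp R _ (fun s : R => h * s) s _ h hd hs).
  by apply: (is_derive_eq hc); rewrite /GRing.scale /= mulrCA mulVf// mulr1.
rewrite /steklov (@U_FTC _ _ G)//; last exact: line_cont (torus_test_derive i tp).
by rewrite /G mulr1 mulr0 scale0r addr0 mulrBr.
Qed.

Lemma derive_trans psi i (v : 'rV[R]_d) x : test psi ->
  'D_(e i) (fun y => psi (y + v)) x = 'D_(e i) psi (x + v).
Proof.
move=> tp; have /is_derive_line0 h := @torus_test_is_derive R d psi i (x + v) tp.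
have /is_derive_line0 h' := @torus_test_is_derive R d (fun y => psi (y + v)) i x (torus_test_trans v tp).
rewrite -(@derive_val _ _ _ _ _ _ _ h) -(@derive_val _ _ _ _ _ _ _ h').
rewrite (_ : (fun r : R => psi (x + r *: e i + v)) = (fun r : R => psi (x + v + r *: e i)))//.
by apply/funext => r; rewrite addrAC.
Qed.

Lemma tintMZ (c : R) u v : tL2 u -> tL2 v ->
  torus_int (fun x => c * u x * v x) = c * torus_int (fun x => u x * v x).
Proof.
move=> [_ Lu] [_ Lv]; have E := RintegralZl c measurableT (L2_integrable Lu Lv).
by rewrite -[RHS]E; apply: eq_Rintegral => t _; rewrite mulrA.
Qed.

(** Against a test function [psi] the difference quotient moves onto [psi], where it is the Steklov
    average of the derivative of [psi]. For each [s] the definition of [w] then applies to a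
    translate of [psi], and adjointness moves the average back onto [w]. *)
Lemma diffquot_steklov i (h : R) u w : h != 0 -> periodic u -> continuous u -> tL2 w ->
  is_wpartial i u w ->
  \forall t \ae mu, h^-1 * (u (row t + h *: e i) - u (row t)) = steklov i h w (row t).
Proof.
move=> h0 pu cu Lw hw.
have Lu := tL2_cont pu cu.
have Lus : tL2 (fun x => u (x + h *: e i)).
  apply: tL2_cont; last exact: comp_trans_cont.
  by move=> j x; rewrite addrAC pu.
pose D x := h^-1 * (u (x + h *: e i) - u x).
have LD : tL2 D by apply: tL2_Z; exact: tL2_B.
have iS := steklov_integrable i h Lw.
have iDS : mu.-integrable setT (EFin \o ((fun x => D x - steklov i h w x) \o row)).
  by have := integrableB measurableT (tL2_integrable1 LD) iS.
suff : \forall t \ae mu, D (row t) - steklov i h w (row t) = 0.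
  by apply: ae_imp => t /eqP; rewrite subr_eq0 => /eqP.
(* The Steklov average of [w] is known here to be integrable only, which is why [torus_ae0] is
   stated for integrable functions. *)
apply: (@torus_ae0 R d (fun x => D x - steklov i h w x)) => // psi tp.
have [M M0 hM] := periodic_bounded (proj1 tp) (torus_test_cont tp).
have [E1 E2] := steklov_adjoint i h Lw (proj1 tp) (tL2_meas (tL2_test tp)) hM.
have tdp := torus_test_derive i tp.
have [M' M'0 hM'] := periodic_bounded (proj1 tdp) (torus_test_cont tdp).
have [_ E3] := steklov_adjoint i h Lu (proj1 tdp) (tL2_meas (tL2_test tdp)) hM'.
have Sd x : steklov i (- h) ('D_(e i) psi) x = h^-1 * (psi x - psi (x - h *: e i)).
  by rewrite steklov_derive ?oppr_eq0// scaleNr invrN mulNr -mulrN opprB.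
have tps := torus_test_trans (- h *: e i) tp.
have Lp := tL2_test tp; have Lps := tL2_test tps.
have E4 : torus_int (fun x => D x * psi x) = - torus_int (fun x => u x * steklov i (- h) ('D_(e i) psi) x).
  have -> : torus_int (fun x => D x * psi x) =
      torus_int (fun x => (h^-1 * u (x + h *: e i) + (- h^-1 * u x)) * psi x).
    by apply: eq_Rintegral => t _; rewrite /D; ring.
  rewrite tint_lin//; last exact: tL2_Z.
  have -> : torus_int (fun x => u (x + h *: e i) * psi x) = torus_int (fun x => u x * psi (x + - h *: e i)).
    rewrite -(@torus_int_shift R d (fun x => u x * psi (x + - h *: e i)) i h).
    - by apply: eq_Rintegral => t _; rewrite scaleNr addrK.
    - by move=> j x; rewrite pu (proj1 tps).
    - exact: (measurable_funM (tL2_meas Lu) (tL2_meas Lps)).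
  have -> : torus_int (fun x => u x * steklov i (- h) ('D_(e i) psi) x) =
      torus_int (fun x => (h^-1 * psi x + (- h^-1) * psi (x + - h *: e i)) * u x).
    by apply: eq_Rintegral => t _; rewrite Sd scaleNr; ring.
  rewrite tint_lin//; last exact: tL2_Z.
  rewrite tintMZ// [X in _ = - (_ + X)]tintMZ// !(tintC _ u).
  ring.
have E5 : torus_int (fun x => u x * steklov i (- h) ('D_(e i) psi) x) =
    - torus_int (fun x => steklov i h w x * psi x).
  rewrite E3 E1 -E2.
  have mS : measurable_fun setT (steklov i (- h) psi \o row).
    by apply/measurable_EFinP; exact: measurable_int (steklov_integrable i (- h) Lp).
  have Sb t := steklov_bound i (- h) t (tL2_meas Lp) hM.
  have iwS := bounded_integrable (tL2_integrable1 Lw) mS Sb.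
  have [_ E6] := steklov_adjoint i h (tL2_Z (-1) Lw) (proj1 tp) (tL2_meas Lp) hM.
  transitivity (torus_int (fun x => -1 * w x * steklov i (- h) psi x)); last first.
    have E7 := RintegralZl (-1) measurableT iwS.
    rewrite -[RHS]mulN1r; transitivity (\int[mu]_t (-1 * (w (row t) * steklov i (- h) psi (row t)))); last exact: E7.
    by apply: eq_Rintegral => t _; rewrite mulrA.
  rewrite E6; apply: eq_Rintegral => s _.
  have tss := torus_test_trans ((- h * s) *: e i) tp.
  have -> : torus_int (fun x => u x * 'D_(e i) psi (x + (- h * s) *: e i)) =
      torus_int (u \* 'D_(e i) (fun x => psi (x + (- h * s) *: e i))).
    by apply: eq_Rintegral => t _ /=; rewrite derive_trans.
  by rewrite hw// tintMZ ?mulN1r//; exact: tL2_test tss.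
have -> : torus_int ((fun x => D x - steklov i h w x) \* psi) =
    torus_int (fun x => D x * psi x) - torus_int (fun x => steklov i h w x * psi x).
  have iSp : mu.-integrable setT (EFin \o (fun t => steklov i h w (row t) * psi (row t))).
    by apply: (bounded_integrable iS (tL2_meas Lp) (M := M)) => t; exact: hM.
  have iDp := L2_integrable (proj2 LD) (proj2 Lp).
  have := Rint_lin (-1) iSp iDp; rewrite mulN1r addrC => <-.
  by apply: eq_Rintegral => t _ /=; ring.
by rewrite E4 E5 opprK subrr.
Qed.

Lemma cell_U_total : ((mu \x U) [set: d.-tuple R * measurableTypeR R] = 1)%E.
Proof.
rewrite -setXTT product_measure1E//.
have E1 : mu [set: d.-tuple R] = 1%E := probability_setT mu.
have E2 : U [set: measurableTypeR R] = 1%E := probability_setT U.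
by transitivity (1 * 1 : \bar R)%E; [congr (_ * _)%E; [exact: E1|exact: E2]|rewrite mul1e].
Qed.

(** The difference quotient of f(u) is a slope [Q n] times that of u, hence times the Steklov
    average of [w]. Adjointness moves the average onto the bounded function [Q n] times [psi]; then
    [w] stays fixed and dominates, and the averages of [g n] converge pointwise by continuity of
    [u]. *)
Lemma chain_rule i u w (f f' : R -> R) : periodic u -> continuous u -> tL2 w ->
  is_wpartial i u w -> (forall s : R, is_derive s 1 f (f' s)) -> continuous f' ->
  tL2 (fun x => f' (u x) * w x) /\ is_wpartial i (fun x => f (u x)) (fun x => f' (u x) * w x).
Proof.
move=> pu cu Lw hw df cf'.
have [Mu Mu0 hMu] := periodic_bounded pu cu.
have cf : continuous f by move=> s; exact: is_derive_continuous (df s).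
have cfu : continuous (fun x => f (u x)).
  by move=> x; apply: (@continuous_comp _ _ _ u f); [exact: cu|exact: cf].
have cf'u : continuous (fun x => f' (u x)).
  by move=> x; apply: (@continuous_comp _ _ _ u f'); [exact: cu|exact: cf'].
have pfu : periodic (fun x => f (u x)) by move=> j x; rewrite pu.
have pf'u : periodic (fun x => f' (u x)) by move=> j x; rewrite pu.
have Lfu := tL2_cont pfu cfu; have Lf'u := tL2_cont pf'u cf'u.
have mu' := tL2_meas (tL2_cont pu cu).
have [M M0 hM] : exists2 M : R, 0 <= M & forall s, - Mu <= s <= Mu -> `|f' s| <= M.
  have /compact_bounded[N [_ hN]] : compact (f' @` `[- Mu, Mu]%classic).
    by apply: continuous_compact; [exact: cont_within|exact: segment_compact].
  exists (`|N| + 1) => [|s hs]; first by rewrite addr_ge0.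
  apply: (hN (`|N| + 1)); first by rewrite (le_lt_trans (ler_norm _))// ltrDl.
  by exists s => //=; rewrite in_itv.
split.
  apply: (tL2_mulb pf'u (tL2_meas Lf'u) Lw (M := M)) => x; apply: hM.
  by rewrite -ler_norml.
move=> psi tp.
have [Mp Mp0 hMp] := periodic_bounded (proj1 tp) (torus_test_cont tp).
pose h (n : nat) : R := n.+1%:R^-1.
have h0 n : 0 < h n by rewrite invr_gt0 ltr0n.
have hn0 n : h n != 0 by rewrite gt_eqF.
(* The slope of f between u x and u (x + h e_i), as a mean of f' to make it measurable in x also where the
   increment of u vanishes. *)
pose cl (s : R) : R := Num.max 0 (Num.min s 1).
have cl01 s : 0 <= cl s <= 1.
  by rewrite /cl le_max lexx /= ge_max ler01 /= ge_min lexx orbT.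
have clE s : 0 <= s <= 1 -> cl s = s.
  by move=> /andP[s0 s1]; rewrite /cl min_l// max_r.
have mcl : measurable_fun setT cl.
  by apply: measurable_maxr => //; exact: measurable_minr.
(* With [s] clamped, [L n x s] lies between the two values of [u] for every real [s], so f' stays
   bounded along it; the uniform measure sees only [0, 1], where clamping changes nothing. *)
pose L n x (s : R) := u x + cl s * (u (x + h n *: e i) - u x).
have Lb n x s : - Mu <= L n x s <= Mu.
  have := hMu x; have := hMu (x + h n *: e i); have /andP[] := cl01 s.
  by rewrite !ler_norml /L; move: (u x) (u (_ + _)) (cl s) => a b c; nra.
pose Q n x := \int[U]_s f' (L n x s).
have mf' : measurable_fun setT f' by exact: continuous_measurable_fun.
have mL n : measurable_fun [set: d.-tuple R * measurableTypeR R] (fun p => L n (row p.1) p.2).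
  have m1 v : measurable_fun setT (v \o row) ->
      measurable_fun [set: d.-tuple R * measurableTypeR R] (fun p => v (row p.1)).
    by move=> mv; apply: (@measurableT_comp _ _ _ _ _ _ (v \o row) _ fst) => //; exact: measurable_fst.
  apply: measurable_funD; first exact: m1.
  apply: measurable_funM.
    by apply: (@measurableT_comp _ _ _ _ _ _ cl _ snd) => //; exact: measurable_snd.
  apply: measurable_funB; last exact: m1.
  apply: (m1 (fun x => u (x + h n *: e i))); exact: measurable_trans.
have mf'L n : measurable_fun [set: d.-tuple R * measurableTypeR R] (fun p => f' (L n (row p.1) p.2)).
  by apply: (@measurableT_comp _ _ _ _ _ _ f').
have msec n x : measurable_fun setT (fun s => f' (L n x s)).
  apply: (@measurableT_comp _ _ _ _ _ _ f') => //; apply: measurable_funD => //.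
  exact: measurable_funM.
have QE n x : f (u (x + h n *: e i)) - f (u x) = Q n x * (u (x + h n *: e i) - u x).
  rewrite /Q Rintegral_U//.
  set dl := u (x + h n *: e i) - u x.
  have -> : \int[leb]_(s in `[0, 1]) f' (L n x s) = \int[leb]_(s in `[0, 1]) f' (u x + s * dl).
    by apply: eq_Rintegral => s; rewrite inE /= in_itv /= => hs; rewrite /L clE.
  have daff (s : R) : is_derive s 1 (fun s : R => u x + s * dl) dl.
    have hd := is_deriveD (is_derive_cst (u x) s 1) (is_deriveM (is_derive_id s 1) (is_derive_cst dl s 1)).
    by apply: (is_derive_eq hd); rewrite /GRing.scale /= mulr0 !add0r mulr1.
  have cg : continuous (fun s : R => f' (u x + s * dl)).
    by move=> s; apply: (@continuous_comp _ _ _ (fun s : R => u x + s * dl) f');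
      [exact: is_derive_continuous (daff s)|exact: cf'].
  rewrite -RintegralZr//; last exact: cont_int_itv.
  have dG (s : R) : is_derive s 1 (fun s : R => f (u x + s * dl)) (f' (u x + s * dl) * dl).
    have hc := @is_derive1_comp R f (fun s : R => u x + s * dl) s _ dl (df _) (daff s).
    by apply: (is_derive_eq hc).
  rewrite (@FTC2R R _ (fun s : R => f (u x + s * dl)))//.
    have -> : u x + 1 * dl = u (x + h n *: e i) by rewrite /dl; ring.
    by rewrite mul0r addr0.
  by move=> s; apply: (@cvgM _ _ (nbhs s) _ (fun s : R => f' (u x + s * dl)) (cst dl)); [exact: cg|exact: cvg_cst].
have Qdev n x c eps : (forall r, u x <= r <= u (x + h n *: e i) \/ u (x + h n *: e i) <= r <= u x ->
    `|f' r - c| <= eps) -> `|Q n x - c| <= eps.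
  move=> h1; apply: (U_dev (M := M)) => //; first by move=> s; apply: hM.
  move=> s hs; rewrite /L clE//; apply: h1.
  move: hs; move: (u x) (u (_ + _)) => a b /andP[s0 s1].
  by have [ab|ab] := leP a b; [left|right]; nra.
have mQ n : measurable_fun setT (Q n \o row).
  have iP : (mu \x U)%E.-integrable setT (EFin \o (fun p : d.-tuple R * measurableTypeR R => f' (L n (row p.1) p.2))).
    apply: measurable_bounded_integrable => //.
    - by apply: le_lt_trans (ltry 1); rewrite le_eqVlt; apply/orP; left; apply/eqP; exact: cell_U_total.
    - exists M; split; first exact: num_real.
      by move=> y My p _; apply: le_trans (ltW My); apply: hM.
  by apply/measurable_EFinP; exact: measurable_int (Rfubini_integrable iP).
have pQ n : periodic (Q n) by move=> j x; apply: eq_Rintegral => s _; rewrite /L addrAC !pu.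
have Qb n x : `|Q n x| <= M.
  rewrite -[Q n x]subr0; apply: Qdev => r hr; rewrite subr0; apply: hM.
  exact: between_bound (hMu _) (hMu _) hr.
pose g n x := Q n x * psi x.
have mg n : measurable_fun setT (g n \o row).
  exact: (measurable_funM (mQ n) (tL2_meas (tL2_test tp))).
have pg n : periodic (g n) by move=> j x; rewrite /g pQ (proj1 tp).
have gb n x : `|g n x| <= M * Mp by rewrite normrM ler_pM.
(* All points involved are within [h n] of [x] in every coordinate, so continuity of [u], [psi] and
   [f'] at single points gives an estimate uniform in [s]. *)
have gcvg x eps : 0 < eps -> exists2 eta : R, 0 < eta & forall n (s : R), h n < eta -> 0 <= s <= 1 ->
    `|g n (x + (- h n * s) *: e i) - f' (u x) * psi x| <= eps.
  move=> eps0.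
  pose e1 := eps / (2 * (Mp + 1)); pose e2 := eps / (2 * (M + 1)).
  have e10 : 0 < e1 by exact: half_gt0.
  have e20 : 0 < e2 by exact: half_gt0.
  have [eta1 eta10 h1] : exists2 eta1 : R, 0 < eta1 & forall r, `|r - u x| <= eta1 -> `|f' r - f' (u x)| <= e1.
    have /cvgrPdist_le/(_ _ e10)/nbhs_normP[r /= r0 hr] := cf' (u x).
    exists (r / 2); first by rewrite divr_gt0.
    by move=> y hy; rewrite distrC; apply: hr; rewrite /= distrC (le_lt_trans hy)// ltr_pdivrMr// ltr_pMr// ltr1n.
  have [eta2 eta20 h2] := cont_coordwise x cu eta10.
  have [eta3 eta30 h3] := cont_coordwise x (torus_test_cont tp) e20.
  exists (Num.min eta2 eta3); first by rewrite lt_min eta20.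
  move=> n s; rewrite lt_min => /andP[hn2 hn3] /andP[s0 s1].
  set y := x + _.
  have hs0 : 0 <= h n * s <= h n by have := h0 n; nra.
  have yc (k : R) j : 0 <= k <= h n -> `|(y + k *: e i) 0 j - x 0 j| <= h n.
    move=> /andP[k0 kh]; rewrite coord_add_e /y coord_add_e.
    have -> : x 0 j + - h n * s * (j == i)%:R + k * (j == i)%:R - x 0 j = (k - h n * s) * (j == i)%:R by ring.
    case: (j == i); last by rewrite mulr0 normr0 ltW.
    by rewrite mulr1 ler_norml; move: hs0 k0 kh (h0 n); move: (h n * s) (h n) => a b; lra.
  have uy : `|u y - u x| <= eta1.
    by apply: h2 => j; have := yc 0 j; rewrite scale0r addr0 lexx ltW// => /(_ isT) hy; apply: le_lt_trans hn2.
  have uy' : `|u (y + h n *: e i) - u x| <= eta1.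
    by apply: h2 => j; have := yc (h n) j; rewrite lexx ltW// => /(_ isT) hy; apply: le_lt_trans hn2.
  have py : `|psi y - psi x| <= e2.
    by apply: h3 => j; have := yc 0 j; rewrite scale0r addr0 lexx ltW// => /(_ isT) hy; apply: le_lt_trans hn3.
  have Qy : `|Q n y - f' (u x)| <= e1.
    by apply: Qdev => r hr; apply: h1; exact: between_dist uy uy' hr.
  have c1 : `|f' (u x)| <= M by apply: hM; rewrite -ler_norml.
  have -> : g n y - f' (u x) * psi x = (Q n y - f' (u x)) * psi y + f' (u x) * (psi y - psi x).
    by rewrite /g; ring.
  apply: le_trans (ler_normD _ _) _; rewrite !normrM.
  have b1 : `|Q n y - f' (u x)| * `|psi y| <= e1 * Mp by apply: ler_pM.
  have b2 : `|f' (u x)| * `|psi y - psi x| <= M * e2 by apply: ler_pM.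
  apply: le_trans (lerD b1 b2) _.
  exact: half_sum.
pose A n t := w (row t) * steklov i (- h n) (g n) (row t).
pose B n t := f (u (row t)) * ((- h n)^-1 * (psi (row t + - h n *: e i) - psi (row t))).
have tps n := torus_test_trans (- h n *: e i) tp.
have Lp := tL2_test tp.
have Lps n := tL2_test (tps n).
(* Discrete integration by parts: by [QE] and [diffquot_steklov] the right side pairs the forward
   quotient of f(u) with [psi], and a shift turns that into minus the pairing with the backward
   quotient of [psi]. *)
have AB n : \int[mu]_t B n t = - \int[mu]_t A n t.
  have [E1 E2] := steklov_adjoint i (h n) Lw (pg n) (mg n) (gb n).
  have -> : \int[mu]_t A n t = torus_int (fun x => steklov i (h n) w x * g n x) by rewrite E1 -E2.
  have Lfus : tL2 (fun x => f (u (x + h n *: e i))).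
    by apply: tL2_cont; [move=> j x; rewrite addrAC pu|exact (@comp_trans_cont R d (fun x => f (u x)) (h n *: e i) cfu)].
  have -> : \int[mu]_t B n t = torus_int (fun x => (- h n)^-1 * (f (u x) * psi (x + - h n *: e i)) - (- h n)^-1 * (f (u x) * psi x)).
    by apply: eq_Rintegral => t _; rewrite /B; ring.
  have -> : torus_int (fun x => (- h n)^-1 * (f (u x) * psi (x + - h n *: e i)) - (- h n)^-1 * (f (u x) * psi x)) =
      torus_int (fun x => ((- h n)^-1 * psi (x + - h n *: e i) + - (- h n)^-1 * psi x) * f (u x)).
    by apply: eq_Rintegral => t _; ring.
  rewrite tint_lin//; last exact: tL2_Z.
  rewrite tintMZ//.
  have -> : torus_int (fun x => psi (x + - h n *: e i) * f (u x)) = torus_int (fun x => psi x * f (u (x + h n *: e i))).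
    rewrite -(@torus_int_shift R d (fun x => psi (x + - h n *: e i) * f (u x)) i (h n)).
    - by apply: eq_Rintegral => t _; rewrite scaleNr addrK.
    - by move=> j x; rewrite pu (proj1 (tps n)).
    - exact: (measurable_funM (tL2_meas (Lps n)) (tL2_meas Lfu)).
  have iS := steklov_integrable i (h n) Lw.
  have -> : torus_int (fun x => steklov i (h n) w x * g n x) =
      torus_int (fun x => ((h n)^-1 * f (u (x + h n *: e i)) + - (h n)^-1 * f (u x)) * psi x).
    apply: ae_Rintegral.
    - by apply: measurable_funM; [apply/measurable_EFinP; exact: measurable_int iS|exact: mg].
    - apply: measurable_funM; last exact: tL2_meas.
      exact: (tL2_meas (tL2_D (tL2_Z (h n)^-1 Lfus) (tL2_Z (- (h n)^-1) Lfu))).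
    apply: ae_imp (diffquot_steklov (hn0 n) pu cu Lw hw) => t <-.
    have -> : (h n)^-1 * f (u (row t + h n *: e i)) + - (h n)^-1 * f (u (row t)) =
        (h n)^-1 * (f (u (row t + h n *: e i)) - f (u (row t))) by ring.
    by rewrite QE /g; ring.
  rewrite tint_lin//; last exact: tL2_Z.
  rewrite tintMZ// invrN !(tintC psi); ring.
have limA : \int[mu]_t A n t @[n --> \oo] --> torus_int (fun x => f' (u x) * w x * psi x).
  apply: (@dominated_cvgR _ _ _ mu setT A (fun t => f' (u (row t)) * w (row t) * psi (row t))
    (fun t => (M * Mp) * `|w (row t)|) measurableT).
  - move=> n; apply: measurable_funM; first exact: tL2_meas.
    have Lg : tL2 (g n).
      split; [exact: pg|exact: (@bounded_L2 R d _ (M * Mp) (mg n) (fun t => gb n (row t)))].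
    by apply/measurable_EFinP; exact: measurable_int (steklov_integrable i (- h n) Lg).
  - exact: (measurable_funM (measurable_funM (tL2_meas Lf'u) (tL2_meas Lw)) (tL2_meas Lp)).
  - apply: aeW => t _; rewrite /A.
    have -> : f' (u (row t)) * w (row t) * psi (row t) = w (row t) * (f' (u (row t)) * psi (row t)) by ring.
    apply: cvgMr; apply/cvgrPdist_le => eps eps0.
    have [eta eta0 heta] := gcvg (row t) eps eps0; near=> n.
    have hn : h n < eta by near: n; exact: near_infty_natSinv_lt (PosNum eta0).
    rewrite distrC; apply: (U_dev (M := M * Mp)).
    + exact: line_section.
    + by move=> s; exact: gb.
    + by move=> s hs; exact: heta.
  - have := integrableZl measurableT (M * Mp) (integrable_norm (tL2_integrable1 Lw)).
    by apply: eq_integrable => // t _ /=.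
  - move=> n t _; rewrite /A normrM mulrC ler_wpM2r//.
    exact: steklov_bound (mg n) (gb n).
have limB : \int[mu]_t B n t @[n --> \oo] --> torus_int (fun x => f (u x) * 'D_(e i) psi x).
  have [Mf Mf0 hMf] := periodic_bounded pfu cfu.
  have tdp := torus_test_derive i tp.
  have [M' M'0 hM'] := periodic_bounded (proj1 tdp) (torus_test_cont tdp).
  apply: (@dominated_cvgR _ _ _ mu setT B (fun t => f (u (row t)) * 'D_(e i) psi (row t))
    (cst (Mf * M')) measurableT).
  - move=> n; apply: measurable_funM; first exact: (tL2_meas Lfu).
    apply: measurable_funM; first exact: measurable_cst.
    apply: measurable_funB; [exact: (tL2_meas (Lps n))|exact: (tL2_meas Lp)].
  - apply: measurable_funM; [exact: (tL2_meas Lfu)|exact: (tL2_meas (tL2_test tdp))].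
  - apply: aeW => t _; rewrite /B; apply: cvgMr.
    apply: (derive_seq_cvg (h := fun n => - h n)).
    + exact: torus_test_is_derive.
    + by move=> n; rewrite oppr_eq0.
    + by rewrite -oppr0; apply: cvgN; exact: cvg_harmonic.
  - exact: (tL2_integrable1 (tL2_test (@torus_test_cst R d (Mf * M')))).
  - move=> n t _; rewrite /B normrM ler_pM//.
    rewrite -steklov_derive ?oppr_eq0//.
    exact: steklov_bound (tL2_meas (tL2_test tdp)) hM'.
have limB' : \int[mu]_t B n t @[n --> \oo] --> - torus_int (fun x => f' (u x) * w x * psi x).
  have -> : (fun n => \int[mu]_t B n t) = (fun n => - \int[mu]_t A n t) by apply/funext.
  exact: cvgN limA.
exact: (cvg_unique _ limB limB').
Unshelve. all: by end_near. Qed.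

End Steklov.

(** * The operator and its perturbations *)

Section Laplacian.
Context {R : realType} {d : nat}.
Implicit Types (u v w : 'rV[R]_d -> R) (i j : 'I_d) (g : 'I_d -> 'rV[R]_d -> R).
Local Notation row := (@row_of_tuple R d).
Local Notation mu := (cell_measure R d).
Local Notation tL2 := (@torus_L2 R d).
Local Notation "u =ae v" := (\forall t \ae mu, u (row t) = v (row t)) (at level 70).

Lemma torus_H_sum k (s : seq 'I_d) g : (forall j, torus_H k (g j)) ->
  torus_H k (fun x => \sum_(j <- s) g j x).
Proof.
move=> hg; elim: s => [|j s IH].
  have -> : (fun x => \sum_(j <- [::]) g j x) = cst 0 by apply/funext => x; rewrite big_nil.
  exact: torus_H_0.
have -> : (fun x => \sum_(i <- j :: s) g i x) = (fun x => g j x + \sum_(i <- s) g i x).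
  by apply/funext => x; rewrite big_cons.
exact: torus_H_D.
Qed.

Lemma wpartial_sum i (s : seq 'I_d) g : (forall j, torus_H 1 (g j)) ->
  wpartial i (fun x => \sum_(j <- s) g j x) =ae (fun x => \sum_(j <- s) wpartial i (g j) x).
Proof.
move=> hg; elim: s => [|j s IH].
  have -> : (fun x => \sum_(j <- [::]) g j x) = (fun x => 0 * (cst 0 : 'rV[R]_d -> R) x).
    by apply/funext => x; rewrite big_nil mul0r.
  have := @wpartialZ R d 0 i 0 _ (@torus_H_0 R d 1); apply: ae_imp => t ->.
  by rewrite big_nil mul0r.
have -> : (fun x => \sum_(i <- j :: s) g i x) = (fun x => 1 * g j x + \sum_(i <- s) g i x).
  by apply/funext => x; rewrite big_cons mul1r.
have hs := torus_H_sum s hg.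
have [h1 _ _ _] := torus_HS i (hg j); have [h2 _ _ _] := torus_HS i hs.
have [_ ae] := wpartial_lin 1 (torus_H_L2 (hg j)) (torus_H_L2 hs) h1 h2.
by apply: filterS2 ae IH => t -> ->; rewrite big_cons mul1r.
Qed.

Lemma torus_H_wpartial k i u : torus_H k.+1 u -> torus_H k (wpartial i u).
Proof. by move=> /(torus_HS i)[]. Qed.

Lemma torus_H_laplacian k u : torus_H k.+2 u -> torus_H k (laplacian u).
Proof. by move=> hu; apply: torus_H_sum => j; do 2 apply: torus_H_wpartial. Qed.

Lemma ae_sum (s : seq 'I_d) g g' : (forall j, g j =ae g' j) ->
  (fun x => \sum_(j <- s) g j x) =ae (fun x => \sum_(j <- s) g' j x).
Proof.
move=> h; have : \forall t \ae mu, forall j, g j (row t) = g' j (row t) by exact: filter_forall.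
by apply: ae_imp => t ht; apply: eq_bigr => j _.
Qed.

Lemma laplacianB k u v : torus_H k.+2 u -> torus_H k.+2 v ->
  laplacian (fun x => u x - v x) =ae (fun x => laplacian u x - laplacian v x).
Proof.
move=> hu hv.
have h j : wpartial j (wpartial j (fun x => u x - v x)) =ae
    (fun x => wpartial j (wpartial j u) x - wpartial j (wpartial j v) x).
  have hu1 := torus_H_wpartial j hu; have hv1 := torus_H_wpartial j hv.
  have huv := torus_H_wpartial j (torus_H_B hu hv).
  rewrite (wpartial_ae j (torus_H_L2 huv) (torus_H_L2 (torus_H_B hu1 hv1)) (wpartialB j hu hv)).
  exact: wpartialB hu1 hv1.
have := @ae_sum (index_enum _) (fun j => wpartial j (wpartial j (fun x => u x - v x)))
  (fun j x => wpartial j (wpartial j u) x - wpartial j (wpartial j v) x) h; apply: ae_imp => t /= h'.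
refine (etrans h' _); rewrite sumrB; reflexivity.
Qed.

Lemma wpartial_laplacianB i u v : torus_H 3 u -> torus_H 3 v ->
  wpartial i (laplacian (fun x => u x - v x)) =ae
  (fun x => wpartial i (laplacian u) x - wpartial i (laplacian v) x).
Proof.
move=> hu hv; have Lu := torus_H_laplacian hu; have Lv := torus_H_laplacian hv.
have Luv := torus_H_laplacian (torus_H_B hu hv).
have E : wpartial i (laplacian (fun x => u x - v x)) = wpartial i (fun x => laplacian u x - laplacian v x).
  exact (wpartial_ae i (torus_H_L2 Luv) (torus_H_L2 (torus_H_B Lu Lv)) (laplacianB hu hv)).
exact (eq_ind_r (fun F => F =ae (fun x => wpartial i (laplacian u) x - wpartial i (laplacian v) x))
  (@wpartialB R d 0 i (laplacian u) (laplacian v) Lu Lv) E).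
Qed.

Lemma torus_L2norm_sum (s : seq 'I_d) g : (forall j, tL2 (g j)) ->
  torus_L2norm (fun x => \sum_(j <- s) g j x) <= \sum_(j <- s) torus_L2norm (g j).
Proof.
move=> hg; elim: s => [|j s IH].
  have -> : (fun x => \sum_(j <- [::]) g j x) = (fun x => 0 * (cst 0 : 'rV[R]_d -> R) x).
    by apply/funext => x; rewrite big_nil mul0r.
  by rewrite torus_L2normZ ?normr0 ?mul0r ?big_nil//; exact: tL2_0.
have -> : (fun x => \sum_(i <- j :: s) g i x) = (fun x => g j x + \sum_(i <- s) g i x).
  by apply/funext => x; rewrite big_cons.
rewrite big_cons; apply: le_trans (torus_L2normD (hg j) (tL2_sum s hg)) _.
by rewrite lerD2l.
Qed.

Lemma wpartial_laplacian_norm i u : torus_H 3 u ->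
  torus_L2norm (wpartial i (laplacian u)) <= d%:R * torus_Hnorm 3 u.
Proof.
move=> hu.
have h2 j : torus_H 1 (wpartial j (wpartial j u)) by do 2 apply: torus_H_wpartial.
have h3 j := torus_H_L2 (torus_H_wpartial i (h2 j)).
rewrite (torus_L2norm_ae _ (tL2_sum (index_enum _) h3) (wpartial_sum i (index_enum _) h2)); last first.
  exact: torus_H_L2 (torus_H_wpartial i (torus_H_laplacian hu)).
apply: le_trans (torus_L2norm_sum (index_enum _) h3) _.
rewrite -[d in d%:R]card_ord -sum1_card natr_sum mulr_suml; apply: ler_sum => j _.
rewrite mul1r; apply: le_trans (torus_L2norm_le_Hnorm 0 _) _.
do 2 apply: le_trans (torus_Hnorm_wpartial _ _ _) _; exact: torus_Hnorm_wpartial.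
Qed.

Lemma wpartial_norm k i u : torus_L2norm (wpartial i u) <= torus_Hnorm k.+1 u.
Proof. exact: le_trans (torus_L2norm_le_Hnorm k _) (torus_Hnorm_wpartial _ _ _). Qed.

(** The splitting p q - p' q' = p' (q - q') + (p - p') q pairs the distance of the coefficients with
    the unperturbed [q]. The perturbed [p'] enters only through its sup bound. *)
Lemma wdiv_diff (p p' : 'rV[R]_d -> R) (q q' : 'I_d -> 'rV[R]_d -> R) (M eta eps B : R) v :
  Defs.periodic p -> continuous p -> Defs.periodic p' -> continuous p' ->
  (forall i, tL2 (q i)) -> (forall i, tL2 (q' i)) ->
  (forall x, `|p' x| <= M) -> (forall x, `|p x - p' x| <= eta) ->
  (forall i, torus_L2norm (fun x => q i x - q' i x) <= eps) -> (forall i, torus_L2norm (q i) <= B) ->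
  torus_H 1 v ->
  `|wdiv (fun i x => p x * q i x) v - wdiv (fun i x => p' x * q' i x) v| <=
    d%:R * (M * eps + eta * B) * torus_Hnorm 1 v.
Proof.
move=> pp cp pp' cp' Lq Lq' hM heta heps hB hv.
have M0 : 0 <= M by apply: le_trans (hM 0).
have eta0 : 0 <= eta by apply: le_trans (heta 0).
have mp := tL2_meas (tL2_cont pp cp); have mp' := tL2_meas (tL2_cont pp' cp').
have [Mp Mp0 hMp] := periodic_bounded pp cp.
have L1 i : tL2 (fun x => p x * q i x) := tL2_mulb pp mp (Lq i) hMp.
have L2' i : tL2 (fun x => p' x * q' i x) := tL2_mulb pp' mp' (Lq' i) hM.
have La i : tL2 (fun x => p' x * (q i x - q' i x)) := tL2_mulb pp' mp' (tL2_B (Lq i) (Lq' i)) hM.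
have mpp : measurable_fun setT ((fun x => p x - p' x) \o row) by exact: measurable_funB.
have Lb i : tL2 (fun x => (p x - p' x) * q i x).
  by apply: (tL2_mulb _ mpp (Lq i) heta) => j x; rewrite pp pp'.
have -> : wdiv (fun i x => p x * q i x) v - wdiv (fun i x => p' x * q' i x) v =
    wdiv (fun i x => p' x * (q i x - q' i x) + (p x - p' x) * q i x) v.
  have := wdiv_linl (-1) L2' L1 hv; rewrite mulN1r addrC => <-.
  by congr (wdiv _ v); apply/funext => i; apply/funext => x; ring.
have Lab i : tL2 (fun x => p' x * (q i x - q' i x) + (p x - p' x) * q i x) by exact: tL2_D.
apply: le_trans (wdiv_bound Lab hv) _; rewrite ler_wpM2r ?torus_Hnorm_ge0//.
rewrite -[d in d%:R]card_ord -sum1_card natr_sum mulr_suml; apply: ler_sum => i _.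
rewrite mul1r; apply: le_trans (torus_L2normD (La i) (Lb i)) _; apply: lerD.
- apply: le_trans (torus_L2norm_mulb mp' (tL2_B (Lq i) (Lq' i)) hM M0) _.
  by rewrite ler_wpM2l.
- by apply: le_trans (torus_L2norm_mulb mpp (Lq i) heta eta0) _; rewrite ler_wpM2l.
Qed.

Lemma Hm1norm_dist (l l' : ('rV[R]_d -> R) -> R) (K : R) : Hm1 l -> Hm1 l' -> 0 <= K ->
  (forall v, torus_H 1 v -> `|l v - l' v| <= K * torus_Hnorm 1 v) ->
  `|Hm1norm l - Hm1norm l'| <= K.
Proof.
move=> hl hl' K0 h.
have half l1 l2 : Hm1 l1 -> Hm1 l2 ->
    (forall v, torus_H 1 v -> `|l1 v - l2 v| <= K * torus_Hnorm 1 v) -> Hm1norm l1 <= Hm1norm l2 + K.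
  move=> h1 h2 h12; apply: Hm1norm_le; first by rewrite addr_ge0 ?Hm1norm_ge0.
  move=> v hv; rewrite mulrDl -[l1 v](subrK (l2 v)) addrC.
  by apply: le_trans (ler_normD _ _) _; rewrite lerD ?Hm1norm_bound ?h12.
have h1 := half _ _ hl hl' h.
have h2 : Hm1norm l' <= Hm1norm l + K by apply: half => // v hv; rewrite distrC; exact: h.
by rewrite ler_norml; move: h1 h2; move: (Hm1norm l) (Hm1norm l') => a b; lra.
Qed.

End Laplacian.

Section ItvClosure.
Context {R : realType}.
Local Notation H := (@itv_H2 R (-1) 1).
Implicit Types c : R -> R.

Lemma ltN11 : -1 < 1 :> R. Proof. by lra. Qed.

Lemma H2_lin (k : R) c c' : H c -> H c' -> H (fun s => k * c s + c' s).
Proof. by move=> hc hc'; have [] := itv_H2_lin ltN11 k hc hc'. Qed.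

Lemma H2_Z (k : R) c : H c -> H (fun s => k * c s).
Proof.
move=> hc; have := H2_lin (k - 1) hc hc; congr (H _).
by apply/funext => s; rewrite mulrBl mul1r subrK.
Qed.

Lemma H2_B c c' : H c -> H c' -> H (fun s => c s - c' s).
Proof.
move=> hc hc'; have := H2_lin (-1) hc' hc; congr (H _).
by apply/funext => s; rewrite mulN1r addrC.
Qed.

End ItvClosure.

(** * The operator and its residual at a fixed state *)

Section State.
Context {R : realType} {d : nat}.
Implicit Types (v w : 'rV[R]_d -> R) (i j : 'I_d) (c : R -> R).
Local Notation tL2 := (@torus_L2 R d).
Local Notation H := (@itv_H2 R (-1) 1).
Local Notation N := (@itv_H2norm R (-1) 1).
Variable u : 'rV[R]_d -> R.
Hypothesis cu : continuous u.
Hypothesis hu : torus_H 3 u.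
Hypothesis ur : forall x, u x \in `[-1, 1].
Variables (CE : R).
Hypothesis CE0 : 0 <= CE.
Hypothesis emb : forall c, H c -> (forall x, x \in `[-1, 1] -> `|c x| <= CE * N c) /\
  (forall x y, x \in `[-1, 1] -> y \in `[-1, 1] -> `|c x - c y| <= CE * N c * `|x - y|).

Let pu : Defs.periodic u := proj1 (torus_H_L2 hu).

Lemma coef_cont c : H c -> continuous (fun x => c (u x)).
Proof.
move=> hc x; have [_ lip] := emb hc.
apply/(@cvgrPdist_le _ _ _ (nbhs x) (nbhs_filter x)) => eps eps0.
pose K := CE * N c + 1.
have K0 : 0 < K by rewrite ltr_wpDl// mulr_ge0// sqrtr_ge0.
have /cvgrPdist_le/(_ (eps / K)) := @cu x.
move=> /(_ (divr_gt0 eps0 K0)); apply: filterS => y h.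
apply: le_trans (lip _ _ (ur x) (ur y)) _.
move: h; rewrite ler_pdivlMr// mulrC; apply: le_trans.
by rewrite ler_wpM2r// /K lerDl.
Qed.

Lemma coef_L2 c i : H c -> tL2 (fun x => c (u x) * wpartial i u x).
Proof.
move=> hc; have pc : Defs.periodic (fun x => c (u x)) by move=> j x; rewrite pu.
have [hb _] := emb hc; have mc := tL2_meas (tL2_cont pc (coef_cont hc)).
have [_ _ Lw _] := torus_HS i hu.
by apply: (tL2_mulb pc mc Lw (M := CE * N c)) => x; exact: hb.
Qed.

Lemma opT_lin k c c' v : H c -> H c' -> torus_H 1 v ->
  opT u (fun s => k * c s + c' s) v = k * opT u c v + opT u c' v.
Proof.
move=> hc hc' hv; rewrite /opT -(wdiv_linl k (fun i => coef_L2 i hc) (fun i => coef_L2 i hc') hv).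
by congr (wdiv _ v); apply/funext => i; apply/funext => x; ring.
Qed.

Lemma opT_bound c v : H c -> torus_H 1 v ->
  `|opT u c v| <= d%:R * torus_Hnorm 1 u * CE * N c * torus_Hnorm 1 v.
Proof.
move=> hc hv; apply: le_trans (wdiv_bound (fun i => coef_L2 i hc) hv) _.
rewrite ler_wpM2r ?torus_Hnorm_ge0//.
have pc : Defs.periodic (fun x => c (u x)) by move=> j x; rewrite pu.
have [hb _] := emb hc; have mc := tL2_meas (tL2_cont pc (coef_cont hc)).
have N0 : 0 <= CE * N c by rewrite mulr_ge0// sqrtr_ge0.
rewrite -!mulrA -[d in d%:R]card_ord -sum1_card natr_sum mulr_suml; apply: ler_sum => i _.
have [_ _ Lw _] := torus_HS i hu.
rewrite mul1r; apply: le_trans (torus_L2norm_mulb mc Lw (fun x => hb _ (ur x)) N0) _.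
by rewrite mulrC ler_wpM2r//; exact: wpartial_norm.
Qed.

Lemma Hm1_opT c : H c -> Hm1 (opT u c).
Proof. by move=> hc; apply: Hm1_wdiv => i; exact: coef_L2. Qed.

Variables (gamma : R) (b : R -> R) (du : ('rV[R]_d -> R) -> R).
Hypothesis cb : continuous b.
Hypothesis hdu : Hm1 du.
Let y := rhs gamma b u du.

Lemma mobility_cont : continuous (fun x => b (u x)).
Proof. by move=> x; apply: (@continuous_comp _ _ _ u b); [exact: cu|exact: cb]. Qed.

Lemma flux_L2 i : tL2 (wpartial i (laplacian u)).
Proof. exact: torus_H_L2 (torus_H_wpartial i (torus_H_laplacian hu)). Qed.

Lemma mobility_L2 i : tL2 (fun x => b (u x) * wpartial i (laplacian u) x).
Proof.
have pb : Defs.periodic (fun x => b (u x)) by move=> j x; rewrite pu.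
have [M M0 hM] := periodic_bounded pb mobility_cont.
exact: (tL2_mulb pb (tL2_meas (tL2_cont pb mobility_cont)) (flux_L2 i) hM).
Qed.

Lemma Hm1_rhs : Hm1 y.
Proof. by apply: Hm1_D => //; apply: Hm1_Z; apply: Hm1_wdiv => i; exact: mobility_L2. Qed.

Lemma Hm1_residual c : H c -> Hm1 (opT u c \- y).
Proof. by move=> hc; apply: Hm1_B; [exact: Hm1_opT|exact: Hm1_rhs]. Qed.

Lemma opTZ k c v : H c -> torus_H 1 v -> opT u (fun s => k * c s) v = k * opT u c v.
Proof.
move=> hc hv; have := opT_lin (k - 1) hc hc hv; rewrite mulrBl mul1r subrK => <-.
by congr (opT u _ v); apply/funext => s; rewrite mulrBl mul1r subrK.
Qed.

Lemma opTB c c' v : H c -> H c' -> torus_H 1 v ->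
  opT u (fun s => c s - c' s) v = opT u c v - opT u c' v.
Proof.
move=> hc hc' hv; have := opT_lin (-1) hc' hc hv; rewrite mulN1r addrC => <-.
by congr (opT u _ v); apply/funext => s; rewrite mulN1r addrC.
Qed.

(** Midpoint convexity is linearity of [opT] in [c] with subadditivity of the dual norm; the
    Lipschitz constant is the operator bound of [opT_bound]. The type [R -> R^o] carries the
    pointwise vector space structure. *)
Lemma residual_opT : residual (E := (R -> R^o : lmodType R)) H N (fun c => Hm1norm (opT u c \- y)).
Proof.
split.
- by move=> c hc; apply: Hm1norm_ge0; exact: Hm1_residual.
- move=> c c' hc hc'; have h1 := Hm1_residual hc; have h2 := Hm1_residual hc'.
  have n1 := Hm1norm_ge0 h1; have n2 := Hm1norm_ge0 h2.
  apply: Hm1norm_le; first by rewrite divr_ge0// addr_ge0.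
  move=> v hv.
  have -> : (opT u (2^-1 *: ((c : R -> R^o) + c')) \- y) v =
      ((opT u c \- y) v + (opT u c' \- y) v) / 2.
    have := opT_lin 2^-1 hc (H2_Z 2^-1 hc') hv; rewrite (opTZ 2^-1 hc' hv) => E.
    transitivity (2^-1 * opT u c v + 2^-1 * opT u c' v - y v); last by rewrite /=; field.
    rewrite -E; congr (opT u _ v - y v); apply/funext => s; exact: mulrDr.
  rewrite normrM [X in _ * X]ger0_norm ?invr_ge0// mulrAC ler_wpM2r ?invr_ge0//.
  by apply: le_trans (ler_normD _ _) _; rewrite mulrDl lerD// Hm1norm_bound.
- exists (d%:R * torus_Hnorm 1 u * CE) => c c' hc hc'.
  have hcc := H2_B hc hc'.
  apply: Hm1norm_dist; [exact: Hm1_residual|exact: Hm1_residual| |].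
    by rewrite !mulr_ge0 ?torus_Hnorm_ge0// sqrtr_ge0.
  move=> v hv; have := opT_bound hcc hv; congr (`|_| <= _).
  by rewrite opTB//=; ring.
Qed.

End State.

Section RealCk.
Context {R : realType}.
Implicit Types (g b f F : R -> R).

Lemma Ck_real_is_derive k g j (s : R) : Ck_real k g -> (j < k)%N ->
  is_derive s 1 (g^`(j)%classic) (g^`(j.+1)%classic s).
Proof. by move=> [dg _] jk; rewrite derive1nS; exact: is_derive_derive1 (dg _ jk s). Qed.

Lemma lipschitz_bound g (g' : R -> R) (L : R) : (forall s : R, is_derive s 1 g (g' s)) ->
  (forall s, `|g' s| <= L) -> forall s r, `|g s - g r| <= L * `|s - r|.
Proof.
move=> dg hL; have cg : continuous g by move=> s; exact: is_derive_continuous (dg s).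
have main s r : r <= s -> `|g s - g r| <= L * `|s - r|.
  move=> rs; have [c _ ->] := MVT_segment rs (fun x _ => dg x) (cont_within cg).
  by rewrite normrM ler_wpM2r.
move=> s r; have [rs|/ltW sr] := leP r s; first exact: main.
by rewrite distrC (distrC s); exact: main.
Qed.

(** Since f = F', the coefficient b f' is b F''. Two further derivatives use up both the C^2
    regularity of [b] and the C^4 regularity of [F]. *)
Lemma coef_H2 b F : Ck_real 2 b -> Ck_real 4 F ->
  itv_H2 (-1) 1 (fun s => b s * F^`(2)%classic s).
Proof.
move=> hb hF.
have b0 (s : R) : is_derive s 1 b (b^`(1)%classic s) by exact: (@Ck_real_is_derive 2 b 0 s hb).
have b1 (s : R) : is_derive s 1 (b^`(1)%classic) (b^`(2)%classic s) by exact: (@Ck_real_is_derive 2 b 1 s hb).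
have F2 (s : R) : is_derive s 1 (F^`(2)%classic) (F^`(3)%classic s) by exact: (@Ck_real_is_derive 4 F 2 s hF).
have F3 (s : R) : is_derive s 1 (F^`(3)%classic) (F^`(4)%classic s) by exact: (@Ck_real_is_derive 4 F 3 s hF).
pose u' s := b s * F^`(3)%classic s + F^`(2)%classic s * b^`(1)%classic s.
pose u'' s := (b s * F^`(4)%classic s + F^`(3)%classic s * b^`(1)%classic s) +
  (F^`(2)%classic s * b^`(2)%classic s + b^`(1)%classic s * F^`(3)%classic s).
have cM (p q : R -> R) : continuous p -> continuous q -> continuous (fun s => p s * q s).
  by move=> cp cq s; apply: cvgM; [exact: cp|exact: cq].
have cD (p q : R -> R) : continuous p -> continuous q -> continuous (fun s => p s + q s).
  by move=> cp cq s; apply: cvgD; [exact: cp|exact: cq].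
have d1 (s : R) : is_derive s 1 (fun s => b s * F^`(2)%classic s) (u' s).
  exact: is_deriveM (b0 s) (F2 s).
have d2 (s : R) : is_derive s 1 u' (u'' s).
  exact: is_deriveD (is_deriveM (b0 s) (F3 s)) (is_deriveM (F2 s) (b1 s)).
have cu'' : continuous u''.
  have [_ cb] := hb; have [_ cF] := hF.
  have c0 : continuous b := cb 0%N isT; have c1 := cb 1%N isT; have c2 := cb 2 isT.
  have C2 := cF 2 isT; have C3 := cF 3 isT; have C4 := cF 4 isT.
  apply: (cD _ _ (cD _ _ (cM _ _ c0 C4) (cM _ _ C3 c1)) (cD _ _ (cM _ _ C2 c2) (cM _ _ c1 C3))).
exact: (C2_itv_H2 ltN11 d1 d2 cu'').
Qed.

End RealCk.

Section Exact.
Context {R : realType} {d : nat}.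
Local Notation tL2 := (@torus_L2 R d).

(** The flux b grad mu splits into - gamma b grad Delta u, which [rhs] moves to the other side, and
    b grad f(u), which the chain rule turns into b f'(u) grad u. *)
Lemma exact_coef (gamma : R) (b f f' : R -> R) (u : 'rV[R]_d -> R) (du : ('rV[R]_d -> R) -> R) :
  continuous b -> (forall s : R, is_derive s 1 f (f' s)) -> continuous f' -> continuous u -> torus_H 3 u ->
  CH_at gamma b f u du ->
  Hm1_eq (opT u (fun s => b s * f' s)) (rhs gamma b u du).
Proof.
move=> cb df cf' cu hu [hmu hdu] v hv.
have pu : Defs.periodic u := proj1 (torus_H_L2 hu).
have pb : Defs.periodic (fun x => b (u x)) by move=> j x; rewrite pu.
have cbu : continuous (fun x => b (u x)).
  by move=> x; apply: (@continuous_comp _ _ _ u b); [exact: cu|exact: cb].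
have [M M0 hM] := periodic_bounded pb cbu.
have mb := tL2_meas (tL2_cont pb cbu).
have Lw i : tL2 (wpartial i u) by have [_ _ L _] := torus_HS i hu.
have ch i : tL2 (fun x => f' (u x) * wpartial i u x) /\
    is_wpartial i (fun x => f (u x)) (fun x => f' (u x) * wpartial i u x).
  by have [_ _ _ hw] := torus_HS i hu; exact: chain_rule.
have Lf i := proj1 (ch i).
have hl := torus_H_laplacian hu.
have Ld i := torus_H_L2 (torus_H_wpartial i hl).
have cfu : continuous (fun x => f (u x)).
  by move=> x; apply: (@continuous_comp _ _ _ u f); [exact: cu|exact: is_derive_continuous (df _)].
have Lfu : tL2 (fun x => f (u x)) by apply: tL2_cont => // j x; rewrite pu.
have mui i : \forall t \ae cell_measure R d,
    wpartial i (chem_potential gamma f u) (row_of_tuple t) =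
    - gamma * wpartial i (laplacian u) (row_of_tuple t) +
    f' (u (row_of_tuple t)) * wpartial i u (row_of_tuple t).
  have hf : has_wpartial i (fun x => f (u x)) by eexists; exact: (ch i).
  have [hlw _ _ _] := torus_HS i hl.
  have [_ ae] := wpartial_lin (- gamma) (torus_H_L2 hl) Lfu hlw hf.
  have ae2 := wpartialE (Lf i) (proj2 (ch i)).
  by apply: filterS2 ae ae2 => t h1 h2; refine (etrans h1 _); rewrite h2.
have Lb g : tL2 g -> tL2 (fun x => b (u x) * g x) by move=> Lg; exact: (tL2_mulb pb mb Lg hM).
have Lmu i := torus_H_L2 (torus_H_wpartial i hmu).
rewrite /rhs /= hdu//.
have -> : wdiv (fun i x => b (u x) * wpartial i (chem_potential gamma f u) x) v =
    wdiv (fun i x => - gamma * (b (u x) * wpartial i (laplacian u) x) +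
      b (u x) * (f' (u x) * wpartial i u x)) v.
  apply: wdiv_ae => //.
  - by move=> i; apply: Lb; exact: Lmu.
  - by move=> i; apply: tL2_lin; apply: Lb; [exact: Ld|exact: Lf].
  by move=> i; apply: ae_imp (mui i) => t ->; ring.
rewrite (wdiv_linl (- gamma) (fun i => Lb _ (Ld i)) (fun i => Lb _ (Lf i)) hv).
rewrite mulNr addrC addrA subrr add0r /opT.
by congr (wdiv _ v); apply/funext => i; apply/funext => x; rewrite mulrA.
Qed.

End Exact.

(** * Stability of the residual under noise *)

Section Perturbation.
Context {R : realType} {d : nat}.
Local Notation tL2 := (@torus_L2 R d).
Local Notation H := (@itv_H2 R (-1) 1).
Local Notation N := (@itv_H2norm R (-1) 1).

Lemma collect_bound (x y delta n : R) : 0 <= x -> 0 <= y -> 0 <= delta -> 0 <= n ->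
  delta * n * x + delta * y <= (x + y) * delta * (1 + n).
Proof.
move=> x0 y0 d0 n0; rewrite -subr_ge0.
have -> : (x + y) * delta * (1 + n) - (delta * n * x + delta * y) = x * delta + y * delta * n by ring.
by rewrite addr_ge0 ?mulr_ge0.
Qed.

Lemma residual_diff_bound (gamma a1 a2 l1 l2 e1 e2 A1 A2 A3 : R) :
  `|a1 - a2| <= A1 -> `|l1 - l2| <= A2 -> `|e1 - e2| <= A3 ->
  `|a2 - (l2 + gamma * e2) - (a1 - (l1 + gamma * e1))| <= A1 + A2 + `|gamma| * A3.
Proof.
move=> T1 T2 T3.
have -> : a2 - (l2 + gamma * e2) - (a1 - (l1 + gamma * e1)) =
    - (a1 - a2) + (l1 - l2) + gamma * (e1 - e2) by ring.
apply: le_trans (ler_normD _ _) _; apply: le_trans (lerD (ler_normD _ _) (lexx _)) _.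
rewrite normrN normrM; exact: (lerD (lerD T1 T2) (ler_wpM2l (normr_ge0 gamma) T3)).
Qed.

Variables (CE : R).
Hypothesis CE0 : 0 <= CE.
Hypothesis emb : forall c, H c -> (forall x, x \in `[-1, 1] -> `|c x| <= CE * N c) /\
  (forall x y, x \in `[-1, 1] -> y \in `[-1, 1] -> `|c x - c y| <= CE * N c * `|x - y|).

(** Three differences add up: of the [opT] terms, of the time derivatives and of the mobility
    fluxes. Only the first grows with [c]. The H^3 norm in the constant is that of [u], the exact
    state, so the constant does not depend on the noise level or on the data [w]. *)
Lemma perturbation (gamma beta L delta : R) (b c : R -> R) (u w : 'rV[R]_d -> R)
    (du dw : ('rV[R]_d -> R) -> R) :
  continuous b -> (forall s, `|b s| <= beta) -> (forall s r, `|b s - b r| <= L * `|s - r|) ->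
  0 <= delta -> H c -> 0 <= L ->
  continuous u -> torus_H 3 u -> (forall x, u x \in `[-1, 1]) -> Hm1 du ->
  continuous w -> torus_H 3 w -> (forall x, w x \in `[-1, 1]) -> Hm1 dw ->
  torus_Hnorm 3 (u \- w) <= delta -> Hm1norm (du \- dw) <= delta ->
  (forall x, `|u x - w x| <= 8 * delta) ->
  `|Hm1norm (opT w c \- rhs gamma b w dw) - Hm1norm (opT u c \- rhs gamma b u du)| <=
    (d%:R * CE * (1 + 8 * torus_Hnorm 3 u) +
     (1 + `|gamma| * (d%:R * (beta * d%:R + 8 * L * (d%:R * torus_Hnorm 3 u))))) * delta * (1 + N c).
Proof.
move=> cb hbeta hL d0 hc L0 cu hu ur hdu cw hw wr hdw nuw ndu suw.
have pu : Defs.periodic u := proj1 (torus_H_L2 hu).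
have pw : Defs.periodic w := proj1 (torus_H_L2 hw).
have [cb1 cb2] := emb hc.
have N0 : 0 <= N c by exact: sqrtr_ge0.
have B0 := torus_Hnorm_ge0 3 u.
have beta0 : 0 <= beta by apply: le_trans (hbeta 0).
have h3 := torus_H_B hu hw.
have Lu i : tL2 (wpartial i u) by have [] := torus_HS i hu.
have Lw i : tL2 (wpartial i w) by have [] := torus_HS i hw.
have comp (g : R -> R) (z : 'rV[R]_d -> R) : continuous g -> continuous z -> continuous (fun x => g (z x)).
  by move=> cg cz x; apply: (@continuous_comp _ _ _ z g); [exact: cz|exact: cg].
have dpartial i : torus_L2norm (fun x => wpartial i u x - wpartial i w x) <= delta.
  rewrite -(torus_L2norm_ae _ (tL2_B (Lu i) (Lw i)) (wpartialB i hu hw)).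
    by apply: le_trans nuw; exact: wpartial_norm.
  exact: torus_H_L2 (torus_H_wpartial i h3).
have dflux i : torus_L2norm (fun x => wpartial i (laplacian u) x - wpartial i (laplacian w) x) <= d%:R * delta.
  rewrite -(torus_L2norm_ae _ (tL2_B (flux_L2 hu i) (flux_L2 hw i)) (wpartial_laplacianB i hu hw)).
    apply: le_trans (wpartial_laplacian_norm i h3) _; rewrite ler_wpM2l//; exact: nuw.
  exact: flux_L2 h3 i.
set K := _ * delta * _.
have K0 : 0 <= K.
  by rewrite /K !mulr_ge0 ?addr_ge0 ?mulr_ge0 ?addr_ge0 ?mulr_ge0 ?normr_ge0.
apply: Hm1norm_dist.
- exact: (Hm1_residual cw hw wr CE0 emb gamma cb hdw hc).
- exact: (Hm1_residual cu hu ur CE0 emb gamma cb hdu hc).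
- exact: K0.
move=> v hv; have Hv0 := torus_Hnorm_ge0 1 v.
have T1 := @wdiv_diff R d (fun x => c (u x)) (fun x => c (w x)) (fun i => wpartial i u)
  (fun i => wpartial i w) (CE * N c) (CE * N c * (8 * delta)) delta (torus_Hnorm 3 u) v.
have {}T1 : `|opT u c v - opT w c v| <=
    d%:R * (CE * N c * delta + CE * N c * (8 * delta) * torus_Hnorm 3 u) * torus_Hnorm 1 v.
  apply: T1 => //.
  - by move=> j x; rewrite pu.
  - exact: (coef_cont cu ur CE0 emb hc).
  - by move=> j x; rewrite pw.
  - exact: (coef_cont cw wr CE0 emb hc).
  - by move=> x; exact: cb1.
  - move=> x; apply: le_trans (cb2 _ _ (ur x) (wr x)) _.
    by rewrite ler_wpM2l// mulr_ge0.
  - by move=> i; exact: wpartial_norm.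
have T2 := Hm1norm_bound (Hm1_B hdu hdw) hv.
have {}T2 : `|du v - dw v| <= delta * torus_Hnorm 1 v.
  by apply: le_trans T2 _; rewrite ler_wpM2r.
have T3 := @wdiv_diff R d (fun x => b (u x)) (fun x => b (w x)) (fun i => wpartial i (laplacian u))
  (fun i => wpartial i (laplacian w)) beta (L * (8 * delta)) (d%:R * delta) (d%:R * torus_Hnorm 3 u) v.
have {}T3 : `|wdiv (fun i x => b (u x) * wpartial i (laplacian u) x) v -
      wdiv (fun i x => b (w x) * wpartial i (laplacian w) x) v| <=
    d%:R * (beta * (d%:R * delta) + L * (8 * delta) * (d%:R * torus_Hnorm 3 u)) * torus_Hnorm 1 v.
  apply: T3 => //.
  - by move=> j x; rewrite pu.
  - exact: comp.
  - by move=> j x; rewrite pw.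
  - exact: comp.
  - exact: flux_L2.
  - exact: flux_L2.
  - by move=> x; apply: le_trans (hL _ _) _; rewrite ler_wpM2l.
  - by move=> i; exact: wpartial_laplacian_norm.
refine (le_trans (residual_diff_bound gamma T1 T2 T3) _).
have E : d%:R * (CE * N c * delta + CE * N c * (8 * delta) * torus_Hnorm 3 u) * torus_Hnorm 1 v +
   delta * torus_Hnorm 1 v + `|gamma| * (d%:R * (beta * (d%:R * delta) +
     L * (8 * delta) * (d%:R * torus_Hnorm 3 u)) * torus_Hnorm 1 v) =
   (delta * N c * (d%:R * CE * (1 + 8 * torus_Hnorm 3 u)) + delta *
     (1 + `|gamma| * (d%:R * (beta * d%:R + 8 * L * (d%:R * torus_Hnorm 3 u))))) * torus_Hnorm 1 v by ring.
rewrite E ler_wpM2r// /K; apply: collect_bound => //.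
  by rewrite !mulr_ge0 ?addr_ge0 ?mulr_ge0.
by rewrite addr_ge0// !mulr_ge0 ?addr_ge0 ?mulr_ge0 ?normr_ge0.
Qed.

End Perturbation.

(** * Convergence of the regularized coefficients *)

Theorem mainTheorem6 (R : realType) (d : nat) (hd : (1 <= d <= 3)%N)
  (b f : R -> R) (gamma T : R)
  (hB : assumption_B b) (hF : assumption_F f) (hgamma : 0 < gamma)
  (phi : R -> 'rV[R]_d -> R) (dphi : R -> ('rV[R]_d -> R) -> R)
  (hsol : CH_solution T gamma b f phi dphi)
  (t : R) (ht : 0 < t < T)
  (* H^3 is contained in C^0 as d <= 3: continuous representatives are taken *)
  (hphi : torus_H 3 (phi t)) (hphic : continuous (phi t))
  (hdphi : Hm1 (dphi t))
  (hCHt : CH_at gamma b f (phi t) (dphi t))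
  (phid : R -> 'rV[R]_d -> R) (dphid : R -> ('rV[R]_d -> R) -> R)
  (hphid : forall delta, 0 < delta ->
    torus_H 3 (phid delta) /\ continuous (phid delta))
  (hdphid : forall delta, 0 < delta -> Hm1 (dphid delta))
  (hrange : forall delta, 0 < delta -> forall x, -1 < phid delta x < 1)
  (hnoise : forall delta, 0 < delta ->
    torus_Hnorm 3 (phi t \- phid delta) <= delta)
  (hdnoise : forall delta, 0 < delta ->
    Hm1norm (dphi t \- dphid delta) <= delta) :
  let y := rhs gamma b (phi t) (dphi t) in
  let yd := fun delta => rhs gamma b (phid delta) (dphid delta) in
  (* the minimizers are well defined *)
  (forall delta alpha, 0 < delta -> 0 < alpha ->
    exists c, tikhonov_minimizer (phid delta) (yd delta) alpha c /\
      forall c', tikhonov_minimizer (phid delta) (yd delta) alpha c' ->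
        {in `[-1, 1], c' =1 c}) /\
  (* so is the minimum-norm solution, and the minimizers converge to it *)
  exists cdag,
    [/\ min_norm_solution (phi t) y cdag,
        forall c', min_norm_solution (phi t) y c' ->
          {in `[-1, 1], c' =1 cdag} &
        forall (alpha : R -> R) (c : R -> R -> R),
          (forall delta, 0 < delta -> 0 < alpha delta) ->
          alpha delta @[delta --> 0^'+] --> (0 : R) ->
          delta ^+ 2 / alpha delta @[delta --> 0^'+] --> (0 : R) ->
          (forall delta, 0 < delta ->
            tikhonov_minimizer (phid delta) (yd delta) (alpha delta)
              (c delta)) ->
          itv_H2norm (-1) 1 (c delta \- cdag) @[delta --> 0^'+] --> (0 : R)].
Proof.
move=> y yd; have hF' := hF; clear hF.
have /andP[_ d3] := hd.
have [hB2 [beta1 [beta2 [beta3 [beta4 [beta10 hbeta]]]]]] := hB.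
have [F [kap [pp [qq [hF fE _ _ _]]]]] := hF'.
have [CE CE0 emb] := @H2_embedding R (-1) 1 ltN11.
have cb : continuous b by have [_ h] := hB2; exact: (h 0%N isT).
have bb s : `|b s| <= beta2.
  have [h1 h2 _ _] := hbeta s; rewrite ger0_norm//; exact: le_trans (ltW beta10) h1.
have db (s : R) : is_derive s 1 b (b^`()%classic s) by exact: (@Ck_real_is_derive R 2 b 0 s hB2).
have hL : forall s r, `|b s - b r| <= beta3 * `|s - r|.
  by apply: (lipschitz_bound db) => s; have [] := hbeta s.
have beta30 : 0 <= beta3 by have [_ _ h _] := hbeta 0; exact: le_trans h.
have Sob delta : 0 < delta -> forall x, `|phi t x - phid delta x| <= 8 * delta.
  move=> dp x; have [h3 c3] := hphid _ dp.
  have cc : continuous (fun x => phi t x + -1 * phid delta x).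
    by apply: addcont => //; apply: mulcont => //; exact: cst_continuous.
  have E : (fun x => phi t x + -1 * phid delta x) = phi t \- phid delta.
    by apply/funext => z; rewrite mulN1r.
  rewrite E in cc.
  apply: le_trans (Sobolev x d3 cc (torus_H_B hphi h3)) _.
  by rewrite ler_wpM2l// hnoise.
have rd delta x : 0 < delta -> phid delta x \in `[-1, 1].
  by move=> dp; rewrite in_itv/=; have /andP[h1 h2] := hrange _ dp x; rewrite !ltW.
(* The exact values are within [8 * delta] of ]-1, 1[ for every [delta], which leaves the closed
   interval in the limit. *)
have rphi x : phi t x \in `[-1, 1].
  rewrite in_itv/= -ler_norml; apply/ler_addgt0Pr => e e0.
  have d0 : 0 < e / 8 by rewrite divr_gt0.
  have := Sob _ d0 x; have := hrange _ d0 x.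
  have -> : 8 * (e / 8) = e by field.
  move: (phi t x) (phid _ x) => p q /andP[q1 q2]; rewrite !ler_norml; lra.
pose H := @itv_H2 R (-1) 1; pose N := @itv_H2norm R (-1) 1.
(* The abstract space consists of all functions, with [H] cutting out the Sobolev space. Values
   outside [-1, 1] are invisible to [N], so distance zero means equality on [-1, 1] only, as in
   [N0eq]. *)
pose E := (R -> R^o : lmodType R).
have H_lin (a : R) (p q : E) : H p -> H q -> H (a *: p + q) by exact: H2_lin.
have N_ge0 (p : E) : 0 <= N p by exact: sqrtr_ge0.
have NZ (a : R) (p : E) : H p -> N (a *: p) = `|a| * N p by exact: H2normZ.
have ND (p q : E) : H p -> H q -> N (p + q) <= N p + N q by exact: H2normD.
have Npar (p q : E) : H p -> H q -> N (p + q) ^+ 2 + N (p - q) ^+ 2 = 2 * N p ^+ 2 + 2 * N q ^+ 2.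
  exact: H2_parallelogram.
have Ncomp (c : nat -> E) : (forall n, H (c n)) -> (forall n, N (c n.+1 - c n) <= 2^-1 ^+ n) ->
    exists l, H l /\ N (c n - l) @[n --> \oo] --> (0 : R) by exact: (H2_complete ltN11).
(* The exact coefficient b f'. It proves solvability of T c = y and also serves as a first element
   for the existence of minimizers. *)
pose c0 (s : R) := b s * F^`(2)%classic s.
have Hc0 : H c0 by exact: coef_H2.
have N0eq (c c' : E) : H c -> H c' -> N (c' - c) = 0 -> {in `[-1, 1], c' =1 c}.
  move=> hc hc' h x xi; have [h1 _] := emb _ (H2_B hc' hc).
  have h' : itv_H2norm (-1) 1 (fun s => c' s - c s) = 0 := h.
  have := h1 x xi; rewrite h' mulr0 normr_le0 subr_eq0.
  by move=> /eqP.
have resd delta : 0 < delta -> residual (E := E) H N (fun c => Hm1norm (opT (phid delta) c \- yd delta)).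
  move=> dp; have [h3 c3] := hphid _ dp.
  exact: (residual_opT c3 h3 (fun x => rd _ x dp) CE0 emb gamma cb (hdphid _ dp)).
have res0 : residual (E := E) H N (fun c => Hm1norm (opT (phi t) c \- y)).
  exact: (residual_opT hphic hphi rphi CE0 emb gamma cb hdphi).
have Hopt c : H c -> Hm1 (opT (phi t) c) by exact: (Hm1_opT hphic hphi rphi CE0 emb).
have Hy : Hm1 y by exact: (Hm1_rhs hphic hphi gamma cb hdphi).
split.
  move=> delta alpha dp ap.
  have [c [hc cmin cuniq]] := tikhonov_exists H_lin N_ge0 NZ ND Npar Ncomp (resd _ dp) ap Hc0.
  exists c; split; first exact (conj hc cmin).
  by move=> c' [hc' hmin]; exact (N0eq c c' hc hc' (cuniq c' hc' hmin)).
have dF1 (s : R) : is_derive s 1 f (F^`(2)%classic s).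
  by rewrite fE; exact: (@Ck_real_is_derive R 4 F 1 s hF).
have cF2 : continuous (F^`(2)%classic) by have [_ h] := hF; exact: (h 2 isT).
have S00 : Hm1norm (opT (phi t) c0 \- y) = 0.
  apply/eqP; rewrite eq_le Hm1norm_ge0 ?andbT; last exact: Hm1_B (Hopt _ Hc0) Hy.
  by apply: Hm1_eq_norm; exact: exact_coef.
have beta20 : 0 <= beta2 by exact: le_trans (bb 0).
pose B := torus_Hnorm 3 (phi t).
have B0 : 0 <= B by exact: torus_Hnorm_ge0.
(* The constant of [perturbation], with [beta2] bounding b and [beta3] its Lipschitz constant. *)
pose C := d%:R * CE * (1 + 8 * B) + (1 + `|gamma| * (d%:R * (beta2 * d%:R + 8 * beta3 * (d%:R * B)))).
have C0 : 0 <= C by rewrite /C !addr_ge0 ?mulr_ge0 ?addr_ge0 ?mulr_ge0.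
have [p [Hp Sp pmin puniq pcvg]] := tikhonov_cvg H_lin N_ge0 NZ ND Npar Ncomp
  (S := fun delta c => Hm1norm (opT (phid delta) c \- yd delta)) res0 C0 Hc0 S00
  (fun delta c dp hc => let: And3 h _ _ := resd _ dp in h c hc)
  (fun delta c dp hc => perturbation CE0 emb gamma cb bb hL (ltW dp) hc beta30 hphic hphi rphi hdphi
    (proj2 (hphid _ dp)) (proj1 (hphid _ dp)) (fun x => rd _ x dp) (hdphid _ dp) (hnoise _ dp)
    (hdnoise _ dp) (Sob _ dp)).
have S0P c : H c -> Hm1_eq (opT (phi t) c) y -> Hm1norm (opT (phi t) c \- y) = 0.
  move=> hc h; apply/eqP; rewrite eq_le Hm1_eq_norm// Hm1norm_ge0//; exact: Hm1_B (Hopt _ hc) Hy.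
have S0P' c : H c -> Hm1norm (opT (phi t) c \- y) = 0 -> Hm1_eq (opT (phi t) c) y.
  by move=> hc h; exact: Hm1norm_eq0 (Hopt _ hc) Hy h.
exists p; split.
- by split; [exact: Hp|exact: S0P'|move=> c' hc' h; apply: pmin => //; exact: S0P].
- move=> c' [hc' h hmin].
  exact (N0eq p c' Hp hc' (puniq c' hc' (S0P c' hc' h) (hmin p Hp (S0P' p Hp Sp)))).
- by move=> alpha c a0 acvg dacvg cm; exact (pcvg alpha c a0 acvg dacvg cm).
Qed.
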